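(* Let $\pi_1\in\mathrm{NC}_{n_1}$ and $\pi_2\in\mathrm{NC}_{n_2}$ be noncrossing matchings, let $n=n_1+n_2$ and $\pi=\pi_1\pi_2\in\mathrm{NC}_n$, and set $q=e^{2\pi i/3}$. The wheel polynomial $$\Psi_{\rho^{n_2}(\pi_1\pi_2)}(z_1,\dots,z_{2n})=\Psi_{\pi_1\pi_2}(z_{2n+1-n_2},\dots,z_{2n},z_1,\dots,z_{2n-n_2})$$ can be expressed as a linear combination (with coefficients in $\mathbb{Q}(q)$) of the polynomials $D_{\tau_1,\tau_2}$ with $\tau_1\in\mathrm{NC}_{n_1}$, $\tau_2\in\mathrm{NC}_{n_2}$, $\tau_1\le\pi_1$, $\tau_2\le\pi_2$, in which the coefficient of $D_{\pi_1,\pi_2}$ is $1$.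
   Context: Noncrossing matchings: $\mathrm{NC}_n$ is the set of noncrossing matchings of size $n$, i.e. of systems of $n$ pairwise noncrossing arches above a line on $2n$ points labelled $1,\dots,2n$ from left to right, each point being an endpoint of exactly one arch. $\sigma\pi$ denotes concatenation ($\sigma$ to the left of $\pi$), $(\pi)_k$ is $\pi$ surrounded by $k$ nested arches, and $()_n\in\mathrm{NC}_n$ consists of $n$ nested arches. The rotation $\rho:\mathrm{NC}_n\to\mathrm{NC}_n$ is defined by: $i$ and $j$ are connected in $\rho(\pi)$ iff $i-1$ and $j-1$ are connected in $\pi$ (labels modulo $2n$). For $\pi\in\mathrm{NC}_n$, the Young diagram $\lambda(\pi)$ is the area between two lattice paths with the same endpoints: the first consists of $n$ north-steps followed by $n$ east-steps; the second is obtained by reading the labels $1,\dots,2n$ in order, drawing a north-step for a left endpoint of an arch and an east-step otherwise. The map $\pi\mapsto\lambda(\pi)$ is a bijection from $\mathrm{NC}_n$ to the Young diagrams (partitions $(\lambda_1,\dots,\lambda_l)$, $\lambda_r$ the number of boxes in the $r$-th row from the top) whose $r$-th row has at most $n-r$ boxes for $1\le r\le n$; moreover $\lambda((\pi)_k)=\lambda(\pi)$. Partial order: $\sigma\le\pi$ iff $\lambda(\sigma)\subseteq\lambda(\pi)$. For elements of $\mathrm{NC}_n$ the box in row $r$ and column $c$ lies on the diagonal labelled $n+c-r$. Write $\sigma\nearrow_j\pi$ if $\lambda(\pi)$ is obtained from $\lambda(\sigma)$ by adding one box on the $j$-th diagonal ($2\le j\le 2n-2$). Operators $e_j$ on matchings: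 for $1\le j\le 2n$, $e_j:\mathrm{NC}_n\to\mathrm{NC}_n$; $e_j(\pi)$ is obtained from $\pi$ by deleting the arches incident to $j$ and $j+1$ and adding an arch between $j$ and $j+1$ and an arch between the points formerly connected to $j$ and $j+1$ (if $j,j+1$ are connected in $\pi$, then $e_j(\pi)=\pi$); $2n+1$ is identified with $1$. $e_j^{-1}(\sigma)$ denotes the preimage of $\sigma$ in $\mathrm{NC}_n$. Operators on polynomials in $z_1,\dots,z_{2n}$: for $1\le k\le 2n$ (with $z_{2n+1}:=z_1$), $\mathbf{S}_k$ interchanges the variables $z_k$ and $z_{k+1}$, and $\mathbf{D}_k(f)=\frac{qz_k-q^{-1}z_{k+1}}{z_{k+1}-z_k}(\mathbf{S}_k(f)-f)$. For all integers $k$ set $\mathbf{D}_{k+2n}:=\mathbf{D}_k$. A product $\prod_{i=1}^N\mathbf{D}_{a_i}$ means $\mathbf{D}_{a_1}\circ\cdots\circ\mathbf{D}_{a_N}$. Wheel polynomials of order $n$ are the homogeneous polynomials $p$ of degree $n(n-1)$ in $z_1,\dots,z_{2n}$ with $p|_{q^4z_i=q^2z_j=z_k}=0$ for all $1\le i<j<k\le 2n$. The polynomials $\Psi_\pi$, $\pi\in\mathrm{NC}_n$: $\Psi_{()_n}:=(q-q^{-1})^{-n(n-1)}\prod_{1\le i<j\le n}(qz_i-q^{-1}z_j)(qz_{n+i}-q^{-1}z_{n+j})$, and whenever $\sigma\nearrow_j\pi$, $$\Psi_\pi:=\mathbf{D}_j(\Psi_\sigma)-\sum_{\tau\in e_j^{-1}(\sigma)\setminus\{\sigma,\pi\}}\Psi_\tau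 .$$ It is known that this recursion gives well-defined wheel polynomials $\Psi_\pi$ for all $\pi\in\mathrm{NC}_n$. These definitions make sense for $q$ a variable and are specialised to $q=e^{2\pi i/3}$. The polynomials $D_\pi$: for $\pi\in\mathrm{NC}_n$ with $\lambda(\pi)=(\lambda_1,\dots,\lambda_l)$, $$D_\pi:=\Big(\prod_{i=1}^{l}\prod_{j=1}^{\lambda_{l+1-i}}\mathbf{D}_{n+(i-l)+(\lambda_{l+1-i}-j)}\Big)(\Psi_{()_n}).$$ The polynomials $D_{\pi_1,\pi_2}$: for $\pi_1\in\mathrm{NC}_{n_1}$, $\pi_2\in\mathrm{NC}_{n_2}$, $n=n_1+n_2$ and $\lambda(\pi_2)=(\lambda_1,\dots,\lambda_l)$, $$D_{\pi_1,\pi_2}:=\Big(\prod_{i=1}^{l}\prod_{j=1}^{\lambda_{l+1-i}}\mathbf{D}_{(i-l)+(\lambda_{l+1-i}-j)}\Big)(D_{(\pi_1)_{n_2}}),$$ where $(\pi_1)_{n_2}\in\mathrm{NC}_n$. Equivalently: starting from $D_{(\pi_1)_{n_2}}$, read the boxes of $\lambda(\pi_2)$ row by row from top to bottom, each row from left to right, and successively apply $\mathbf{D}_{c-r}$ for the box in row $r$ and column $c$.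
   Formalization: The displayed rotation identity is false as printed (e.g. π1π2=(())(), n2=1) and is corrected to Ψ_{ρ^{n2}(π1π2)}(z_1,…,z_{2n}) = Ψ_{π1π2}(z_{n2+1},…,z_{2n},z_1,…,z_{n2}); everything else is as stated. *)

(* Defs.v *)
From HB Require Import structures.
From mathcomp Require Import all_boot all_order all_fingroup all_algebra zify.
From mathcomp Require Import mpoly.

Set Implicit Arguments.
Unset Strict Implicit.
Unset Printing Implicit Defensive.

Import GRing.Theory Num.Theory.

(* A matching is its partner function; the point labelled k, 1 <= k <= 2n, is *)
(* the ordinal k - 1.  Operators indexed by an ordinal i (e, swap, Dop) are    *)
(* thus those with label i + 1, whereas add_box, Dint and word take labels.    *)
Definition noncrossing m (p : {ffun 'I_m -> 'I_m}) : bool :=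
  [&& [forall i, p i != i], [forall i, p (p i) == i]
    & [forall i : 'I_m, forall j : 'I_m, ~~ [&& i < j, j < p i & p i < p j]]].

Record NC (n : nat) : predArgType := MkNC {
  partner :> {ffun 'I_n.*2 -> 'I_n.*2};
  partnerP : noncrossing partner }.

HB.instance Definition _ n := [isSub for @partner n].
HB.instance Definition _ n := [Finite of NC n by <:].

Lemma noncrossingP m (p : {ffun 'I_m -> 'I_m}) :
  reflect [/\ forall i, p i <> i, forall i, p (p i) = i
    & forall i j : 'I_m, ~ [/\ i < j, j < p i & p i < p j]] (noncrossing p).
Proof.
apply: (iffP and3P) => [] [A B D]; split.
- by move=> i; apply/eqP; apply: (forallP A).
- by move=> i; apply/eqP; apply: (forallP B).
- by move=> i j [h1 h2 h3]; have/forallP/(_ j) := forallP D i; rewrite h1 h2 h3.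
- by apply/forallP => i; apply/eqP.
- by apply/forallP => i; apply/eqP.
- apply/forallP => i; apply/forallP => j; apply/negP => /and3P h; exact: (D i j).
Qed.

Definition rainbow_fun n : {ffun 'I_n.*2 -> 'I_n.*2} := [ffun i => rev_ord i].

Fact rainbow_subproof n : noncrossing (rainbow_fun n).
Proof.
apply/noncrossingP; split=> [i|i|i j]; rewrite ?ffunE ?rev_ordK //.
  by move/(congr1 val) => /= h; have := ltn_ord i; lia.
by move=> [] /= h1 h2 h3; have := ltn_ord i; lia.
Qed.

Definition rainbow n : NC n := MkNC (rainbow_subproof n).

Definition concat_fun n1 n2 (p1 : NC n1) (p2 : NC n2) :
    {ffun 'I_(n1 + n2).*2 -> 'I_(n1 + n2).*2} :=
  [ffun i => cast_ord (esym (doubleD n1 n2))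
     match split (cast_ord (doubleD n1 n2) i) with
     | inl j => lshift n2.*2 (p1 j)
     | inr j => rshift n1.*2 (p2 j)
     end].

Fact concat_subproof n1 n2 (p1 : NC n1) (p2 : NC n2) :
  noncrossing (concat_fun p1 p2).
Proof.
have /noncrossingP [A1 B1 C1] := partnerP p1.
have /noncrossingP [A2 B2 C2] := partnerP p2.
pose c (u : 'I_n1.*2 + 'I_n2.*2) := cast_ord (esym (doubleD n1 n2)) (unsplit u).
have cP i : exists u, i = c u.
  by exists (split (cast_ord (doubleD n1 n2) i)); rewrite /c splitK cast_ordK.
have cE u : concat_fun p1 p2 (c u) =
    c (match u with inl j => inl (p1 j) | inr j => inr (p2 j) end).
  by rewrite ffunE /c cast_ordKV unsplitK; case: u.
have cI u v : c u = c v -> u = v.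
  by move/cast_ord_inj => h; rewrite -(unsplitK u) h unsplitK.
apply/noncrossingP; split=> [i|i|i j].
- have [u ->] := cP i; rewrite cE => /cI; case: u => j [] //.
    exact: A1.
  exact: A2.
- by have [u ->] := cP i; rewrite !cE; case: u => j; rewrite ?B1 ?B2.
have [u ->] := cP i; have [v ->] := cP j; rewrite !cE /c.
case: u v => [a|a] [b|b] /= [].
- by move=> h1 h2 h3; apply: (C1 a b).
- by have := ltn_ord (p1 a); lia.
- by have := ltn_ord b; lia.
- by rewrite !ltn_add2l => h1 h2 h3; apply: (C2 a b).
Qed.

Definition concat n1 n2 (p1 : NC n1) (p2 : NC n2) : NC (n1 + n2) :=
  MkNC (concat_subproof p1 p2).

Fact nest_size n k : (n + k).*2 = k + n.*2 + k.
Proof. lia. Qed.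

Definition nest_fun k n (p : NC n) : {ffun 'I_(n + k).*2 -> 'I_(n + k).*2} :=
  [ffun i => match split (cast_ord (nest_size n k) i) with
     | inl a => match split a with
                | inr j => cast_ord (esym (nest_size n k))
                             (lshift k (rshift k (p j)))
                | inl _ => rev_ord i
                end
     | inr _ => rev_ord i
     end].

Lemma nest_fun_out k n (p : NC n) (i : 'I_(n + k).*2) :
  (i < k) || (k + n.*2 <= i) -> nest_fun k p i = rev_ord i.
Proof.
rewrite ffunE; case: splitP => //= a ea; case: splitP => //= j ej.
by have := ltn_ord j; lia.
Qed.

Lemma nest_fun_in k n (p : NC n) (i : 'I_(n + k).*2) (j : 'I_n.*2) :
  i = k + j :> nat -> nest_fun k p i = k + p j :> nat.
Proof.
move=> e; rewrite ffunE; case: splitP => /= [a ea|a ea]; last first.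
  by have := ltn_ord j; lia.
case: splitP => /= [b eb|b eb]; first by have := ltn_ord b; lia.
by suff -> : b = j by []; apply: val_inj => /=; lia.
Qed.

Fact nest_subproof k n (p : NC n) : noncrossing (nest_fun k p).
Proof.
have /noncrossingP [A B D] := partnerP p.
have inP (i : 'I_(n + k).*2) : ~~ ((i < k) || (k + n.*2 <= i)) ->
    exists j : 'I_n.*2, i = k + j :> nat.
  rewrite negb_or -leqNgt -ltnNge => /andP [h1 h2].
  have h : i - k < n.*2 by lia.
  by exists (Ordinal h) => /=; lia.
apply/noncrossingP; split=> [i|i|i j].
- have li := ltn_ord i.
  have [o|/inP [a ea]] := boolP ((i < k) || (k + n.*2 <= i)).
    by rewrite nest_fun_out // => /(congr1 val) /=; lia.
  move/(congr1 val) => /=; rewrite (nest_fun_in p ea) => h.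
  by apply: (A a); apply: val_inj => /=; lia.
- have li := ltn_ord i.
  have [o|/inP [a ea]] := boolP ((i < k) || (k + n.*2 <= i)).
    by rewrite [nest_fun k p i]nest_fun_out // nest_fun_out ?rev_ordK //=; lia.
  have e := nest_fun_in p ea.
  by apply: val_inj; rewrite /= (nest_fun_in p e) B.
have li := ltn_ord i; have lj := ltn_ord j.
have [oi|/inP [a ea]] := boolP ((i < k) || (k + n.*2 <= i));
have [oj|/inP [b eb]] := boolP ((j < k) || (k + n.*2 <= j)).
- by rewrite !nest_fun_out //= => -[]; lia.
- rewrite (nest_fun_out _ oi) (nest_fun_in p eb) /= => -[].
  by have := ltn_ord (p b); have := ltn_ord b; lia.
- rewrite (nest_fun_out _ oj) (nest_fun_in p ea) /= => -[].
  by have := ltn_ord (p a); have := ltn_ord a; lia.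
rewrite (nest_fun_in p ea) (nest_fun_in p eb) => -[h1 h2 h3].
by apply: (D a b); split; lia.
Qed.

Definition nest k n (p : NC n) : NC (n + k) := MkNC (nest_subproof k p).

Definition rho_fun n (p : NC n) : {ffun 'I_n.*2 -> 'I_n.*2} :=
  [ffun i => ordS (p (ord_pred i))].

Lemma val_ordS m (i : 'I_m) :
  (ordS i : nat) = if i.+1 == m then 0 else i.+1.
Proof.
have := ltn_ord i => h; rewrite /=; case: eqP => [->|]; first by rewrite modnn.
by move=> ne; rewrite modn_small //; lia.
Qed.

Fact rho_subproof n (p : NC n) : noncrossing (rho_fun p).
Proof.
have /noncrossingP [A B D] := partnerP p.
have sP (i : 'I_n.*2) : exists a, i = ordS a.
  by exists (ord_pred i); rewrite ord_predK.
have E a : rho_fun p (ordS a) = ordS (p a) by rewrite ffunE ordSK.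
apply/noncrossingP; split=> [i|i|i j].
- by have [a ->] := sP i; rewrite E => /(can_inj (@ordSK _)); apply: A.
- by have [a ->] := sP i; rewrite !E B.
have [a ->] := sP i; have [b ->] := sP j; rewrite !E !val_ordS.
have := D a b; have := D b (p a); rewrite B.
have := ltn_ord a; have := ltn_ord b; have := ltn_ord (p a).
have := ltn_ord (p b); move=> l1 l2 l3 l4 D1 D2 [].
do !case: eqP => //; try lia.
- by move=> *; apply: D1; split; lia.
- by move=> *; apply: D2; split; lia.
Qed.

Definition rho n (p : NC n) : NC n := MkNC (rho_subproof p).

(* The label 2n + 1 is identified with 1: ordS is the cyclic successor. *)
Definition e_fun n (i : 'I_n.*2) (p : NC n) : {ffun 'I_n.*2 -> 'I_n.*2} :=
  [ffun x => if x == i then ordS i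
             else if x == ordS i then i
             else if x == p i then p (ordS i)
             else if x == p (ordS i) then p i
             else p x].

Lemma ordS_neq n (i : 'I_n.*2) : ordS i <> i.
Proof.
move/(congr1 (@nat_of_ord _)); rewrite val_ordS; have := ltn_ord i.
by case: eqP; lia.
Qed.

Fact e_subproof n (i : 'I_n.*2) (p : NC n) : noncrossing (e_fun i p).
Proof.
have [pis|npis] := eqVneq (p i) (ordS i).
  suff -> : e_fun i p = p by exact: partnerP.
  have /noncrossingP [_ B _] := partnerP p.
  apply/ffunP => x; rewrite ffunE.
  case: eqP => [->|xi]; first by rewrite pis.
  case: eqP => [->|xs]; first by rewrite -pis B.
  have psi : p (ordS i) = i by rewrite -pis B.
  by rewrite pis psi; do 2![case: eqP => // _].
have /noncrossingP [A B D] := partnerP p.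
have iS := @ordS_neq _ i.
have I u v : p u = p v -> u = v by move=> h; rewrite -(B u) h B.
have vE (u v : 'I_n.*2) : u <> v -> u <> v :> nat by move=> h /val_inj.
pose g := e_fun i p.
have ei : g i = ordS i by rewrite ffunE eqxx.
have es : g (ordS i) = i by rewrite ffunE; case: eqP => //; rewrite eqxx.
have ea : g (p i) = p (ordS i).
  rewrite ffunE; case: eqP => [/A//|_]; case: eqP => [/eqP|_].
    by rewrite (negPf npis).
  by rewrite eqxx.
have eb : g (p (ordS i)) = p i.
  rewrite ffunE; case: eqP => [h|_].
    by have := B (ordS i); rewrite h => /eqP; rewrite (negPf npis).
  case: eqP => [/A//|_]; case: eqP => [/I/iS//|_]; by rewrite eqxx.
have eo x : x <> i -> x <> ordS i -> x <> p i -> x <> p (ordS i) ->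
    g x = p x.
  by move=> *; rewrite ffunE; do 4!(case: eqP => // _).
have cs x : [\/ x = i, x = ordS i, x = p i | x = p (ordS i)] \/
    [/\ x <> i, x <> ordS i, x <> p i & x <> p (ordS i)].
  case: (x =P i) => ?; first by left; constructor 1.
  case: (x =P ordS i) => ?; first by left; constructor 2.
  case: (x =P p i) => ?; first by left; constructor 3.
  case: (x =P p (ordS i)) => ?; first by left; constructor 4.
  by right.
have po x : [/\ x <> i, x <> ordS i, x <> p i & x <> p (ordS i)] ->
    [/\ p x <> i, p x <> ordS i, p x <> p i & p x <> p (ordS i)].
  move=> [h1 h2 h3 h4]; split=> h; move: h1 h2 h3 h4; rewrite -?h ?B //.
    by move/I: h => ->.
  by move/I: h => ->.
apply/noncrossingP; rewrite -/g; split=> [x|x|x y].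
- have [[|||]->|o] := cs x; rewrite ?ei ?es ?ea ?eb //.
  + by move/esym/iS.
  + by move/I/iS.
  + by move/I/esym/iS.
  + by case: (o) => *; rewrite eo //; apply: A.
- have [[|||]->|o] := cs x; rewrite ?(ei, es, ea, eb) //.
  by case: (o) => *; rewrite eo //; case: (po _ o) => *; rewrite eo.
have adj : ordS i = (if i.+1 == n.*2 then 0 else i.+1) :> nat by exact: val_ordS.
have li := ltn_ord i.
have lt := @ltn_ord n.*2.
have Db (u v : 'I_n.*2) : (u < v) && (v < p u) && (p u < p v) = false.
  by apply/negP => /andP [/andP [h1 h2] h3]; apply: (D u v).
pose btw (a b x : nat) := (a < x) && (x < b) || (b < x) && (x < a).
have btwP u v : v <> u -> v <> p u -> btw u (p u) v = btw u (p u) (p v).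
  move=> /vE h1 /vE h2.
  have /vE h3 : p v <> u by move=> h; apply: h2; rewrite -h B.
  have /vE h4 : p v <> p u by move/I => h; apply: h1; rewrite h.
  have := Db u v; have := Db u (p v); have := Db (p u) v.
  have := Db (p u) (p v); have := Db v u; have := Db (p v) u.
  have := Db v (p u); have := Db (p v) (p u).
  rewrite !B /btw.
  case: (ltngtP u v) h1 => [_ _|_ _|-> //];
  case: (ltngtP (p u) v) h2 => [_ _|_ _|-> //];
  case: (ltngtP u (p v)) h3 => [_ _|_ _|-> //];
  by case: (ltngtP (p u) (p v)) h4 => [_ _|_ _|-> //].
have key u v : [/\ u <> i, u <> ordS i, u <> p i & u <> p (ordS i)] ->
    v = p i \/ v = p (ordS i) -> btw v (g v) u = btw v (g v) (p u).
  move=> o; have o' := po _ o.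
  have bi : btw i (p i) u = btw i (p i) (p u) by apply: btwP; case: (o).
  have bs : btw (ordS i) (p (ordS i)) u = btw (ordS i) (p (ordS i)) (p u).
    by apply: btwP; case: (o).
  have btwC a b w : btw a b w = btw b a w by rewrite /btw orbC.
  have E w : [/\ w <> i, w <> ordS i, w <> p i & w <> p (ordS i)] ->
      btw (p i) (p (ordS i)) w =
      (i.+1 == n.*2) (+) btw i (p i) w (+) btw (ordS i) (p (ordS i)) w.
    case=> /vE h1 /vE h2 /vE h3 /vE h4.
    have /vE k1 := A i; have /vE k2 := A (ordS i).
    have /vE k3 : p (ordS i) <> i.
      by move=> h; have := B (ordS i); rewrite h => /eqP; rewrite (negPf npis).
    have /vE k4 : p i <> ordS i by move/eqP; rewrite (negPf npis).
    have l1 := lt w; have l2 := lt (p i); have l3 := lt (p (ordS i)).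
    move: adj h1 h2 h3 h4 k1 k2 k3 k4 l1 l2 l3 li; rewrite /btw.
    move: (nat_of_ord (ordS i)) (nat_of_ord (p i)) (nat_of_ord (p (ordS i))).
    move: (nat_of_ord w) (nat_of_ord i) => w' i' s a b {D Db btwP bi bs}.
    by case: eqP => /= ? ->; lia.
  by case=> ->; rewrite ?ea ?eb ?[btw (p (ordS i)) _ _]btwC !E ?bi ?bs.
have btwN a b c d : btw a b c = btw a b d ->
    ~ [/\ c < a, a < d & d < b] /\ ~ [/\ a < c, c < b & b < d].
  by rewrite /btw => h; split=> -[]; lia.
have [xc|xo] := cs x; have [yc|yo] := cs y.
- have lts := lt (p i); have ltt := lt (p (ordS i)).
  by case: xc => ->; case: yc => ->; rewrite ?(ei, es, ea, eb);
    case=> *; move: adj; case: eqP; lia.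
- have ly := lt y; have lpy := lt (p y).
  have ey : g y = p y by case: (yo) => *; apply: eo.
  case: xc => xe; rewrite xe ey ?ei ?es.
  + by case=> *; move: adj; case: eqP; lia.
  + by case=> *; move: adj; case: eqP; lia.
  + by have [_ h] := btwN _ _ _ _ (key y x yo (or_introl xe)); rewrite -xe.
  + by have [_ h] := btwN _ _ _ _ (key y x yo (or_intror xe)); rewrite -xe.
- have lx := lt x; have lpx := lt (p x).
  have ex : g x = p x by case: (xo) => *; apply: eo.
  case: yc => ye; rewrite ye ex ?ei ?es.
  + by case=> *; move: adj; case: eqP; lia.
  + by case=> *; move: adj; case: eqP; lia.
  + have [h _] := btwN _ _ _ _ (key x y xo (or_introl ye)); by rewrite -ye.
  + have [h _] := btwN _ _ _ _ (key x y xo (or_intror ye)); by rewrite -ye.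
have ex : g x = p x by case: (xo) => *; apply: eo.
have ey : g y = p y by case: (yo) => *; apply: eo.
by rewrite ex ey; apply: D.
Qed.

Definition e n (i : 'I_n.*2) (p : NC n) : NC n := MkNC (e_subproof i p).

(* The Young diagram as its list of row lengths, top row first.  Row r is the *)
(* horizontal strip crossed by the second path at its (n-r+1)-th north-step,  *)
(* and its length is the number of east-steps made before that north-step.    *)
Definition lam n (p : NC n) : seq nat :=
  [seq c <- rev [seq #|[pred j : 'I_n.*2 | (j < i) && (p j < j)]|
                | i : 'I_n.*2 <- enum 'I_n.*2 & i < p i] | 0 < c].

Definition NCle n (s p : NC n) : bool :=
  [forall r : 'I_n, nth 0 (lam s) r <= nth 0 (lam p) r].

(* The added box is in row r + 1 and column nth 0 (lam p) r. *)
Definition add_box n (j : nat) (s p : NC n) : Prop :=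
  exists r, lam p = incr_nth (lam s) r /\ j + r.+1 = n + nth 0 (lam p) r.

Local Open Scope ring_scope.

Section Polynomials.

Variables (F : fieldType) (n : nat).
Implicit Types (i j : 'I_n.*2) (f g : {mpoly F[n.*2]}).

Definition swap i f : {mpoly F[n.*2]} := msym (tperm i (ordS i)) f.

Fact divdiff_exists i f :
  exists g, ('X_(ordS i) - 'X_i) * g == swap i f - f.
Proof.
pose P f := exists g, ('X_(ordS i) - 'X_i) * g = swap i f - f.
suff [g /eqP h] : P f by exists g.
have PM a b : P a -> P b -> P (a * b).
  move=> [u hu] [v hv]; exists (swap i a * v + u * b).
  rewrite mulrDr mulrCA hv mulrA hu /swap msymM mulrBr mulrBl addrA.
  by rewrite subrK.
have PC c : P c%:MP.
  exists 0; rewrite mulr0 /swap -[c%:MP]mulr1 mul_mpolyC msymZ.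
  by rewrite (rmorph1 (msym _)) subrr.
have PX k : P 'X_k.
  rewrite /P /swap /msym mmapX mmap1U.
  case: tpermP => [->|->|_ _]; first by exists 1; rewrite mulr1.
    by exists (-1); rewrite mulrN1 opprB.
  by exists 0; rewrite mulr0 subrr.
elim/mpolyind: f => [|c m f _ _ [g hg]].
  by exists 0; rewrite mulr0 /swap msym0 subrr.
have [u hu] : P (c *: 'X_[m]).
  rewrite -mul_mpolyC; apply: (PM) => //; rewrite (mpolyXE _ 1%g).
  apply: (big_ind P) => [|a b|k _]; [exact: (PC 1)|exact: PM|].
  elim: (m _) => [|d IHd]; first exact: (PC 1).
  by rewrite exprS; apply: PM.
by exists (u + g); rewrite mulrDr hu hg /swap msymD opprD addrACA.
Qed.

(* The exact quotient (S_k(f) - f) / (z_{k+1} - z_k). *)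
Definition divdiff i f : {mpoly F[n.*2]} := xchoose (divdiff_exists i f).

Lemma divdiffE i f : ('X_(ordS i) - 'X_i) * divdiff i f = swap i f - f.
Proof. exact/eqP/(xchooseP (divdiff_exists i f)). Qed.

Variable q : F.

Definition Dop i f : {mpoly F[n.*2]} :=
  (q *: 'X_i - q^-1 *: 'X_(ordS i)) * divdiff i f.

(* D_k for every integer k, of period 2n.  The default value is only used for *)
(* n = 0.                                                                     *)
Definition Dint (k : int) f : {mpoly F[n.*2]} :=
  if insub `|((k - 1) %% n.*2%:Z)%Z|%N is Some i then Dop i f else f.

Definition Dprod (w : seq int) f : {mpoly F[n.*2]} := foldr Dint f w.

(* On q^4 z_i = q^2 z_j = z_k one has z_i = q^-4 z_k and z_j = q^-2 z_k. *)
Definition wheel f : Prop :=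
  f \is (n * n.-1)%N.-homog /\
  forall i j k : 'I_n.*2, (i < j)%N -> (j < k)%N ->
    f \mPo [tuple if x == i then q ^- 4 *: 'X_k
                  else if x == j then q ^- 2 *: 'X_k else 'X_x | x < n.*2] = 0.

Definition var_lo (i : 'I_n) : {mpoly F[n.*2]} :=
  'X_(cast_ord (addnn n) (lshift n i)).
Definition var_hi (i : 'I_n) : {mpoly F[n.*2]} :=
  'X_(cast_ord (addnn n) (rshift n i)).

Definition Psi_rainbow : {mpoly F[n.*2]} :=
  (q - q^-1) ^- (n * n.-1) *:
    \prod_(i < n) \prod_(j < n | (i < j)%N)
      ((q *: var_lo i - q^-1 *: var_lo j) * (q *: var_hi i - q^-1 *: var_hi j)).

(* These equations determine the family Psi. *)
Definition is_Psi (Psi : NC n -> {mpoly F[n.*2]}) : Prop :=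
  Psi (rainbow n) = Psi_rainbow /\
  forall (i : 'I_n.*2) (s p : NC n), add_box i.+1 s p ->
    Psi p = Dop i (Psi s) -
      \sum_(t in (e i @^-1: [set s]) :\: [set s; p]) Psi t.

(* f(z_{k+1}, ..., z_{2n}, z_1, ..., z_k) *)
Definition rotate_vars (k : nat) f : {mpoly F[n.*2]} :=
  f \mPo [tuple 'X_(iter k (@ordS _) x) | x < n.*2].

End Polynomials.

(* The indices of the product of operators attached to the diagram la. *)
Definition word (base : int) (la : seq nat) : seq int :=
  let l := size la in
  [seq base + (i%:Z - l%:Z) + ((nth 0%N la (l - i))%:Z - j%:Z)
  | i <- iota 1 l, j <- iota 1 (nth 0%N la (l - i))].

Definition D_single (F : fieldType) (q : F) n (p : NC n) : {mpoly F[n.*2]} :=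
  Dprod q (word n (lam p)) (Psi_rainbow n q).

Definition D_pair (F : fieldType) (q : F) n1 n2 (p1 : NC n1) (p2 : NC n2) :
    {mpoly F[(n1 + n2).*2]} :=
  Dprod q (word 0 (lam p2)) (D_single q (nest n2 p1)).

(* e^{2 pi i / 3} = - 1 / 2 + i sqrt 3 / 2 *)
Definition omega (C : numClosedFieldType) : C := (-1 + 'i * sqrtC 3) / 2.

(* x belongs to the subfield Q(q). *)
Definition in_Qadj (F : fieldType) (q x : F) : Prop :=
  exists a b : {poly rat}, (map_poly ratr b).[q] != 0 /\
    x = (map_poly ratr a).[q] / (map_poly ratr b).[q].

(* Main.v *)
Require Import Defs.
From HB Require Import structures.
From mathcomp Require Import all_boot all_order all_fingroup all_algebra.
From mathcomp Require Import mpoly zify ring.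

Set Implicit Arguments.
Unset Strict Implicit.
Unset Printing Implicit Defensive.

Import GRing.Theory Num.Theory.
Local Open Scope ring_scope.

(* Attach to a matching s the point P_s with coordinate q^2 at the openings   *)
(* and q at the closings of s.  At q^3 = 1 a wheel polynomial restricted to   *)
(* z_j = q^2 z_i (i, j adjacent) is the product of the z_m - q z_i times a    *)
(* wheel polynomial of order n - 1 in the other variables.  By induction, a   *)
(* wheel polynomial is determined by its values at the P_s, and one that is   *)
(* symmetric in z_i, z_(i+1) has the same value at P_s and at P_(e_i s).      *)
(* As 1 + D_i produces symmetric polynomials and keeps the values at the P_s  *)
(* with s in the image of e_i, the recursion gives Psi_p(P_s) = [s = p], and  *)
(* (1 + D_i) Psi_s is the sum of the Psi_t with e_i t = s, for 1 <= i < 2n.   *)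
(* Rotating variables preserves wheel polynomials; evaluating the rotation of *)
(* Psi_(()_n) at the P_s gives Psi_(rho p) for p = ()_n, the general case     *)
(* follows along the recursion, and so does the formula for i = 2n.           *)
(* Finally (1 + D_i) acts on the Psi_(rho^n2 (s1 s2)) through s1 or s2 alone  *)
(* as long as (i, i+1) is enclosed in an arch of that block; so adding a box  *)
(* is a unitriangular step, and D_(p1,p2) expands unitriangularly with        *)
(* integer coefficients.                                                      *)

(** * Evaluation of polynomials at polynomial points *)

(** At q^3 = 1 a wheel polynomial is known once its values at the finitely many points P_s
    ([arch_pt]) are known, and every identity for the Psi_p is checked there. Uniqueness is
    [wheel_meval_eq0]: setting z_j = q^2 z_i for adjacent i, j splits off one linear factor for each
    remaining variable and leaves a wheel polynomial of the next lower order ([wheel_reduction]).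
    Below the critical degree a wheel polynomial is 0 ([wheel_eq0]), and at the critical degree it
    ignores all parameters ([wheel_indep]), so the cofactor does not involve z_i and induction
    applies.

    On these values 1 + D_i ([Eop]) is dual to e_i: ((1 + D_i) f)(P_p) = f(P_(e_i p)), by
    [Eop_arch_pt], which rests on [swap_arch]. Hence Psi_p(P_s) = [s = p] ([Psi_spec]), every wheel
    polynomial expands in the Psi_s ([inW_expand]), and (1 + D_i) Psi_s is the sum of the Psi_t with
    e_i t = s ([Eop_Psi]). Evaluating the rotated Psi_(()_n) at the P_s starts the proof that
    rotating variables is rotating matchings ([Psi_rho]).

    Put Phi_(s1,s2) = Psi_(rho^n2 (s1 s2)). For nested s1 and s2 this is Psi_(()_n), the polynomial
    from which D_(p1,p2) is built. Suppose p has a valley at i inside one block, and the part of s1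
    s2 in that block is at most e_i p. Then an arch of that part encloses i, i + 1
    ([enclosing_arch]), so the preimages of s1 s2 change this block alone ([preimage_concat_l],
    [preimage_concat_r]), and there they stay below p ([preimage_le]). Therefore D = (1 + D) - 1
    turns an expansion with leading term e_i p into one with leading term p ([expands_Dop]). Box by
    box, D_(p1,p2) becomes an integral unitriangular combination of the Phi ([expands_r]), and
    inverting it is [Phi_expansion]. *)

Section Evaluation.

Variables (F : fieldType) (N : nat).
Implicit Types (f g : {mpoly F[N]}) (i j k m : 'I_N).
Implicit Types (t u : 'I_N -> {mpoly F[N]}) (v : 'I_N -> F).

Definition ev t f : {mpoly F[N]} := mmap (@mpolyC N F) t f.

HB.instance Definition _ t := GRing.RMorphism.copy (ev t) (ev t).

Lemma evX t i : ev t 'X_i = t i.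
Proof. by rewrite /ev mmapX mmap1U. Qed.

Lemma evZ t c f : ev t (c *: f) = c *: ev t f.
Proof. by rewrite /ev mmapZ mul_mpolyC. Qed.

Lemma evC t c : ev t c%:MP = c%:MP.
Proof. by rewrite /ev mmapC. Qed.

Lemma mmap_eq (S : comNzRingType) (h : F -> S) (t u : 'I_N -> S) f :
  t =1 u -> mmap h t f = mmap h u f.
Proof.
by move=> tu; apply: eq_bigr => m _; rewrite (mmap1_eq _ tu).
Qed.

Lemma mmap_ev (S : comNzRingType) (h : {rmorphism F -> S}) (v : 'I_N -> S) t f :
  mmap h v (ev t f) = mmap h (fun i => mmap h v (t i)) f.
Proof.
elim/mpolyind: f => [|c m f _ _ IH]; first by rewrite !raddf0.
rewrite /ev !mmapD IH -/(ev t _) evZ !mmapZ; congr (_ * _ + _).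
rewrite /ev !mmapX rmorph_prod; apply: eq_bigr => i _.
by rewrite rmorphXn.
Qed.

Lemma evE t u f : ev t (ev u f) = ev (fun i => ev t (u i)) f.
Proof. exact: mmap_ev. Qed.

Lemma meval_ev v t f : (ev t f).@[v] = f.@[fun i => (t i).@[v]].
Proof. exact: (mmap_ev idfun). Qed.

Lemma eq_ev t u f : t =1 u -> ev t f = ev u f.
Proof. exact: mmap_eq. Qed.

Lemma ev_id f : ev (fun i => 'X_i) f = f.
Proof.
elim/mpolyind: f => [|c m f _ _ IH]; first by rewrite raddf0.
rewrite raddfD /= IH evZ; congr (_ *: _ + _).
by rewrite /ev mmapX mmap1_id.
Qed.

Lemma comp_mpoly_ev (T : N.-tuple {mpoly F[N]}) f : f \mPo T = ev (tnth T) f.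
Proof. by []. Qed.

Lemma ev_msym (s : 'S_N) t f : ev t (msym s f) = ev (t \o s) f.
Proof.
pose T (u : 'I_N -> {mpoly F[N]}) := [tuple u x | x < N].
have E u : tnth (T u) =1 u by move=> x; rewrite tnth_mktuple.
rewrite -(eq_ev _ (E t)) -comp_mpoly_ev msym_mPo comp_mpoly_ev.
by apply: eq_ev => x; rewrite !tnth_mktuple.
Qed.

Lemma meval_msym (s : 'S_N) v f : (msym s f).@[v] = f.@[v \o s].
Proof.
rewrite -[msym s f]ev_id ev_msym meval_ev.
by apply: meval_eq => x; rewrite /= mevalXU.
Qed.

Lemma meval_const v f : (f.@[v])%:MP = ev (fun i => (v i)%:MP) f.
Proof.
elim/mpolyind: f => [|c m f _ _ IH]; first by rewrite !raddf0.
rewrite raddfD /= mpolyCD IH [RHS]raddfD /= evZ mevalZ mpolyCM mul_mpolyC.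
congr (_ *: _ + _); rewrite mevalX /ev mmapX rmorph_prod.
by apply: eq_bigr => i _; rewrite rmorphXn.
Qed.

Definition upd (T : Type) (t : 'I_N -> T) j (x : T) : 'I_N -> T :=
  fun k => if k == j then x else t k.

Lemma updE (T : Type) (t : 'I_N -> T) j x : upd t j x j = x.
Proof. by rewrite /upd eqxx. Qed.

Lemma upd_neq (T : Type) (t : 'I_N -> T) j x k : k != j -> upd t j x k = t k.
Proof. by rewrite /upd => /negPf ->. Qed.

(** The polynomials with this property contain constants and variables and are closed under sums
    and, by a Leibniz rule, products. *)
Lemma ev_factor j (p : {mpoly F[N]}) f :
  exists g, f - ev (upd (fun k => 'X_k) j p) f = ('X_j - p) * g.
Proof.
pose s := upd (fun k => 'X_k : {mpoly F[N]}) j p.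
pose P f := exists g, f - ev s f = ('X_j - p) * g; change (P f).
have PM a b : P a -> P b -> P (a * b).
  move=> [g hg] [g' hg']; exists (g * b + ev s a * g').
  rewrite rmorphM /= mulrDr mulrA -hg mulrCA -hg'; ring.
have PC c : P c%:MP by exists 0; rewrite evC; ring.
have PX k : P 'X_k.
  rewrite /P /s evX /upd; case: eqP => [->|_]; first by exists 1; ring.
  by exists 0; ring.
elim/mpolyind: f => [|c m f _ _ [g hg]]; first exact: (PC 0).
have [g' hg'] : P (c *: 'X_[m]).
  rewrite -mul_mpolyC; apply: (PM) => //; rewrite (mpolyXE _ 1%g).
  apply: (big_ind P) => [|a b|k _]; [exact: (PC 1)|exact: PM|].
  elim: (m _) => [|d IHd]; first exact: (PC 1).
  by rewrite exprS; apply: PM.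
by exists (g' + g); rewrite mulrDr -hg -hg' raddfD /=; ring.
Qed.

(** [msize] is the total degree plus one, and 0 for the zero polynomial; all degree bounds below are
    in this form. *)
Lemma msize_linear_ge2 j c i : j != i ->
  (2 <= msize ('X_j - c *: 'X_i : {mpoly F[N]}))%N.
Proof.
move=> ji; have := @msize_mdeg_lt _ _ ('X_j - c *: 'X_i : {mpoly F[N]}) U_(j).
rewrite mdeg1 mcoeff_msupp mcoeffB mcoeffZ !mcoeffX eqxx.
have /negPf -> : U_(i)%MM != U_(j)%MM :> 'X_{1..N}.
  apply/eqP => /(congr1 (fun m : 'X_{1..N} => m j)).
  by rewrite !mnm1E eqxx eq_sym (negPf ji).
by rewrite mulr0 subr0 oner_neq0 => /(_ isT).
Qed.

Lemma linear_neq0 j c i : j != i -> 'X_j - c *: 'X_i != 0 :> {mpoly F[N]}.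
Proof.
move=> /(msize_linear_ge2 c) h; apply/eqP => e.
by move: h; rewrite e msize0.
Qed.

Lemma mpolyX_neq0 j : 'X_j != 0 :> {mpoly F[N]}.
Proof. by rewrite -msize_poly_eq0 msizeX. Qed.

Lemma msizeM_bound f g a b : (msize f <= a.+1)%N -> (msize g <= b.+1)%N ->
  (msize (f * g) <= (a + b).+1)%N.
Proof.
move=> ha hb; have [->|f0] := eqVneq f 0; first by rewrite mul0r msize0.
have [->|g0] := eqVneq g 0; first by rewrite mulr0 msize0.
by rewrite msizeM //; move: (msize f) (msize g) ha hb => x y; lia.
Qed.

Lemma mmap1_ev_msize t (m : 'X_{1..N}) :
  (forall x, msize (t x) <= 2)%N -> (msize (mmap1 t m) <= (mdeg m).+1)%N.
Proof.
move=> ht; rewrite /mmap1 mdegE.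
elim/big_rec2: _ => [|i d p _ IH]; first by rewrite msize1.
have hX e : (msize (t i ^+ e) <= e.+1)%N.
  elim: e => [|e IHe]; first by rewrite expr0 msize1.
  by rewrite exprS; exact: (@msizeM_bound _ _ 1 e).
exact: msizeM_bound.
Qed.

Lemma ev_msize t f : (forall x, msize (t x) <= 2)%N -> (msize (ev t f) <= msize f)%N.
Proof.
move=> ht; rewrite {1}/ev /mmap; apply: leq_trans (msize_sum _ _ _) _.
apply/bigmax_leqP_seq => m hm _.
rewrite mul_mpolyC; apply: leq_trans (msizeZ_le _ _) _.
by apply: leq_trans (mmap1_ev_msize _ ht) (msize_mdeg_lt hm).
Qed.

Lemma msize_X_le2 (m : 'I_N) : (msize ('X_m : {mpoly F[N]}) <= 2)%N.
Proof. by rewrite msizeX mdeg1. Qed.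

Lemma msize_ZX_le2 c (m : 'I_N) : (msize (c *: 'X_m : {mpoly F[N]}) <= 2)%N.
Proof. exact: leq_trans (msizeZ_le _ _) (msize_X_le2 _). Qed.

Lemma msize_upd_ev j (p : {mpoly F[N]}) f : (msize p <= 2)%N ->
  (msize (ev (upd (fun k => 'X_k) j p) f) <= msize f)%N.
Proof.
move=> hp; apply: ev_msize => x; rewrite /upd; case: eqP => // _.
exact: msize_X_le2.
Qed.

(** The linear forms are pairwise non-proportional, so the one split off first is nonzero on the
    other hyperplanes and its cofactor still vanishes there. *)
Lemma hyperplanes_factor i (L : seq ('I_N * F)) f :
    uniq L -> all (fun x => x.1 != i) L ->
    (forall x, x \in L -> ev (upd (fun k => 'X_k) x.1 (x.2 *: 'X_i)) f = 0) ->
  exists g, f = \prod_(x <- L) ('X_x.1 - x.2 *: 'X_i) * g.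
Proof.
elim: L f => [|[m c] L IH] f /=; first by exists f; rewrite big_nil mul1r.
move=> /andP [mL uL] /andP [/= mi aL] h.
have [g hg] := ev_factor m (c *: 'X_i) f.
have := h (m, c); rewrite mem_head => /(_ isT) /= f0.
rewrite f0 subr0 in hg.
have [|g' hg'] := IH g uL aL; last first.
  by exists g'; rewrite big_cons hg {1}hg' mulrA.
move=> [m' c'] xL; have /= := h (m', c'); rewrite inE xL orbT => /(_ isT).
have m'i : m' != i by exact: (allP aL _ xL).
rewrite hg rmorphM => /eqP; rewrite mulf_eq0 => /orP [|/eqP //].
rewrite raddfB /= evX evZ evX [upd _ _ _ i]upd_neq 1?[i == _]eq_sym //.
rewrite /upd; case: (m =P m') => [mm|_]; last by rewrite (negPf (linear_neq0 c mi)).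
rewrite -scalerBl -mul_mpolyC mulf_eq0 (negPf (mpolyX_neq0 _)) orbF.
rewrite mpolyC_eq0 subr_eq0 => /eqP cc; move: mL.
by rewrite mm -cc xL.
Qed.

Lemma prod_linear_neq0 i (L : seq ('I_N * F)) : all (fun x => x.1 != i) L ->
  \prod_(x <- L) ('X_x.1 - x.2 *: 'X_i) != 0 :> {mpoly F[N]}.
Proof.
elim: L => [|[m c] L IH] /=; first by rewrite big_nil oner_neq0.
by case/andP=> mi /IH h; rewrite big_cons mulf_neq0 // linear_neq0.
Qed.

Lemma msize_prod_linear i (L : seq ('I_N * F)) g :
    all (fun x => x.1 != i) L -> g != 0 ->
  (size L + msize g <= msize (\prod_(x <- L) ('X_x.1 - x.2 *: 'X_i) * g))%N.
Proof.
move=> + g0; elim: L => [|[m c] L IH] /=; first by rewrite big_nil mul1r.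
case/andP=> mi aL; rewrite big_cons -mulrA msizeM ?linear_neq0 //; last first.
  by rewrite mulf_neq0 ?prod_linear_neq0.
have h1 := IH aL; have h2 := msize_linear_ge2 c mi.
rewrite -(subnKC h2) /= addSn addSn ltnS; apply: leq_trans h1 _.
exact: leq_addl.
Qed.

End Evaluation.

(** * Wheel polynomials at a primitive cube root of unity *)

Lemma ltn_ord_neq (N : nat) (i j : 'I_N) : (i < j)%N -> i != j.
Proof. by rewrite -val_eqE ltn_neqAle => /andP []. Qed.

Ltac neq := by [apply: ltn_ord_neq | rewrite eq_sym; apply: ltn_ord_neq
  | apply: ltn_ord_neq; apply: ltn_trans; eassumption].

Section Wheel.

Variables (F : fieldType) (N : nat) (q : F).
Hypotheses (qE : q ^+ 2 + q + 1 = 0) (q1 : q != 1).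
Implicit Types (f g : {mpoly F[N]}) (i j k m : 'I_N) (A : {set 'I_N}).
Implicit Types (t : 'I_N -> {mpoly F[N]}) (v : 'I_N -> F).

Local Notation X := (fun k : 'I_N => 'X_k : {mpoly F[N]}).

Lemma q_cube : q ^+ 3 = 1.
Proof.
apply/eqP; rewrite -subr_eq0.
have -> : q ^+ 3 - 1 = (q - 1) * (q ^+ 2 + q + 1) by ring.
by rewrite qE mulr0.
Qed.

Lemma q_neq0 : q != 0.
Proof.
apply/eqP => q0; move: qE; rewrite q0 expr0n !add0r => /eqP.
by rewrite oner_eq0.
Qed.

Lemma q2_neq1 : q ^+ 2 != 1.
Proof.
apply/eqP => q2; have e : q = q ^+ 3 * (q ^+ 2) ^- 1 by rewrite q2 invr1 mulr1 exprS q2 mulr1.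
by move: q1; rewrite e q_cube q2 invr1 mul1r eqxx.
Qed.

Lemma q2_neq_q : q ^+ 2 != q.
Proof.
apply/eqP => q2; move: q1; rewrite -[q](mulfK q_neq0) -expr2 q2 divff ?eqxx //.
exact: q_neq0.
Qed.

(* The wheel condition for the variables indexed by A, the other ones being    *)
(* parameters; t is a generic point, and q^4 = q.                              *)
Definition wheel_on A f := forall t i j k, i \in A -> j \in A -> k \in A ->
  (i < j)%N -> (j < k)%N -> t j = q ^+ 2 *: t i -> t k = q *: t i -> ev t f = 0.

(** The generic wheel on i, j, k; by [wheel_onP] no other point has to be tested. *)
Definition wheel_pt i j k := upd (upd X j (q ^+ 2 *: 'X_i)) k (q *: 'X_i).

Lemma wheel_onP A f :
  (forall i j k, i \in A -> j \in A -> k \in A -> (i < j)%N -> (j < k)%N ->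
     ev (wheel_pt i j k) f = 0) -> wheel_on A f.
Proof.
move=> h t i j k Ai Aj Ak ij jk tj tk.
have := congr1 (ev t) (h i j k Ai Aj Ak ij jk).
rewrite raddf0 evE => <-; apply: eq_ev => x; rewrite /wheel_pt /upd.
case: eqP => [->|_]; first by rewrite evZ evX.
by case: eqP => [->|_]; rewrite ?evZ evX.
Qed.

(** Values at generic wheels lie in an integral domain, so a factor that is nonzero there can be
    cancelled. *)
Lemma wheel_onM A p f :
  (forall i j k, i \in A -> j \in A -> k \in A -> (i < j)%N -> (j < k)%N ->
     ev (wheel_pt i j k) p != 0) ->
  wheel_on A (p * f) -> wheel_on A f.
Proof.
move=> hp hf; apply: wheel_onP => i j k Ai Aj Ak ij jk.
have nij : i != j by neq.
have nik : i != k by neq.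
have njk : j != k by neq.
have := hf (wheel_pt i j k) i j k Ai Aj Ak ij jk.
rewrite /wheel_pt !(updE, upd_neq) // => /(_ erefl erefl).
rewrite rmorphM => /eqP; rewrite mulf_eq0 -/(wheel_pt i j k).
by rewrite (negPf (hp _ _ _ Ai Aj Ak ij jk)) => /eqP.
Qed.

Lemma ev_linear_neq0 t i j m c d : t i = 'X_i -> t m = d *: 'X_j -> j != i ->
  c != 0 -> ev t ('X_m - c *: 'X_i) != 0.
Proof.
move=> ti tm ji c0; rewrite raddfB /= evZ !evX ti tm.
have -> : d *: 'X_j - c *: 'X_i = - c *: ('X_i - (d / c) *: 'X_j) :> {mpoly F[N]}.
  by rewrite scalerBr scalerA mulNr mulrCA divff // mulr1 !scaleNr opprK addrC.
by rewrite -mul_mpolyC mulf_neq0 ?mpolyC_eq0 ?oppr_eq0 // linear_neq0 // eq_sym.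
Qed.

Lemma wheel_pt_ne i j k x : x != j -> x != k -> wheel_pt i j k x = 'X_x.
Proof. by move=> xj xk; rewrite /wheel_pt !upd_neq. Qed.

Lemma wheel_pt_linear_neq0 A i j k x m c :
  i \in A -> j \in A -> k \in A -> x \notin A -> m != x -> c != 0 ->
  ev (wheel_pt i j k) ('X_m - c *: 'X_x) != 0.
Proof.
move=> Ai Aj Ak Ax mx c0.
have xN y : y \in A -> y != x by apply: contraL => /eqP ->.
have [d [y [e yx]]] : exists d y, wheel_pt i j k m = d *: 'X_y /\ y != x.
  rewrite /wheel_pt /upd; case: eqP => _; first by exists q, i; rewrite xN.
  case: eqP => _; first by exists (q ^+ 2), i; rewrite xN.
  by exists 1, m; rewrite scale1r.
by apply: ev_linear_neq0 e yx c0; rewrite wheel_pt_ne // eq_sym xN.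
Qed.

Definition rst i j f := ev (upd X j (q ^+ 2 *: 'X_i)) f.

Lemma rst_eq0 i j f t : rst i j f = 0 -> t j = q ^+ 2 *: t i -> ev t f = 0.
Proof.
move=> h tj; have := congr1 (ev t) h; rewrite raddf0 evE => <-.
by apply: eq_ev => x; rewrite /upd; case: eqP => [->|_]; rewrite ?evZ evX.
Qed.

Lemma rst_msize i j f : (msize (rst i j f) <= msize f)%N.
Proof. exact/msize_upd_ev/msize_ZX_le2. Qed.

Lemma wheel_on_rst A i j f : i \in A -> j \in A -> i != j ->
  wheel_on A f -> wheel_on (A :\: [set i; j]) (rst i j f).
Proof.
move=> Ai Aj nij hf; apply: wheel_onP => a b c.
rewrite !inE !negb_or => /andP [/andP [ai aj] Aa] /andP [/andP [bi bj] Ab].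
move=> /andP [/andP [ci cj] Ac] ab bc; rewrite /rst evE.
apply: (hf _ a b c) => //; rewrite !upd_neq // !evX /wheel_pt.
- have nac : a != c by neq.
  have nab : a != b by neq.
  by rewrite !(updE, upd_neq) //; neq.
- have nac : a != c by neq.
  have nab : a != b by neq.
  by rewrite !(updE, upd_neq) //; neq.
Qed.

(** The forms in L involve z_i, a parameter once i and j are removed. They are thus nonzero at every
    wheel of the remaining variables, and [wheel_onM] hands the wheel condition to the cofactor. *)
Lemma reduction A i j f (L : seq ('I_N * F)) :
    i \in A -> j \in A -> i != j -> wheel_on A f -> uniq L ->
    (forall x, x \in L -> x.1 \in A :\: [set i; j]) ->
    (forall x, x \in L -> x.2 != 0) ->
    (forall x, x \in L -> ev (upd X x.1 (x.2 *: 'X_i)) (rst i j f) = 0) ->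
  exists g, [/\ rst i j f = \prod_(x <- L) ('X_x.1 - x.2 *: 'X_i) * g,
    wheel_on (A :\: [set i; j]) g
    & g != 0 -> (size L + msize g <= msize f)%N].
Proof.
move=> Ai Aj nij hf uL LA L0 Lz.
have aL : all (fun x => x.1 != i) L.
  by apply/allP => x /LA; rewrite !inE negb_or; case: (x.1 == i).
have [g hg] := hyperplanes_factor uL aL Lz.
exists g; split=> // [|g0].
  have := wheel_on_rst Ai Aj nij hf; rewrite hg; apply: wheel_onM => a b c Aa Ab Ac ab bc.
  rewrite rmorph_prod big_seq prodf_seq_neq0; apply/allP => x xL; apply/implyP => _.
  apply: (wheel_pt_linear_neq0 Aa Ab Ac); rewrite ?L0 //.
    by rewrite !inE eqxx.
  by have := allP aL _ xL.
apply: leq_trans (msize_prod_linear aL g0) _; rewrite -hg; exact: rst_msize.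
Qed.

(* z_m = q z_i completes (z_i, z_j) to a wheel (m, i, j) or (i, j, m).         *)
Lemma zero_outer A i j m f : wheel_on A f -> i \in A -> j \in A -> m \in A ->
  (i < j)%N -> (m < i)%N || (j < m)%N ->
  ev (upd X m (q *: 'X_i)) (rst i j f) = 0.
Proof.
move=> hf Ai Aj Am ij; rewrite /rst evE => /orP [mi|jm].
  have ? : i != m by neq.
  have ? : i != j by neq.
  have ? : m != j by neq.
  apply: (hf _ m i j) => //; rewrite !(updE, upd_neq) // ?evZ !evX !(updE, upd_neq) //.
    by rewrite scalerA -exprSr q_cube scale1r.
  by rewrite scalerA.
have ? : i != m by neq.
have ? : i != j by neq.
have ? : m != j by neq.
by apply: (hf _ i j m) => //; rewrite !(updE, upd_neq) // ?evZ !evX !(updE, upd_neq).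
Qed.

(** Yields the factor z_m - q^2 z_i for m between i and j, once the shorter pair (i, m) is
    settled. *)
Lemma zero_inner i j m f : (i < m)%N -> (m < j)%N -> rst i m f = 0 ->
  ev (upd X m (q ^+ 2 *: 'X_i)) (rst i j f) = 0.
Proof.
move=> im mj h; rewrite /rst evE; apply: (rst_eq0 h).
have ? : i != m by neq.
have ? : i != j by neq.
have ? : m != j by neq.
by rewrite !(updE, upd_neq) // !evX !(updE, upd_neq).
Qed.

(** The second factor of an inner variable: on z_m = z_i, the relation z_j = q^2 z_i reads z_j = q^2
    z_m. *)
Lemma zero_inner1 i j m f : (i < m)%N -> (m < j)%N -> rst m j f = 0 ->
  ev (upd X m (1 *: 'X_i)) (rst i j f) = 0.
Proof.
move=> im mj h; rewrite /rst evE; apply: (rst_eq0 h).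
have ? : i != m by neq.
have ? : i != j by neq.
have ? : m != j by neq.
by rewrite !(updE, upd_neq) // evZ !evX !(updE, upd_neq) // scale1r.
Qed.

Lemma card_remove2 A i j d : i \in A -> j \in A -> i != j -> #|A| = d.+1.*2 ->
  #|A :\: [set i; j]| = d.*2.
Proof.
move=> Ai Aj nij hA.
have -> : A :\: [set i; j] = (A :\ i) :\ j.
  by apply/setP => x; rewrite !inE negb_or andbA [(x != i) && _]andbC.
have cj := cardsD1 j (A :\ i); rewrite !inE Aj [j == i]eq_sym nij in cj.
have := cardsD1 i A; rewrite Ai hA cj; move: #|_| => x; clear; lia.
Qed.

(** In effect f is divisible by all z_j - q^2 z_i. The factors with smallest i are split off first;
    none of them vanishes on the hyperplanes of the other pairs, so induction applies to the
    cofactor. *)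
Lemma all_pairs_msize A f : f != 0 ->
    (forall i j, i \in A -> j \in A -> (i < j)%N -> rst i j f = 0) ->
  ('C(#|A|, 2) < msize f)%N.
Proof.
elim: {A}#|A| {-2}A (erefl #|A|) f => [|d IH] A hA f f0 h.
  by rewrite hA lt0n msize_poly_eq0.
have /card_gt0P [i0 Ai0] : (0 < #|A|)%N by rewrite hA.
case: (@arg_minnP _ i0 (mem A) (fun x : 'I_N => nat_of_ord x) Ai0) => i /= Ai imin.
have {}Ai : i \in A by [].
have iA x : x \in A :\ i -> (i < x)%N.
  rewrite !inE => /andP [xi Ax]; have := imin x Ax; rewrite leq_eqVlt.
  by rewrite val_eqE eq_sym (negPf xi).
pose L := [seq (x, q ^+ 2) | x <- enum (A :\ i)].
have LP x : x \in L -> x.1 \in A :\ i /\ x.2 = q ^+ 2.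
  by case/mapP => y; rewrite mem_enum => hy ->.
have uL : uniq L by rewrite map_inj_uniq ?enum_uniq // => x y [].
have aL : all (fun x => x.1 != i) L.
  by apply/allP => x /LP []; rewrite !inE; case: (x.1 == i).
have [|g hg] := hyperplanes_factor uL aL (f := f).
  move=> [x c] xL; have [/= xA ->] := LP _ xL; apply: h => //; last exact: iA.
  by move: xA; rewrite inE => /andP [].
have g0 : g != 0 by apply: contraNneq f0 => g0; rewrite hg g0 mulr0.
have := msize_prod_linear aL g0; rewrite -hg.
have cA : #|A :\ i| = d by have := cardsD1 i A; rewrite Ai hA => -[].
rewrite size_map -cardE cA; apply: leq_trans.
rewrite hA binS bin1 -addSn addnC leq_add2l -cA; apply: IH => // a b Aa Ab ab.
have := h a b _ _ ab; move: (Aa) (Ab); rewrite !inE => /andP [ai ->] /andP [bi ->].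
move=> /(_ isT isT); rewrite hg /rst rmorphM => /eqP; rewrite mulf_eq0.
case/orP => [|/eqP //]; rewrite rmorph_prod big_seq prodf_seq_eq0.
case/hasP => -[x c] xL /andP [_]; have [/= xA ->] := LP _ xL.
move=> e0; exfalso; move: e0; apply/negP.
have xi : x != i by move: xA; rewrite !inE => /andP [].
have [e|xb] := eqVneq x b.
  apply: (ev_linear_neq0 (j := a) (d := q ^+ 2)) => //.
  - by rewrite upd_neq // eq_sym.
  - by rewrite e updE.
  - by rewrite expf_neq0 // q_neq0.
apply: (ev_linear_neq0 (j := x) (d := 1)) => //.
- by rewrite upd_neq // eq_sym.
- by rewrite upd_neq // scale1r.
- by rewrite expf_neq0 // q_neq0.
Qed.

Definition consecutive A i j :=
  [/\ i \in A, j \in A, (i < j)%N & forall m, m \in A -> ~~ ((i < m) && (m < j))%N].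

(* For nonconsecutive i < j, a variable in between contributes two factors     *)
(* instead of one to the restriction to z_j = q^2 z_i, whose cofactor thus has *)
(* subcritical degree.                                                         *)
Lemma wheel_eq0_step d A f :
    (forall (B : {set 'I_N}) g, #|B| = d.*2 -> wheel_on B g ->
       (msize g <= d * d.-1)%N -> g = 0) ->
    #|A| = d.+1.*2 -> wheel_on A f -> (msize f <= (d.+1 * d).+1)%N ->
    (forall i j, consecutive A i j -> rst i j f = 0) -> f = 0.
Proof.
move=> IH hA hf sf hc; apply/eqP; apply: contraT => f0.
(* Vanishing for all pairs would force degree at least (d + 1)(2d + 1), beyond the bound (d +
   1)d. *)
suff h i j : i \in A -> j \in A -> (i < j)%N -> rst i j f = 0.
  have := all_pairs_msize f0 h; rewrite hA bin2 /= => /leq_trans /(_ sf).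
  by rewrite ltnS; clear; nia.
move: {2}(j - i)%N (leqnn (j - i)%N) => s; elim: s i j => [|s IHs] i j hs Ai Aj ij.
  by move: hs ij; clear; lia.
have [/existsP [m /and3P [Am im mj]]|no] :=
  boolP [exists m, [&& m \in A, (i < m)%N & (m < j)%N]]; last first.
  apply: hc; split=> // m Am; apply: contra no => hm.
  by apply/existsP; exists m; rewrite Am.
have nij : i != j by neq.
pose A' := A :\: [set i; j].
pose c (x : 'I_N) := if ((i < x) && (x < j))%N then q ^+ 2 else q.
(* One factor for each of the 2d other variables and a second one for m: these 2d + 1 factors take
   the degree from (d + 1)d down to d(d - 1) - 1. *)
pose L := (m, 1) :: [seq (x, c x) | x <- enum A'].
have mA' : m \in A' by rewrite !inE Am -!val_eqE /=; move: im mj; clear; lia.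
have LP x : x \in L -> x = (m, 1) \/ x.1 \in A' /\ x.2 = c x.1.
  rewrite inE => /orP [/eqP ->|/mapP [y]]; first by left.
  by rewrite mem_enum => hy ->; right.
have c0 x : c x != 0 by rewrite /c; case: ifP; rewrite ?expf_neq0 // q_neq0.
have [] := @reduction A i j f L Ai Aj nij hf.
- rewrite /L /= map_inj_uniq ?enum_uniq ?andbT => [|x y []//].
  apply/negP => /mapP [x _ [<-]]; rewrite /c im mj /= => /esym /eqP.
  by rewrite (negPf q2_neq1).
- by move=> x /LP [->|[]].
- by move=> x /LP [->|[_ ->]] //=; rewrite oner_neq0.
- move=> [x d'] /LP [[-> ->]|/= [xA ->]].
    by apply: zero_inner1 => //; apply: IHs => //=; move: hs im mj; clear; lia.
  have Ax : x \in A by move: xA; rewrite inE => /andP [].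
  have xi : x != i by move: xA; rewrite !inE negb_or => /andP [/andP []].
  have xj : x != j by move: xA; rewrite !inE negb_or => /andP [/andP []].
  rewrite /c; case: ifP => [/andP [ix xj']|hx].
    by apply: zero_inner => //; apply: IHs => //; move: hs ix xj'; clear; lia.
  apply: (zero_outer hf) => //; move: hx xi xj ij; rewrite -!val_eqE /=; clear; lia.
move=> g [eg wg sg]; rewrite eg (IH A' g) ?mulr0 //; first exact: card_remove2.
have [->|/sg] := eqVneq g 0; first by rewrite msize0.
rewrite /= size_map -cardE (card_remove2 Ai Aj nij hA) => h.
have := leq_trans h sf; move: (msize g) => x; clear; nia.
Qed.

(** At adjacent variables 2d linear factors split off, which turns the degree bound (d + 1)d - 1
    into d(d - 1) - 1; being subcritical is inherited by the cofactor. *)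
Lemma wheel_eq0 d A f : #|A| = d.*2 -> wheel_on A f ->
  (msize f <= d * d.-1)%N -> f = 0.
Proof.
elim: d A f => [|d IH] A f hA hf sf.
  by apply/eqP; rewrite -msize_poly_eq0 -leqn0.
apply: (wheel_eq0_step IH hA hf); first exact: leqW.
move=> i j [Ai Aj ij hij].
have nij : i != j by neq.
pose A' := A :\: [set i; j].
pose L := [seq (x, q) | x <- enum A'].
have LP x : x \in L -> x.1 \in A' /\ x.2 = q.
  by case/mapP => y; rewrite mem_enum => hy ->.
have [] := @reduction A i j f L Ai Aj nij hf.
- by rewrite map_inj_uniq ?enum_uniq // => x y [].
- by move=> x /LP [].
- by move=> x /LP [_ ->]; rewrite q_neq0.
- move=> [x c] /LP /= [xA ->]; move: xA; rewrite !inE negb_or.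
  move=> /andP [/andP [xi xj] Ax]; apply: (zero_outer hf) => //.
  by have := hij x Ax; move: xi xj ij; rewrite -!val_eqE /=; clear; lia.
move=> g [eg wg sg]; rewrite eg (IH A' g) ?mulr0 //; first exact: card_remove2.
have [->|/sg] := eqVneq g 0; first by rewrite msize0.
rewrite size_map -cardE (card_remove2 Ai Aj nij hA) => h.
have := leq_trans h sf; move: (msize g) => x /=; clear; nia.
Qed.

(** The difference of the two sides is z_i times a wheel polynomial of subcritical degree, which is
    0. *)
Lemma wheel_indep1 d A f i : #|A| = d.*2 -> wheel_on A f ->
  (msize f <= (d * d.-1).+1)%N -> i \notin A -> f = ev (upd X i 0) f.
Proof.
move=> hA hf sf iA; have [g hg] := ev_factor i 0 f.
apply/eqP; rewrite -subr_eq0 hg subr0.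
have [->|g0] := eqVneq g 0; first by rewrite mulr0.
rewrite subr0 in hg; rewrite (wheel_eq0 hA (f := g)) ?mulr0 //.
  have: wheel_on A ('X_i * g).
    apply: wheel_onP => a b c Aa Ab Ac ab bc; rewrite -hg raddfB /= evE.
    have iN y : y \in A -> y != i by apply: contraL => /eqP ->.
    have ? : a != b by neq.
    have ? : a != c by neq.
    have ? : b != c by neq.
    have w t' : t' a = 'X_a -> t' b = q ^+ 2 *: 'X_a -> t' c = q *: 'X_a -> ev t' f = 0.
      by move=> ea eb ec; apply: (hf _ a b c); rewrite ?ea.
    rewrite !w ?subr0 //; rewrite ?upd_neq ?iN // ?evX /wheel_pt ?(updE, upd_neq) //.
  apply: wheel_onM => a b c Aa Ab Ac ab bc; rewrite evX wheel_pt_ne ?mpolyX_neq0 //.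
    by apply: contraNneq iA => ->.
  by apply: contraNneq iA => ->.
have : (msize ('X_i * g) <= msize f)%N.
  rewrite -hg; apply: leq_trans (msizeD_le _ _) _; rewrite msizeN geq_max leqnn.
  by apply: msize_upd_ev; rewrite msize0.
rewrite msizeM ?mpolyX_neq0 // msizeX mdeg1 => h.
by have := leq_trans h sf; move: (msize g) => x /=; clear; lia.
Qed.

Lemma wheel_indep d A f t u : #|A| = d.*2 -> wheel_on A f ->
  (msize f <= (d * d.-1).+1)%N -> {in A, t =1 u} -> ev t f = ev u f.
Proof.
move=> hA hf sf.
suff h t' : ev t' f = ev (fun k => if k \in A then t' k else 0) f.
  move=> tu; rewrite h [RHS]h; apply: eq_ev => k.
  by case: ifP => // /tu.
have h (s : seq 'I_N) : {subset s <= ~: A} ->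
    ev t' f = ev (fun k => if k \in s then 0 else t' k) f.
  elim: s => [|i s IH] sA; first exact: eq_ev.
  rewrite IH => [|x xs]; last by apply: sA; rewrite inE xs orbT.
  have iA : i \notin A by have := sA i (mem_head _ _); rewrite inE.
  rewrite [in LHS](wheel_indep1 hA hf sf iA) evE; apply: eq_ev => k.
  rewrite /upd inE; case: eqP => _ /=; first by rewrite raddf0.
  by rewrite evX.
rewrite (h (enum (~: A))) => [|x]; last by rewrite mem_enum.
by apply: eq_ev => k; rewrite mem_enum inE if_neg.
Qed.

(** For adjacent i, j every other variable of A lies outside (i, j), so z_m = q z_i completes a
    wheel and gives a factor; the cofactor again meets the critical degree bound. *)
Lemma wheel_reduction d A i j f : #|A| = d.+1.*2 -> wheel_on A f ->
    (msize f <= (d.+1 * d).+1)%N -> consecutive A i j ->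
  exists g, [/\ rst i j f = \prod_(x in A :\: [set i; j]) ('X_x - q *: 'X_i) * g,
    wheel_on (A :\: [set i; j]) g, #|A :\: [set i; j]| = d.*2
    & (msize g <= (d * d.-1).+1)%N].
Proof.
move=> hA hf sf [Ai Aj ij hij].
have nij : i != j by neq.
have cA := card_remove2 Ai Aj nij hA.
pose A' := A :\: [set i; j]; rewrite -/A' in cA *.
pose L := [seq (x, q) | x <- enum A'].
have LP x : x \in L -> x.1 \in A' /\ x.2 = q.
  by case/mapP => y; rewrite mem_enum => hy ->.
have [] := @reduction A i j f L Ai Aj nij hf.
- by rewrite map_inj_uniq ?enum_uniq // => x y [].
- by move=> x /LP [].
- by move=> x /LP [_ ->]; rewrite q_neq0.
- move=> [x c] /LP /= [xA ->]; move: xA; rewrite !inE negb_or.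
  move=> /andP [/andP [xi xj] Ax]; apply: (zero_outer hf) => //.
  by have := hij x Ax; move: xi xj ij; rewrite -!val_eqE /=; clear; lia.
move=> g [eg wg sg]; exists g; split=> //.
  by rewrite eg big_map big_enum.
have [->|/sg] := eqVneq g 0; first by rewrite msize0.
rewrite size_map -cardE cA => h.
have := leq_trans h sf; move: (msize g) => x /=; clear; nia.
Qed.

End Wheel.

(** * Values of wheel polynomials at the points of noncrossing matchings *)

Section Arches.

Variables (F : fieldType) (N : nat) (q : F).
Hypotheses (qE : q ^+ 2 + q + 1 = 0) (q1 : q != 1).
Implicit Types (f g : {mpoly F[N]}) (i j k m r s u w x : 'I_N) (A : {set 'I_N}).
Implicit Types (t : 'I_N -> {mpoly F[N]}) (v : 'I_N -> F) (p : 'I_N -> 'I_N).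

Local Notation X := (fun k : 'I_N => 'X_k : {mpoly F[N]}).

(** Matchings live on subsets A of the labels, so that arches can be deleted without relabelling. *)
Definition nc_on A p :=
  [/\ forall x, x \in A -> [/\ p x \in A, p x != x & p (p x) = x]
    & forall x y, x \in A -> y \in A ->
        ~~ [&& (x < y)%N, (y < p x)%N & (p x < p y)%N]].

Definition arch_pt p : 'I_N -> F := fun i => if (i < p i)%N then q ^+ 2 else q.

Lemma wheel_indep_meval d A f v v' : #|A| = d.*2 -> wheel_on q A f ->
  (msize f <= (d * d.-1).+1)%N -> {in A, v =1 v'} -> f.@[v] = f.@[v'].
Proof.
move=> hA hf sf h; apply: (can_inj (@mpolyCK N F)); rewrite !meval_const.
by apply: (wheel_indep qE q1 hA hf sf) => x /h ->.
Qed.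

Lemma meval_rst i j f v : v j = q ^+ 2 * v i -> (rst q i j f).@[v] = f.@[v].
Proof.
move=> vj; rewrite /rst meval_ev; apply: meval_eq => x; rewrite /upd.
by case: eqP => [->|_]; rewrite ?mevalZ mevalXU.
Qed.

Lemma meval_prod_linear (B : {set 'I_N}) i c v :
  (\prod_(x in B) ('X_x - c *: 'X_i : {mpoly F[N]})).@[v] =
  \prod_(x in B) (v x - c * v i).
Proof.
rewrite rmorph_prod; apply: eq_bigr => x _.
by rewrite raddfB /= mevalZ !mevalXU.
Qed.

Lemma q4 : q ^+ 2 * q ^+ 2 = q.
Proof. by rewrite -exprD exprS q_cube // mulr1. Qed.

Lemma arch_pt_neq1 p x : arch_pt p x != 1.
Proof. by rewrite /arch_pt; case: ifP; rewrite ?q2_neq1. Qed.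

Lemma nc_on_add_arch A p i j : consecutive A i j -> nc_on (A :\: [set i; j]) p ->
  nc_on A (upd (upd p i j) j i).
Proof.
move=> [Ai Aj ij hij] [h1 h2]; pose A' := A :\: [set i; j].
have nij : i != j by neq.
have iA' : i \notin A' by rewrite !inE eqxx.
have jA' : j \notin A' by rewrite !inE eqxx orbT.
set p' := upd _ _ _.
have pi : p' i = j by rewrite /p' upd_neq // updE.
have pj : p' j = i by rewrite /p' updE.
have pA x : x \in A -> [\/ x = i, x = j | x \in A' /\ p' x = p x].
  move=> Ax; case: (eqVneq x i) => [->|xi]; first by constructor 1.
  case: (eqVneq x j) => [->|xj]; first by constructor 2.
  by constructor 3; rewrite !inE negb_or xi xj Ax /p' !upd_neq.
have sA x : x \in A' -> x \in A by rewrite inE => /andP [].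
have out x : x \in A' -> ((x < i) || (j < x))%N.
  move=> xA'; have := hij x (sA _ xA').
  have : x != i by apply: contraNneq iA' => <-.
  have : x != j by apply: contraNneq jA' => <-.
  by rewrite -!val_eqE /= => xj xi; move: xi xj ij; clear; lia.
split=> [x /pA [->|->|[xA' e]]|x y /pA hx /pA hy].
- by rewrite pi pj Aj eq_sym.
- by rewrite pj pi Ai.
- have [pxA' pxx ppx] := h1 x xA'; rewrite e; split=> //; first exact: sA.
  by rewrite /p' !upd_neq //; apply: contraTneq pxA' => ->.
case: hx hy => [->|->|[xA' ex]] [->|->|[yA' ey]]; rewrite ?pi ?pj ?ex ?ey.
- by rewrite ltnn.
- by rewrite ltnn andbF.
- by have := out y yA'; clear; lia.
- by move: ij; clear; lia.
- by rewrite ltnn.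
- by move: ij; clear; lia.
- have [px _ _] := h1 x xA'; have := out _ px; have := out _ xA'; move: ij; clear; lia.
- by have := out x xA'; move: ij; clear; lia.
- exact: h2.
Qed.

(** A matching of the remaining points extends by the arch (i, j). At its point the linear factors
    are z_m - q^3 = z_m - 1, hence nonzero, so the cofactor vanishes at all points of smaller
    matchings. *)
Lemma wheel_meval_eq0 d A f : #|A| = d.*2 -> wheel_on q A f ->
  (msize f <= (d * d.-1).+1)%N ->
  (forall p, nc_on A p -> f.@[arch_pt p] = 0) -> f = 0.
Proof.
elim: d A f => [|d IH] A f hA hf sf h.
  have fC := msize1_polyC sf; have := h id.
  rewrite fC mevalC => -> //.
  have A0 x : (x \in A) = false by rewrite (cards0_eq hA) inE.
  by split=> x; rewrite A0.
apply: (wheel_eq0_step qE q1 _ hA hf sf).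
  by move=> B g hB hg sg; exact: (wheel_eq0 qE q1 hB hg sg).
move=> i j cij; have [Ai Aj ij _] := cij.
have [g [eg wg cA sg]] := wheel_reduction qE hA hf sf cij.
rewrite eg (IH _ g cA wg sg) ?mulr0 // => p hp.
have nij : i != j by neq.
pose p' := upd (upd p i j) j i; have := h p' (nc_on_add_arch cij hp).
have pi : arch_pt p' i = q ^+ 2 by rewrite /arch_pt /p' upd_neq // updE ij.
have pj : arch_pt p' j = q by rewrite /arch_pt /p' updE ltnNge ltnW.
rewrite -(@meval_rst i j) ?pi ?pj ?q4 // eg mevalM meval_prod_linear pi.
move=> /eqP; rewrite mulf_eq0 => /orP [|/eqP <-]; last first.
  apply: (wheel_indep_meval cA wg sg) => x; rewrite !inE negb_or.
  by move=> /andP [/andP [xi xj] _]; rewrite /arch_pt /p' !upd_neq.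
rewrite prodf_seq_eq0 => /hasP [x _ /andP [_]].
by rewrite -exprS q_cube // subr_eq0 (negPf (arch_pt_neq1 _ _)).
Qed.

Definition pt3 (T : Type) (t : 'I_N -> T) r s u (a b c : T) :=
  upd (upd (upd t r a) s b) u c.

Lemma pt3E (T : Type) (t : 'I_N -> T) r s u a b c : (r < s)%N -> (s < u)%N ->
  [/\ pt3 t r s u a b c r = a, pt3 t r s u a b c s = b, pt3 t r s u a b c u = c
   & forall x, x \notin [set r; s; u] -> pt3 t r s u a b c x = t x].
Proof.
move=> rs su; have ? : r != s by neq.
have ? : s != u by neq.
have ? : r != u by neq.
rewrite /pt3; split; rewrite ?(updE, upd_neq) //.
by move=> x; rewrite !inE !negb_or => /andP [/andP [? ?] ?]; rewrite !upd_neq.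
Qed.

(* The reductions at (r, s) and at (s, u) have the same cofactor, up to        *)
(* renaming the remaining variable, as soon as f takes the same value at the   *)
(* two points of the hypothesis.                                               *)
Lemma three_adjacent d A f r s u c (a : F) e v : #|A| = d.+1.*2 -> wheel_on q A f ->
    (msize f <= (d.+1 * d).+1)%N -> consecutive A r s -> consecutive A s u ->
    e != 0 -> e != q ->
    ev (pt3 X r s u 'X_r (q ^+ 2 *: 'X_r) (e *: 'X_r)) f =
    ev (pt3 X r s u (e *: 'X_r) 'X_r (q ^+ 2 *: 'X_r)) f ->
  f.@[pt3 v r s u a (q ^+ 2 * a) c] = f.@[pt3 v r s u c a (q ^+ 2 * a)].
Proof.
move=> hA hf sf crs csu e0 eq' hE.
have [Ar As rs _] := crs; have [_ Au su _] := csu.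
have nrs : r != s by neq.
have nsu : s != u by neq.
have nru : r != u by neq.
have [g1 [e1 w1 c1 s1]] := wheel_reduction qE hA hf sf crs.
have [g2 [e2 w2 c2 s2]] := wheel_reduction qE hA hf sf csu.
pose B := A :\: [set r; s; u].
have B1 : A :\: [set r; s] = u |: B.
  apply/setP => x; rewrite !inE !negb_or; case: (x =P u) => [->|_]; last by rewrite andbT.
  by rewrite Au ![u == _]eq_sym nru nsu.
have B2 : A :\: [set s; u] = r |: B.
  apply/setP => x; rewrite !inE !negb_or; case: (x =P r) => [->|//].
  by rewrite Ar nrs nru.
have uB : u \notin B by rewrite !inE eqxx orbT.
have rB : r \notin B by rewrite !inE eqxx.
have out x : x \in B -> x \notin [set r; s; u] by rewrite inE => /andP [].
have E1 (t : 'I_N -> {mpoly F[N]}) : t s = q ^+ 2 *: t r -> ev t f =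
    (t u - q *: t r) * \prod_(x in B) (t x - q *: t r) * ev t g1.
  move=> ts; have -> : ev t f = ev t (rst q r s f).
    rewrite /rst evE; apply: eq_ev => x; rewrite /upd.
    by case: eqP => [->|_]; rewrite ?evZ evX.
  rewrite e1 rmorphM rmorph_prod B1 big_setU1 //=; congr (_ * _ * _).
    by rewrite raddfB /= evZ !evX.
  by apply: eq_bigr => x _; rewrite raddfB /= evZ !evX.
have E2 (t : 'I_N -> {mpoly F[N]}) : t u = q ^+ 2 *: t s -> ev t f =
    (t r - q *: t s) * \prod_(x in B) (t x - q *: t s) * ev t g2.
  move=> ts; have -> : ev t f = ev t (rst q s u f).
    rewrite /rst evE; apply: eq_ev => x; rewrite /upd.
    by case: eqP => [->|_]; rewrite ?evZ evX.
  rewrite e2 rmorphM rmorph_prod B2 big_setU1 //=; congr (_ * _ * _).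
    by rewrite raddfB /= evZ !evX.
  by apply: eq_bigr => x _; rewrite raddfB /= evZ !evX.
(* The hypothesis, with (e - q) z_r and the product over B cancelled on both sides. *)
have g12 : ev (pt3 X r s u 'X_r (q ^+ 2 *: 'X_r) (e *: 'X_r)) g1 =
    ev (pt3 X r s u (e *: 'X_r) 'X_r (q ^+ 2 *: 'X_r)) g2.
  have [r1 s1' u1 o1] := pt3E X 'X_r (q ^+ 2 *: 'X_r) (e *: 'X_r) rs su.
  have [r2 s2' u2 o2] := pt3E X (e *: 'X_r) 'X_r (q ^+ 2 *: 'X_r) rs su.
  have := hE; rewrite E1 ?r1 ?s1' // E2 ?u2 ?s2' // u1 r2.
  rewrite [X in _ * X * _ = _](eq_bigr (fun x => 'X_x - q *: 'X_r)); last first.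
    by move=> x /out xo; rewrite o1.
  rewrite [X in _ = _ * X * _](eq_bigr (fun x => 'X_x - q *: 'X_r)); last first.
    by move=> x /out xo; rewrite o2.
  apply: mulfI; rewrite mulf_neq0 //.
    rewrite -scalerBl -mul_mpolyC mulf_neq0 ?mpolyX_neq0 //.
    by rewrite mpolyC_eq0 subr_eq0.
  rewrite prodf_seq_neq0; apply/allP => x _; apply/implyP => xB.
  by apply: linear_neq0; apply: contraNneq rB => <-.
have [r1 s1' u1 o1] := pt3E v a (q ^+ 2 * a) c rs su.
have [r2 s2' u2 o2] := pt3E v c a (q ^+ 2 * a) rs su.
rewrite -(@meval_rst r s) ?r1 ?s1' // -[RHS](@meval_rst s u) ?u2 ?s2' //.
rewrite e1 e2 !mevalM !meval_prod_linear B1 B2 !big_setU1 //= u1 r1 r2 s2'.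
congr (_ * _ * _).
  by apply: eq_bigr => x /out xo; rewrite o1 ?o2.
(* Each cofactor ignores its own adjacent pair; z_r = c / e gives the one remaining variable of the
   three the value c. *)
have := congr1 (meval (upd v r (c / e))) g12; rewrite !meval_ev.
have [r3 s3 u3 o3] := pt3E X 'X_r (q ^+ 2 *: 'X_r) (e *: 'X_r) rs su.
have [r4 s4 u4 o4] := pt3E X (e *: 'X_r) 'X_r (q ^+ 2 *: 'X_r) rs su.
have ec : e * (c / e) = c by rewrite mulrCA divff // mulr1.
move=> h; transitivity (g1.@[fun k => (pt3 X r s u 'X_r (q ^+ 2 *: 'X_r)
   (e *: 'X_r) k).@[upd v r (c / e)]]).
  apply: (wheel_indep_meval c1 w1 s1) => x; rewrite B1 in_setU1.
  case: (x =P u) => [-> _|_ /= xB]; first by rewrite u1 u3 mevalZ mevalXU updE ec.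
  have xo := out _ xB.
  rewrite o1 // o3 // mevalXU upd_neq //.
  by apply: contraNneq xo => ->; rewrite !inE eqxx.
rewrite {}h; apply: (wheel_indep_meval c2 w2 s2) => x; rewrite B2 in_setU1.
case: (x =P r) => [-> _|_ /= xB]; first by rewrite r2 r4 mevalZ mevalXU updE ec.
have xo := out _ xB.
rewrite o2 // o4 // mevalXU upd_neq //.
by apply: contraNneq xo => ->; rewrite !inE eqxx.
Qed.

Lemma msym_rst A i j f (a b : 'I_N) : a \notin [set i; j] -> b \notin [set i; j] ->
  msym (tperm a b) (rst q i j f) = rst q i j (msym (tperm a b) f).
Proof.
rewrite !inE !negb_or => /andP [ai aj] /andP [bi bj].
rewrite /rst ev_msym [LHS]evE; apply: eq_ev => x.
rewrite /upd /=; case: (tpermP a b x) => [->|->|xa xb].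
- by rewrite (negPf aj) (negPf bj) evX tpermL.
- by rewrite (negPf aj) (negPf bj) evX tpermR.
case: eqP => _; first by rewrite evZ evX tpermD.
by rewrite evX tpermD //; apply/eqP => e; [apply: xa | apply: xb].
Qed.

Lemma msym_reduction_prod i (B : {set 'I_N}) (c : F) (a b : 'I_N) :
  a \in B -> b \in B -> i \notin B ->
  msym (tperm a b) (\prod_(x in B) ('X_x - c *: 'X_i)) =
  \prod_(x in B) ('X_x - c *: 'X_i).
Proof.
move=> aB bB iB; rewrite rmorph_prod [RHS](reindex_inj (@perm_inj _ (tperm a b))).
apply: eq_big => [x|x xB] /=; first by case: tpermP => // ->; rewrite ?aB ?bB.
rewrite raddfB /= msymZ /msym !mmapX !mmap1U [tperm a b i]tpermD //.
  by apply: contraNneq iB => <-.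
by apply: contraNneq iB => <-.
Qed.

Definition sym_at (a b : 'I_N) f := msym (tperm a b) f = f.

Lemma ev_sym_at (a b : 'I_N) f t : sym_at a b f -> ev t f = ev (t \o tperm a b) f.
Proof. by move=> h; rewrite -[in LHS]h ev_msym. Qed.

(** A point of A strictly inside an arch belongs, by noncrossing, to a shorter arch inside it; the
    descent ends at an arch with adjacent ends. *)
Lemma inner_arch A p u : nc_on A p -> u \in A -> (u < p u)%N ->
  consecutive A u (p u) \/
  exists i, [/\ (u < i)%N, (p i < p u)%N & consecutive A i (p i)].
Proof.
move=> [h1 h2]; move: {2}(p u - u)%N (leqnn (p u - u)%N) => d.
elim: d u => [|d IH] u hd Au upu.
  by move: upu; rewrite -subn_gt0; move: hd; rewrite leqn0 => /eqP ->.
have [/existsP [m /and3P [Am um mpu]]|no] :=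
  boolP [exists m, [&& m \in A, (u < m)%N & (m < p u)%N]]; last first.
  left; split=> //; first by have [] := h1 u Au.
  by move=> m Am; apply: contra no => hm; apply/existsP; exists m; rewrite Am.
right; have [pmA pmm ppm] := h1 m Am.
have [puA _ ppu] := h1 u Au.
have nmu : p m != u by apply: contraTneq mpu => <-; rewrite ppm ltnn.
have nmpu : p m != p u.
  by apply: contraTneq um => e; rewrite -[m]ppm e ppu ltnn.
have [um' mpu'] : (u < p m)%N /\ (p m < p u)%N.
  have := h2 u m Au Am; have := h2 (p m) u pmA Au; rewrite ppm.
  move: nmu nmpu um mpu; rewrite -!val_eqE /=; clear; lia.
wlog mpm : m Am um mpu {nmu nmpu} pmA pmm ppm um' mpu' / (m < p m)%N.
  move=> W; have [lt|ge] := ltnP m (p m); first exact: (W m).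
  apply: (W (p m)) => //; rewrite ?ppm // 1?eq_sym //.
  by move: ge pmm; rewrite -val_eqE /=; clear; lia.
have [|//|//|c|[i [mi im c]]] := IH m _.
- by move: hd um mpu'; clear; lia.
- by exists m.
by exists i; split=> //; [exact: ltn_trans mi | exact: ltn_trans mpu'].
Qed.

Lemma nc_on_remove A p i : nc_on A p -> i \in A -> nc_on (A :\: [set i; p i]) p.
Proof.
move=> [h1 h2] Ai; have [_ _ ppi] := h1 i Ai.
have sA x : x \in A :\: [set i; p i] -> x \in A by rewrite inE => /andP [].
split=> [x|x y /sA Ax /sA Ay]; last exact: h2.
rewrite !inE !negb_or => /andP [/andP [xi xpi] Ax].
have [pA px ppx] := h1 x Ax; split=> //; rewrite pA andbT; apply/andP; split.
  by apply: contraNneq xpi => <-; rewrite ppx.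
by apply: contraNneq xi => e; rewrite -ppx e ppi.
Qed.

(* Removing the arches inside (u, p u) one by one leaves three adjacent points. *)
Lemma swap_arch d A p f u x : #|A| = d.*2 -> wheel_on q A f ->
    (msize f <= (d * d.-1).+1)%N -> nc_on A p -> u \in A -> (u < p u)%N ->
    [/\ consecutive A x u, (x < p x)%N & sym_at x u f] \/
    [/\ consecutive A (p u) x, (p x < x)%N & sym_at (p u) x f] ->
  f.@[arch_pt p] = f.@[arch_pt p \o tperm u (p u)].
Proof.
elim: d A f => [|d IH] A f hA hf sf hp Au upu hx.
  by move: Au; rewrite (cards0_eq hA) inE.
have [h1 h2] := hp; have [wA _ pw] := h1 u Au.
have nuw : u != p u by neq.
have pu : arch_pt p u = q ^+ 2 by rewrite /arch_pt upu.
have ppu : arch_pt p (p u) = q by rewrite /arch_pt pw ltnNge ltnW.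
have ee : q != 0 by exact: q_neq0.
have e2 : q ^+ 2 != 0 by rewrite expf_neq0.
have [cuw|[i [ui ipu ci]]] := inner_arch hp Au upu.
  case: hx => -[cx px sx].
  - have [Ax _ xu _] := cx.
    have nxu : x != u by neq.
    have nxw : x != p u by neq.
    have ax : arch_pt p x = q ^+ 2 by rewrite /arch_pt px.
    (* With e = q^2 the two points of the hypothesis differ by exchanging z_x and z_u, in which f is
       symmetric; a = c = q^2 gives the two points to be compared. *)
    have := @three_adjacent d A f x u (p u) (q ^+ 2) (q ^+ 2) (q ^+ 2) (arch_pt p)
       hA hf sf cx cuw e2 (q2_neq_q qE q1).
    have [r3 s3 u3 o3] := pt3E X 'X_x (q ^+ 2 *: 'X_x) (q ^+ 2 *: 'X_x) xu upu.
    have [r4 s4 u4 o4] := pt3E X (q ^+ 2 *: 'X_x) 'X_x (q ^+ 2 *: 'X_x) xu upu.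
    have -> : ev (pt3 X x u (p u) 'X_x (q ^+ 2 *: 'X_x) (q ^+ 2 *: 'X_x)) f =
              ev (pt3 X x u (p u) (q ^+ 2 *: 'X_x) 'X_x (q ^+ 2 *: 'X_x)) f.
      rewrite (ev_sym_at _ sx); apply: eq_ev => y /=.
      case: tpermP => [->|->|/eqP yx /eqP yu]; rewrite ?r4 ?s4 //.
      case: (y =P p u) => [->|/eqP yw]; first by rewrite u3 u4.
      by rewrite o3 ?o4 // !inE !negb_or yx yu.
    move=> /(_ erefl) h.
    have [r5 s5 u5 o5] := pt3E (arch_pt p) (q ^+ 2) (q ^+ 2 * q ^+ 2) (q ^+ 2) xu upu.
    have [r6 s6 u6 o6] := pt3E (arch_pt p) (q ^+ 2) (q ^+ 2) (q ^+ 2 * q ^+ 2) xu upu.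
    transitivity (f.@[pt3 (arch_pt p) x u (p u) (q ^+ 2) (q ^+ 2) (q ^+ 2 * q ^+ 2)]).
      apply: meval_eq => y.
      case: (y =P x) => [->|/eqP yx]; first by rewrite r6.
      case: (y =P u) => [->|/eqP yu]; first by rewrite s6.
      case: (y =P p u) => [->|/eqP yw]; first by rewrite u6 q4.
      by rewrite o6 // !inE !negb_or yx yu.
    rewrite -h; apply: meval_eq => y /=.
    case: tpermP => [->|->|/eqP yu /eqP yw]; [by rewrite s5 q4|by rewrite u5|].
    case: (y =P x) => [->|/eqP yx]; first by rewrite r5.
    by rewrite o5 // !inE !negb_or yx yu.
  - have [_ Ax wx _] := cx.
    have nux : u != x by neq.
    have nwx : p u != x by neq.
    have ax : arch_pt p x = q by rewrite /arch_pt ltnNge ltnW.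
    (* Mirror case: with e = 1 the two points differ by exchanging z_(p u) and z_x. *)
    have := @three_adjacent d A f u (p u) x q (q ^+ 2) 1 (arch_pt p)
       hA hf sf cuw cx (oner_neq0 _).
    rewrite eq_sym q1 => /(_ isT).
    have [r3 s3 u3 o3] := pt3E X 'X_u (q ^+ 2 *: 'X_u) (1 *: 'X_u) upu wx.
    have [r4 s4 u4 o4] := pt3E X (1 *: 'X_u) 'X_u (q ^+ 2 *: 'X_u) upu wx.
    have -> : ev (pt3 X u (p u) x 'X_u (q ^+ 2 *: 'X_u) (1 *: 'X_u)) f =
              ev (pt3 X u (p u) x (1 *: 'X_u) 'X_u (q ^+ 2 *: 'X_u)) f.
      rewrite (ev_sym_at _ sx); apply: eq_ev => y /=.
      case: tpermP => [->|->|/eqP yw /eqP yx]; [by rewrite u3 s4 scale1r|by rewrite s3 u4|].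
      case: (y =P u) => [->|/eqP yu]; first by rewrite r3 r4 scale1r.
      by rewrite o3 ?o4 // !inE !negb_or yx yu yw.
    move=> /(_ erefl) h.
    have [r5 s5 u5 o5] := pt3E (arch_pt p) (q ^+ 2) (q ^+ 2 * q ^+ 2) q upu wx.
    have [r6 s6 u6 o6] := pt3E (arch_pt p) q (q ^+ 2) (q ^+ 2 * q ^+ 2) upu wx.
    transitivity (f.@[pt3 (arch_pt p) u (p u) x (q ^+ 2) (q ^+ 2 * q ^+ 2) q]).
      apply: meval_eq => y.
      case: (y =P u) => [->|/eqP yu]; first by rewrite r5.
      case: (y =P p u) => [->|/eqP yw]; first by rewrite s5 q4.
      case: (y =P x) => [->|/eqP yx]; first by rewrite u5.
      by rewrite o5 // !inE !negb_or yx yu yw.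
    rewrite h; apply: meval_eq => y /=.
    case: tpermP => [->|->|/eqP yu /eqP yw]; rewrite ?r6 ?s6 //.
    case: (y =P x) => [->|/eqP yx]; first by rewrite u6 q4.
    by rewrite o6 // !inE !negb_or yx yu yw.
have [Ai Api ipi _] := ci.
(* The two points agree on the inner arch (i, p i), the linear factors have the same product at
   both, and the cofactor inherits the symmetry of f. *)
have [g [eg wg cA sg]] := wheel_reduction qE hA hf sf ci.
have uo : u \notin [set i; p i].
  by rewrite !inE -!val_eqE /=; move: ui ipi; clear; lia.
have wo : p u \notin [set i; p i].
  by rewrite !inE -!val_eqE /=; move: ipu ipi; clear; lia.
have ai : arch_pt p i = q ^+ 2 by rewrite /arch_pt ipi.
have [_ _ ppi] := h1 i Ai.
have api : arch_pt p (p i) = q by rewrite /arch_pt ppi ltnNge ltnW.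
have ti : tperm u (p u) i = i.
  by rewrite tpermD //; [move: uo | move: wo]; rewrite !inE negb_or => /andP [].
have tpi : tperm u (p u) (p i) = p i.
  by rewrite tpermD //; [move: uo | move: wo]; rewrite !inE negb_or => /andP [].
rewrite -(@meval_rst i (p i)) ?ai ?api ?q4 //.
rewrite -[RHS](@meval_rst i (p i)) /= ?ti ?tpi ?ai ?api ?q4 //.
rewrite eg !mevalM !meval_prod_linear /= ti ai; congr (_ * _).
  rewrite (reindex_inj (@perm_inj _ (tperm u (p u)))); apply: eq_bigl => y /=.
  by case: (tpermP u (p u) y) => [->|->|//]; rewrite ?in_setD ?uo ?Au ?wo ?wA.
apply: (IH _ g cA wg sg); first exact: nc_on_remove.
- by rewrite in_setD uo.
- by [].
have nprod : \prod_(x in A :\: [set i; p i]) ('X_x - q *: 'X_i : {mpoly F[N]}) != 0.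
  rewrite prodf_seq_neq0; apply/allP => y _; apply/implyP => yB.
  by apply: linear_neq0; apply: contraTneq yB => ->; rewrite !inE eqxx.
have symg a b : a \in A :\: [set i; p i] -> b \in A :\: [set i; p i] ->
    sym_at a b f -> sym_at a b g.
  move=> aB bB sf'; apply: (mulfI nprod).
  rewrite -[X in X * _ = _](@msym_reduction_prod i _ q a b) //; last by rewrite !inE eqxx.
  rewrite -rmorphM /= -eg msym_rst ?sf' //.
    by move: aB; rewrite inE => /andP [].
  by move: bB; rewrite inE => /andP [].
have cons a b : consecutive A a b -> a \in A :\: [set i; p i] ->
    b \in A :\: [set i; p i] -> consecutive (A :\: [set i; p i]) a b.
  by case=> _ _ ab hab aB bB; split=> // m; rewrite inE => /andP [_ /hab].
have uB : u \in A :\: [set i; p i] by rewrite in_setD uo.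
have wB : p u \in A :\: [set i; p i] by rewrite in_setD wo.
case: hx => -[cx px sx]; [left|right].
  have [Ax _ xu _] := cx.
  have xB : x \in A :\: [set i; p i].
    by rewrite in_setD Ax !inE -!val_eqE /=; move: xu ui ipi; clear; lia.
  by split; [exact: cons | | exact: symg].
have [_ Ax wx _] := cx.
have xB : x \in A :\: [set i; p i].
  by rewrite in_setD Ax !inE -!val_eqE /=; move: wx ipu ipi; clear; lia.
by split; [exact: cons | | exact: symg].
Qed.

End Arches.

(** * Noncrossing matchings and their diagrams *)

Section Matchings.

Variable n : nat.
Implicit Types (p s : NC n) (i j x y : 'I_n.*2).

Lemma nc_neq p x : p x != x.
Proof. by have /noncrossingP [h _ _] := partnerP p; apply/eqP. Qed.

Lemma nc_inv p : involutive p.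
Proof. by have /noncrossingP [] := partnerP p. Qed.

Lemma nc_inj p : injective p.
Proof. exact: inv_inj (nc_inv p). Qed.

Lemma nc_cross p x y : ~ [/\ (x < y)%N, (y < p x)%N & (p x < p y)%N].
Proof. by have /noncrossingP [_ _ h] := partnerP p; apply: h. Qed.

Lemma nc_ltNge p x : (p x < x)%N = ~~ (x < p x)%N.
Proof. by move: (nc_neq p x); rewrite -val_eqE /=; case: ltngtP. Qed.

Lemma nc_eqP p s : p =1 s -> p = s.
Proof. by move=> h; apply: val_inj; apply/ffunP. Qed.

Definition opener p x := (x < p x)%N.

(* The arch of least minimal span on which two matchings with the same openers *)
(* differ would enclose a shorter one.                                         *)
Lemma opener_inj p s : opener p =1 opener s -> p = s.
Proof.
have key p' s' x : opener p' =1 opener s' -> (x < p' x)%N -> (p' x < s' x)%N ->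
    exists y, [/\ (x < y)%N, (y < p' y)%N, (s' y = p' x) & (p' y < p' x)%N].
  move=> hop xp ps; set z := p' x in xp ps *; exists (s' z).
  have oz : opener s' z = false by rewrite -hop /opener /z nc_inv ltnNge ltnW.
  have sz : (s' z < z)%N by rewrite nc_ltNge -[(z < _)%N]/(opener s' z) oz.
  have xsz : (x < s' z)%N.
    have ne : s' z != x by apply: contraTneq ps => <-; rewrite nc_inv ltnn.
    have := @nc_cross s' (s' z) x; rewrite nc_inv => h.
    case: ltngtP ne => // [lt|/val_inj->]; last by rewrite eqxx.
    by move=> _; case: h.
  have osz : opener p' (s' z) by rewrite hop /opener nc_inv.
  split=> //; first by rewrite nc_inv.
  have := @nc_cross p' x (s' z); rewrite -/z => h.
  have ne : p' (s' z) != z.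
    by apply: contraTneq xsz => e; rewrite -[s' z](nc_inv p') e /z nc_inv ltnn.
  by case: ltngtP ne => // [lt|/val_inj->]; [case: h | rewrite eqxx].
move=> hop; suff h d x : (x < p x)%N -> (minn (p x) (s x) - x <= d)%N -> p x = s x.
  apply: nc_eqP => x; have [xp|] := boolP (x < p x)%N.
    exact: (h (p x) x xp (leq_trans (leq_subr _ _) (geq_minl _ _))).
  rewrite -nc_ltNge => px; have xx : (p x < p (p x))%N by rewrite nc_inv.
  have := h _ (p x) xx (leqnn _); rewrite nc_inv => e.
  by rewrite -[LHS](nc_inv s) -e.
elim: d x => [|d IH] x xp hd.
  have xs : (x < s x)%N by rewrite -[(_ < _)%N]/(opener s x) -hop.
  by move: hd; rewrite leqn0 subn_eq0 geq_min leqNgt xp leqNgt xs.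
have xs : (x < s x)%N by rewrite -[(_ < _)%N]/(opener s x) -hop.
case: (ltngtP (p x) (s x)) => [lt|lt|/val_inj //].
  have [y [xy yp sy py]] := key p s x hop xp lt.
  suff e : p y = s y by move: py; rewrite e sy ltnn.
  by apply: IH => //; rewrite sy; move: lt hd xy py; clear; lia.
have hop' : opener s =1 opener p by move=> z; rewrite hop.
have [y [xy ys py sy]] := key s p x hop' xs lt.
suff e : p y = s y by move: sy; rewrite -e py ltnn.
apply: IH; first by rewrite -[(_ < _)%N]/(opener p y) hop.
by rewrite py; move: lt hd xy sy; clear; lia.
Qed.

Lemma ordS_small i : (i.+1 < n.*2)%N -> ordS i = i.+1 :> nat.
Proof. by move=> h; rewrite val_ordS ltn_eqF. Qed.

Section Adjacent.

Variable i : 'I_n.*2.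
Hypothesis i1 : (i.+1 < n.*2)%N.
Let j := ordS i.
Let jE : j = i.+1 :> nat := ordS_small i1.

Lemma e_at p x : e i p x = if x == i then j else if x == j then i
  else if x == p i then p j else if x == p j then p i else p x.
Proof. by rewrite ffunE. Qed.

Let nij : j != i.
Proof. by apply/eqP/ordS_neq. Qed.

Lemma e_connected p : p i = j -> e i p = p.
Proof.
move=> pi; have pj : p j = i by rewrite -pi nc_inv.
apply: nc_eqP => x; rewrite e_at pi pj.
by do 2!case: eqP => [->|?] //.
Qed.

Lemma opener_connected p : opener p i -> ~~ opener p j -> p i = j.
Proof.
rewrite /opener -nc_ltNge => oi oj; apply/eqP; apply/negPn/negP => ne.
have nj : p j != i by apply: contraNneq ne => <-; rewrite nc_inv.
have := @nc_cross p (p j) i; rewrite nc_inv => h1.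
move: oi oj ne nj h1; rewrite -!(inj_eq (@ord_inj _)) jE.
have := @nc_cross p i (p i); rewrite nc_inv => h2.
move=> oi oj ne nj h1; apply: h1; split; move: oi oj ne nj; clear; lia.
Qed.

Lemma e_val p : [/\ e i p i = j, e i p j = i &
  p i != j -> [/\ e i p (p i) = p j, e i p (p j) = p i &
    forall x, x != i -> x != j -> x != p i -> x != p j -> e i p x = p x]].
Proof.
split=> [||ne]; [by rewrite e_at eqxx | by rewrite e_at (negPf nij) eqxx |].
have pji : p j != i by apply: contraNneq ne => <-; rewrite nc_inv.
split.
- by rewrite e_at (negPf (nc_neq p i)) (negPf ne) eqxx.
- rewrite e_at (negPf pji) (negPf (nc_neq p j)) eqxx.
  by rewrite (inj_eq (@nc_inj p)) (negPf nij).
- by move=> x /negPf h1 /negPf h2 /negPf h3 /negPf h4; rewrite e_at h1 h2 h3 h4.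
Qed.

(** The openers determine the matching ([opener_inj]), so e_i is described by how it permutes the
    steps of the path; only the four reconnected points need inspection. *)
Lemma e_opener_gen p u w : p i != j -> u != w ->
    (forall x, x \in [:: i; j; p i; p j] ->
      opener (e i p) x = opener p (tperm u w x)) ->
    u \in [:: i; j; p i; p j] -> w \in [:: i; j; p i; p j] ->
  forall x, opener (e i p) x = opener p (tperm u w x).
Proof.
move=> ne uw h hu hw x; have [/h //|] := boolP (x \in [:: i; j; p i; p j]).
move=> hx; have -> : tperm u w x = x.
  by rewrite tpermD //; [apply: contraNneq hx => <- | apply: contraNneq hx => <-].
move: hx; rewrite !inE !negb_or => /and4P [xi xj xpi xpj].
by rewrite /opener; have [_ _ /(_ ne) [_ _ ->]] := e_val p.
Qed.

Lemma opener_partner p x : opener p (p x) = ~~ opener p x.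
Proof. by rewrite /opener nc_inv nc_ltNge. Qed.

(** A valley of the path becomes a peak: one box is removed. *)
Lemma e_opener_EN p : ~~ opener p i -> opener p j ->
  forall x, opener (e i p) x = opener p (tperm i j x).
Proof.
move=> oi oj; have ne : p i != j.
  by apply: contraNneq oi => h; rewrite /opener h jE.
have [ei ej /(_ ne) [epi epj _]] := e_val p.
have pj : p j != i by apply: contraNneq ne => <-; rewrite nc_inv.
apply: e_opener_gen => //; rewrite ?inE ?eqxx ?orbT //; first by rewrite eq_sym.
have oi' : (p i < i)%N by rewrite nc_ltNge.
have lt : (p i < p j)%N by move: oj oi'; rewrite /opener jE; clear; lia.
move=> x; rewrite !inE => /or4P [] /eqP ->.
- by rewrite tpermL oj /opener ei jE ltnSn.
- by rewrite tpermR (negPf oi) /opener ej jE ltnNge leqnSn.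
- rewrite tpermD ?opener_partner ?oi /opener ?epi ?lt //.
  + by rewrite eq_sym nc_neq.
  + by rewrite eq_sym.
- rewrite tpermD ?opener_partner ?oj /opener ?epj 1?ltnNge ?(ltnW lt) //.
  + by rewrite eq_sym.
  + by rewrite eq_sym nc_neq.
Qed.

(** Noncrossing gives p j < p i, so the new arch opens at p j; only j and p j change roles. *)
Lemma e_opener_NN p : opener p i -> opener p j ->
  forall x, opener (e i p) x = opener p (tperm j (p j) x).
Proof.
move=> oi oj; have ne : p i != j.
  by apply: contraTneq oj => <-; rewrite opener_partner oi.
have [ei ej /(_ ne) [epi epj _]] := e_val p.
have pj : p j != i by apply: contraNneq ne => <-; rewrite nc_inv.
apply: e_opener_gen => //; rewrite ?inE ?eqxx ?orbT //; first by rewrite eq_sym nc_neq.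
have ippj : p i != p j by rewrite (inj_eq (@nc_inj p)) eq_sym.
have lt : (p j < p i)%N.
  have := @nc_cross p i j; move: oi oj ne ippj.
  rewrite /opener -!(inj_eq (@ord_inj _)) jE => oi oj ne ippj h.
  rewrite ltnNge; apply/negP => h'; apply: h; split; move: oi oj ne ippj h'; clear; lia.
move=> x; rewrite !inE => /or4P [] /eqP ->.
- by rewrite tpermD // oi /opener ei jE ltnSn.
- by rewrite tpermL opener_partner oj /opener ej jE ltnNge leqnSn.
- by rewrite tpermD 1?[_ == p i]eq_sym // opener_partner oi /opener epi ltnNge ltnW.
- by rewrite tpermR oj /opener epj lt.
Qed.

(** Again p j < p i; only i and p i change roles. *)
Lemma e_opener_EE p : ~~ opener p i -> ~~ opener p j ->
  forall x, opener (e i p) x = opener p (tperm (p i) i x).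
Proof.
move=> oi oj; have ne : p i != j.
  by apply: contraNneq oi => h; rewrite /opener h jE.
have [ei ej /(_ ne) [epi epj _]] := e_val p.
have pj : p j != i by apply: contraNneq ne => <-; rewrite nc_inv.
apply: e_opener_gen => //; rewrite ?inE ?eqxx ?orbT //; first by rewrite nc_neq.
have ippj : p i != p j by rewrite (inj_eq (@nc_inj p)) eq_sym.
have lt : (p j < p i)%N.
  have := @nc_cross p (p i) (p j); move: oi oj pj ippj.
  rewrite /opener -!nc_ltNge !nc_inv -!(inj_eq (@ord_inj _)) jE => oi oj ne' ippj h.
  rewrite ltnNge; apply/negP => h'; apply: h; split; move: oi oj ne' ippj h'; clear; lia.
move=> x; rewrite !inE => /or4P [] /eqP ->.
- by rewrite tpermR opener_partner oi /opener ei jE ltnSn.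
- by rewrite tpermD // 1?[i == _]eq_sym // (negPf oj) /opener ej jE ltnNge leqnSn.
- by rewrite tpermL (negPf oi) /opener epi ltnNge ltnW.
- by rewrite tpermD // 1?[i == _]eq_sym // opener_partner oj /opener epj lt.
Qed.

End Adjacent.

(** Counting east-steps makes the order on paths pointwise ([closers_le]); this order implies [NCle]
    by [closers_le_NCle] and avoids row lengths. *)
Definition closers p (x : nat) : nat :=
  #|[pred y : 'I_n.*2 | (y < x)%N && (p y < y)%N]|.

Definition closers_le s p := forall k, (closers s k <= closers p k)%N.

Lemma closersE p k : closers p k = (\sum_(y | ~~ opener p y) (y < k))%N.
Proof.
rewrite /closers -sum1_card big_mkcond [RHS]big_mkcond; apply: eq_bigr => y _.
by rewrite inE nc_ltNge /opener andbC; case: (y < p y)%N => //=; case: (y < k)%N.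
Qed.

Lemma closers_swap p s (u w : 'I_n.*2) k :
    (forall y, opener s y = opener p (tperm u w y)) ->
  closers s k = (\sum_(y | ~~ opener p y) (tperm u w y < k))%N.
Proof.
move=> h; rewrite closersE (reindex_inj (@perm_inj _ (tperm u w))) /=.
by apply: eq_bigl => y; rewrite h tpermK.
Qed.

Lemma closers_swap_le p s (u w : 'I_n.*2) :
    (forall y, opener s y = opener p (tperm u w y)) ->
  opener p u -> (u < w)%N -> closers_le p s.
Proof.
move=> h ou uw k; rewrite closersE (closers_swap _ h); apply: leq_sum => y oy.
case: tpermP => [yu|->|//]; first by move: oy; rewrite yu ou.
by move: uw; clear; case: ltnP; case: ltnP => //; lia.
Qed.

Lemma closersS p x : closers p x.+1 = (closers p x + ~~ opener p x)%N.
Proof.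
have E z : closers p z = (\sum_y (~~ opener p y && (y < z)))%N.
  by rewrite closersE big_mkcond; apply: eq_bigr => y _; case: opener.
rewrite !E (bigD1 x) //= [in RHS](bigD1 x) //=.
rewrite ltnSn ltnn; set a := (\sum_(y | _) _)%N; set b := (\sum_(y | _) _)%N.
have -> : a = b.
  by apply: eq_bigr => y; rewrite ltnS leq_eqVlt -(inj_eq (@ord_inj _)) => /negPf ->.
by rewrite andbT andbF add0n addnC.
Qed.

Lemma closers0 p : closers p 0 = 0%N.
Proof. by rewrite closersE big1. Qed.

Lemma closers_eq p s : (forall x : nat, (x <= n.*2)%N -> closers p x = closers s x) -> p = s.
Proof.
move=> h; apply: opener_inj => x; have := h x.+1 (ltn_ord x).
rewrite !closersS h ?(ltnW (ltn_ord x)) // => /addnI.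
by case: opener; case: opener.
Qed.

Lemma closers_le_anti p s : closers_le p s -> closers_le s p -> p = s.
Proof.
by move=> ps sp; apply: closers_eq => x _; apply/eqP; rewrite eqn_leq ps sp.
Qed.

(** Strictly increasing for [closers_le]; the measure behind the inductions on the order. *)
Definition weight p := (\sum_(x < n.*2.+1) closers p x)%N.

Lemma weight_lt p s : closers_le p s -> p != s -> (weight p < weight s)%N.
Proof.
move=> ps ne; have [/forallP h|] :=
  boolP [forall k : 'I_n.*2.+1, closers p k == closers s k].
  by case/eqP: ne; apply: closers_eq => k kn; apply/eqP/(h (Ordinal (kn : k < n.*2.+1)%N)).
rewrite negb_forall => /existsP [k hk].
rewrite /weight (bigD1 k) //= [X in (_ < X)%N](bigD1 k) //= -addSn.
by apply: leq_add; [rewrite ltn_neqAle hk ps | apply: leq_sum].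
Qed.

(** Flipping a valley moves the path only at its middle vertex, after i + 1 steps. *)
Lemma closers_valley p i k : (i.+1 < n.*2)%N -> ~~ opener p i -> opener p (ordS i) ->
  closers p k = (closers (e i p) k + (k == i.+1))%N.
Proof.
move=> i1 oi oj; rewrite closersE (closers_swap _ (e_opener_EN i1 oi oj)).
rewrite (bigD1 i) //= [in RHS](bigD1 i) //= tpermL ordS_small //.
have -> : (\sum_(y | ~~ opener p y && (y != i)) (tperm i (ordS i) y < k) =
           \sum_(y | ~~ opener p y && (y != i)) (y < k))%N.
  apply: eq_bigr => y /andP [oy yi]; rewrite tpermD // 1?eq_sym //.
  by apply: contraNneq oy => ->.
move: (\sum_(_ | _) _)%N => a; move: (nat_of_ord i) => b; clear.
by case: (ltngtP b k) => [h|h|->]; case: (ltngtP b.+1 k) => h'; lia.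
Qed.

Lemma e_valley_le p i : (i.+1 < n.*2)%N -> ~~ opener p i -> opener p (ordS i) ->
  closers_le (e i p) p.
Proof. by move=> i1 oi oj k; rewrite [leqRHS](closers_valley k i1 oi oj) leq_addr. Qed.

(** e_i removes at most the box at a valley; in the other cases it fixes p or moves a closer to the
    left, which enlarges the diagram. *)
Lemma closers_e p i k : (i.+1 < n.*2)%N ->
  (closers p k <= closers (e i p) k + (k == i.+1))%N.
Proof.
move=> i1; have [oi|oi] := boolP (opener p i); have [oj|oj] := boolP (opener p (ordS i)).
- apply: leq_trans (leq_addr _ _).
  by apply: (closers_swap_le (e_opener_NN i1 oi oj) oj).
- by rewrite e_connected ?leq_addr //; exact: opener_connected.
- by rewrite (closers_valley k i1 oi oj).
- apply: leq_trans (leq_addr _ _).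
  apply: (closers_swap_le (e_opener_EE i1 oi oj)); first by rewrite opener_partner.
  by rewrite nc_ltNge.
Qed.

(** The only box that e_i can remove from t is the one by which p exceeds e_i p. This bound makes
    the recursion for Psi and the action of D_i triangular. *)
Lemma preimage_le p i s t : (i.+1 < n.*2)%N -> ~~ opener p i -> opener p (ordS i) ->
  closers_le s (e i p) -> e i t = s -> closers_le t p.
Proof.
move=> i1 oi oj sp ts k; rewrite (closers_valley k i1 oi oj).
apply: leq_trans (closers_e t k i1) _; rewrite ts leq_add2r; exact: sp.
Qed.

End Matchings.

(** * Young diagrams and their last boxes *)

Section Diagram.

Variable n : nat.
Implicit Types (p s : NC n) (i j x : 'I_n.*2) (l : seq nat).

Definition openers p : seq nat :=
  [seq nat_of_ord i | i <- enum 'I_n.*2 & opener p i].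

Lemma lamE p : lam p = [seq c <- rev (map (closers p) (openers p)) | (0 < c)%N].
Proof. by rewrite /lam /openers -map_comp. Qed.

Lemma openers_sorted p : sorted ltn (openers p).
Proof.
apply: (subseq_sorted ltn_trans (map_subseq _ (filter_subseq _ _))).
by rewrite val_enum_ord iota_ltn_sorted.
Qed.

Lemma count_lt_iota k m : (k <= m)%N -> count (fun z : nat => z < k)%N (iota 0 m) = k.
Proof.
move=> km; rewrite -(subnKC km) iotaD count_cat add0n.
have /eqP -> : count (fun z : nat => z < k)%N (iota 0 k) == size (iota 0 k).
  by rewrite -all_count; apply/allP => y; rewrite mem_iota.
have /eqP -> : count (fun z : nat => z < k)%N (iota k (m - k)) == 0%N.
  rewrite -leqn0 leqNgt -has_count.
  by apply/hasPn => y; rewrite mem_iota -leqNgt => /andP [].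
by rewrite size_iota addn0.
Qed.

Lemma closers_count p k : closers p k =
  count (fun y : 'I_n.*2 => (y < k)%N && ~~ opener p y) (enum 'I_n.*2).
Proof.
rewrite /closers cardE size_filter -enumT; apply: eq_count => y /=.
by rewrite inE nc_ltNge.
Qed.

Lemma closers_openers p k : (k <= n.*2)%N ->
  (closers p k + count (fun z : nat => z < k)%N (openers p) = k)%N.
Proof.
move=> kn; rewrite /openers count_map count_filter closers_count.
rewrite -[RHS](count_lt_iota kn) -val_enum_ord count_map.
rewrite -(count_predUI (fun y : 'I_n.*2 => (y < k)%N && ~~ opener p y)).
rewrite [X in (_ + X)%N](@eq_count _ _ pred0) ?count_pred0 ?addn0.
  by apply: eq_count => y /=; case: opener; rewrite ?andbT ?andbF ?orbF.
by move=> y /=; case: opener; rewrite ?andbF.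
Qed.

Lemma size_openers p : size (openers p) = n.
Proof.
have /(_ n.*2 (leqnn _)) := closers_openers p.
have -> : count (fun z : nat => z < n.*2)%N (openers p) = size (openers p).
  by apply/eqP; rewrite -all_count; apply/allP => _ /mapP [y _ ->].
have -> : closers p n.*2 = size (openers p).
  rewrite /openers size_map size_filter closersE.
  rewrite (eq_bigr (fun=> 1%N)) => [|y _]; last by rewrite ltn_ord.
  rewrite (reindex_inj (@nc_inj _ p)) -sum1_count big_enum_cond /=.
  by apply: eq_bigl => y; rewrite opener_partner negbK.
lia.
Qed.

Lemma nth_lt_count l t k : sorted ltn l -> (t < size l)%N ->
  (nth 0%N l t < k)%N = (t < count (fun z : nat => z < k)%N l)%N.
Proof.
elim: l t => [//|y l IH] t /=; rewrite (path_sortedE ltn_trans) => /andP [yl sl].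
have [yk|ky] := ltnP y k; case: t => [|t] /= ht //.
  by rewrite add1n ltnS IH.
  have -> : count (fun z : nat => z < k)%N l = 0%N.
    apply/eqP; rewrite -leqn0 leqNgt -has_count; apply/hasPn => z /(allP yl) /= h.
    by rewrite -leqNgt; apply: leq_trans ky (ltnW h).
  by rewrite addn0 ltnNge ky.
have -> : count (fun z : nat => z < k)%N l = 0%N.
  apply/eqP; rewrite -leqn0 leqNgt -has_count; apply/hasPn => z /(allP yl) /= h.
  by rewrite -leqNgt; apply: leq_trans ky (ltnW h).
rewrite addn0; apply/negbTE; rewrite -leqNgt.
have := allP yl _ (mem_nth 0%N (ht : t < size l)%N) => /= h.
exact: leq_trans ky (ltnW h).
Qed.

Lemma nth_openers_lt p t : (t < n)%N -> (nth 0%N (openers p) t < n.*2)%N.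
Proof.
move=> tn; have := mem_nth 0%N (_ : (t < size (openers p))%N).
by rewrite size_openers => /(_ tn) /mapP [y _ ->].
Qed.

Lemma closers_nth p t : (t < n)%N ->
  (closers p (nth 0%N (openers p) t) + t = nth 0%N (openers p) t)%N.
Proof.
move=> tn; have tl : (t < size (openers p))%N by rewrite size_openers.
have ho := ltnW (nth_openers_lt p tn).
rewrite -[RHS](closers_openers p ho); congr (_ + _)%N.
set o := nth _ _ t; apply/eqP; rewrite eqn_leq; apply/andP; split; last first.
  by rewrite leqNgt -(nth_lt_count _ (openers_sorted p) tl) ltnn.
case: t @o tn tl ho => // t /= tn tl ho.
rewrite -(nth_lt_count _ (openers_sorted p) (ltnW tl)).
by apply: (sorted_ltn_nth ltn_trans) => //; [exact: openers_sorted | exact: ltnW].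
Qed.

Lemma nth_filter_pos l r : sorted geq l ->
  nth 0%N [seq c <- l | (0 < c)%N] r = nth 0%N l r.
Proof.
elim: l r => [//|c l IH] r /=; rewrite (path_sortedE (rev_trans leq_trans)) => /andP [cl sl].
case: ltnP => [_|]; first by case: r => //= r; exact: IH.
rewrite leqn0 => /eqP c0; have l0 r' : nth 0%N l r' = 0%N.
  have [h|h] := ltnP r' (size l); last by rewrite nth_default.
  by have /= := allP cl _ (mem_nth 0%N h); rewrite c0 leqn0 => /eqP.
by rewrite IH // l0; case: r => [|r] /=; rewrite ?c0 ?l0.
Qed.

Lemma closers_mono p k m : (k <= m)%N -> (closers p k <= closers p m)%N.
Proof.
move=> km; rewrite !closersE; apply: leq_sum => y _.
by case: (ltnP y k) => // h; rewrite (leq_trans h km).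
Qed.

Lemma rows_sorted p : sorted geq (rev (map (closers p) (openers p))).
Proof.
rewrite rev_sorted; apply: (homo_sorted (e := ltn)); last exact: openers_sorted.
by move=> k m /ltnW; exact: closers_mono.
Qed.

(** The top row belongs to the last north-step, hence the reversed index; rows decrease, so dropping
    the empty ones shifts nothing. *)
Lemma nth_lam p r : (r < n)%N ->
  nth 0%N (lam p) r = closers p (nth 0%N (openers p) (n - r.+1)).
Proof.
move=> rn; rewrite lamE nth_filter_pos ?rows_sorted //.
have sz : size (map (closers p) (openers p)) = n by rewrite size_map size_openers.
by rewrite nth_rev sz // (nth_map 0%N) // size_openers; lia.
Qed.

Lemma closers_le_NCle s p : closers_le s p -> NCle s p.
Proof.
move=> sp; apply/forallP => r; rewrite !nth_lam //.
have tn : (n - r.+1 < n)%N by have := ltn_ord r; lia.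
move: (n - r.+1)%N tn => t tn.
(* Adding t turns the row length at the t-th opener (counted from 0) into the position of that
   opener. *)
rewrite -(leq_add2r t) !closers_nth //.
have tl (q : NC n) : (t < size (openers q))%N by rewrite size_openers.
rewrite -ltnS (nth_lt_count _ (openers_sorted s) (tl s)).
have := nth_lt_count (nth 0%N (openers p) t).+1 (openers_sorted p) (tl p).
rewrite ltnSn => /esym h; apply: leq_trans h _.
have kn := nth_openers_lt p tn.
have := closers_openers p kn; have := closers_openers s kn.
have := sp (nth 0%N (openers p) t).+1.
move: (closers _ _) (closers _ _) (count _ _) (count _ _); lia.
Qed.

Lemma incr_nth_cat_size l l' : incr_nth (l ++ l') (size l) = l ++ incr_nth l' 0.
Proof. by elim: l => //= c l ->. Qed.

Lemma openers_valley p i : (i.+1 < n.*2)%N -> ~~ opener p i -> opener p (ordS i) ->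
  exists l l', [/\ openers p = l ++ i.+1 :: l', openers (e i p) = l ++ (i : nat) :: l',
    all (fun z : nat => z < i)%N l & all (fun z : nat => i.+1 < z)%N l'].
Proof.
move=> i1 oi oj; pose E := enum 'I_n.*2.
have sE : size E = n.*2 by rewrite size_enum_ord.
have jE : nat_of_ord (ordS i) = i.+1 by exact: ordS_small.
have EE : E = take i E ++ i :: ordS i :: drop i.+2 E.
  rewrite -[LHS](cat_take_drop i) (drop_nth i) ?sE ?ltn_ord // nth_ord_enum.
  rewrite (drop_nth i) ?sE //; congr (_ ++ _ :: _ :: _).
  by rewrite -[in LHS]jE nth_ord_enum.
have t1 y : y \in take i E -> (y < i)%N.
  move=> /(map_f val); rewrite map_take val_enum_ord take_iota mem_iota add0n.
  by move=> /andP [_ h]; apply: leq_trans h (geq_minl _ _).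
have t2 y : y \in drop i.+2 E -> (i.+1 < y)%N.
  move=> /(map_f val); rewrite map_drop val_enum_ord drop_iota mem_iota.
  by case/andP.
have oe y : y != i -> y != ordS i -> opener (e i p) y = opener p y.
  by move=> yi yj; rewrite (e_opener_EN i1 oi oj) tpermD 1?eq_sym.
have oei : opener (e i p) i by rewrite (e_opener_EN i1 oi oj) tpermL.
have oej : ~~ opener (e i p) (ordS i) by rewrite (e_opener_EN i1 oi oj) tpermR.
move: (take i E) (drop i.+2 E) EE t1 t2 => a b EE t1 t2.
exists [seq nat_of_ord y | y <- a & opener p y], [seq nat_of_ord y | y <- b & opener p y].
rewrite /openers -/E EE !filter_cat /= (negPf oi) oj oei (negPf oej) !map_cat !map_cons jE.
split=> //.
- congr (_ ++ _ :: _); congr map; apply: eq_in_filter => y.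
    by move/t1 => h; rewrite oe // -(inj_eq (@ord_inj _)) ?jE neq_ltn ?h ?(leqW h).
  by move/t2 => h; rewrite oe // -(inj_eq (@ord_inj _)) ?jE neq_ltn ?h ?(ltnW h) orbT.
- apply/allP => _ /mapP [y + ->]; rewrite mem_filter => /andP [_ /t1 //].
- apply/allP => _ /mapP [y + ->]; rewrite mem_filter => /andP [_ /t2 //].
Qed.

Lemma rainbow_openers p : (forall x, opener p x -> closers p x = 0%N) -> p = rainbow n.
Proof.
move=> h; apply: opener_inj => x; rewrite [RHS]/opener ffunE /=.
have key s : (forall x, opener s x -> closers s x = 0%N) -> openers s = iota 0 n.
  move=> hs; apply: (@eq_from_nth _ 0%N); rewrite ?size_openers ?size_iota // => t tn.
  rewrite nth_iota // add0n -[LHS](closers_nth s tn).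
  have := mem_nth 0%N (_ : (t < size (openers s))%N); rewrite size_openers => /(_ tn).
  by case/mapP => y + ->; rewrite mem_filter => /andP [/hs -> _].
have mo s (y : 'I_n.*2) : (nat_of_ord y \in openers s) = opener s y.
  by rewrite (mem_map (@ord_inj _)) mem_filter mem_enum andbT.
by rewrite -mo key // mem_iota /= add0n; have := ltn_ord x; move: (nat_of_ord x); clear; lia.
Qed.

(** The outermost operator belongs to the last box, in row [size l] + 1 and column g + 1; a row that
    becomes empty disappears from the list. *)
Lemma word_rcons base l g :
  word base (rcons l g.+1) =
  (base + g%:Z - (size l)%:Z) :: word base (if g is 0 then l else rcons l g).
Proof.
pose row (m : nat) (la : seq nat) (i : nat) := [seq base + (i%:Z - m%:Z) +
  ((nth 0%N la (m - i))%:Z - j%:Z) | j : nat <- iota 1 (nth 0%N la (m - i))].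
have wE la : word base la = flatten (map (row (size la) la) (iota 1 (size la))) by [].
rewrite !wE size_rcons /= {1}/row subSS subn0 nth_rcons ltnn eqxx /=.
congr (_ :: _); first by lia.
have -> : [seq base + (1 - (size l).+1%:Z) + (g.+1%:Z - j%:Z) | j : nat <- iota 2 g] =
          [seq base + (1 - (size l).+1%:Z) + (g%:Z - j%:Z) | j : nat <- iota 1 g].
  by rewrite (iotaDl 1 1) -map_comp; apply: eq_map => j /=; lia.
case: g => [|g] /=.
  rewrite (iotaDl 1 1) -map_comp; congr flatten; apply/eq_in_map => i.
  rewrite mem_iota add1n => /andP [i0 il] /=; rewrite /row add1n subSS nth_rcons.
  have -> : (size l - i < size l)%N by lia.
  by apply: eq_map => j; lia.
rewrite !size_rcons /= {2}/row subSS subn0 nth_rcons ltnn eqxx /=.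
congr (_ :: _); congr (_ ++ _); congr flatten; apply/eq_in_map => i.
rewrite mem_iota => /andP [i0 il] /=; rewrite /row !nth_rcons.
by have -> : ((size l).+1 - i < size l)%N by lia.
Qed.

(* The first valley of the path of p carries the last box of the last row. *)
Lemma last_box p : p != rainbow n -> exists i, [/\ (i.+1 < n.*2)%N,
  ~~ opener p i, opener p (ordS i), add_box i.+1 (e i p) p
  & forall base, word base (lam p) = (base + i.+1%:Z - n%:Z) :: word base (lam (e i p))].
Proof.
move=> pR; have [/existsP [x0 hx0]|] := boolP [exists x, opener p x && (0 < closers p x)%N];
  last first.
  rewrite negb_exists => /forallP h; case/eqP: pR; apply: rainbow_openers => x ox.
  by have := h x; rewrite ox /= -eqn0Ngt => /eqP.
(* The first opener j with a closer before it; by minimality the point just before j is a closer,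
   and this is the first valley. *)
case: (@arg_minnP _ x0 (fun x => opener p x && (0 < closers p x)%N)
  (fun x => nat_of_ord x) hx0).
move=> j /andP [oj cj] jmin; have j0 : (0 < j)%N.
  by rewrite lt0n; apply: contraTneq cj => ->; rewrite closers0.
have ilt : (j.-1 < n.*2)%N by have := ltn_ord j; lia.
pose i := Ordinal ilt; have i1E : i.+1 = j by rewrite /= prednK.
have i1 : (i.+1 < n.*2)%N by rewrite i1E.
have ji : ordS i = j by apply: ord_inj; rewrite ordS_small.
have oi : ~~ opener p i.
  apply/negP => oi; have := jmin i; rewrite oi /= => hi.
  have /hi : (0 < closers p i)%N.
    by have := closersS p i; rewrite oi addn0 i1E => <-.
  by rewrite leqNgt ltn_predL j0.
have oj' : opener p (ordS i) by rewrite ji.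
have [l [l' [eo eo' hl hl']]] := openers_valley i1 oi oj'.
pose g := closers (e i p) i; pose R := rev (map (closers p) l').
have cE k : k != i.+1 -> closers (e i p) k = closers p k.
  by move=> ki; rewrite (closers_valley k i1 oi oj') (negPf ki) addn0.
have gE : closers p i.+1 = g.+1.
  rewrite (closers_valley _ i1 oi oj') eqxx closersS.
  by rewrite (e_opener_EN i1 oi oj') tpermL ji oj addn0 addn1.
have l0 : [seq c <- rev (map (closers p) l) | (0 < c)%N] = [::].
  apply/eqP; rewrite -size_eq0 size_filter -leqn0 leqNgt -has_count -all_predC.
  rewrite all_rev all_map; apply/allP => k kl /=; rewrite -leqNgt leqn0 -leqn0 leqNgt.
  apply/negP => ck; have : k \in openers p by rewrite eo mem_cat kl.
  case/mapP => y; rewrite mem_filter => /andP [oy _] ky.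
  have := jmin y; rewrite oy -ky ck => /(_ isT); have /= := allP hl _ kl.
  by rewrite -i1E; clear; lia.
have l1 : [seq c <- R | (0 < c)%N] = R.
  apply/all_filterP; rewrite all_rev all_map; apply/allP => k /(allP hl') /= h.
  by apply: leq_trans (closers_mono p (ltnW h)); rewrite gE.
have lamp : lam p = rcons R g.+1.
  rewrite lamE eo map_cat map_cons rev_cat rev_cons cat_rcons filter_cat l1 /=.
  by rewrite gE /= l0 cats1.
have lame : lam (e i p) = if g is 0 then R else rcons R g.
  rewrite lamE eo' map_cat map_cons rev_cat rev_cons cat_rcons filter_cat /= -/g.
  have -> : map (closers (e i p)) l' = map (closers p) l'.
    by apply/eq_in_map => k /(allP hl') h; apply: cE; rewrite neq_ltn h orbT.
  have -> : map (closers (e i p)) l = map (closers p) l.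
    by apply/eq_in_map => k /(allP hl) h; apply: cE; rewrite neq_ltn ltnW.
  by rewrite -/R l1 l0; case: (g) => [|g'] /=; rewrite ?cats0 ?cats1.
(* Counting steps up to the valley: the box in row [size R] + 1 and column g + 1 lies on diagonal i
   + 1. *)
have sR : (i.+1 + (size R).+1 = n + g.+1)%N.
  have := size_openers p; rewrite eo size_cat /= size_rev size_map.
  have := closers_openers p (ltnW i1); rewrite gE eo count_cat /= ltnn add0n.
  have -> : count (fun z : nat => z < i.+1)%N l = size l.
    apply/eqP; rewrite -all_count; apply: sub_all hl => z; exact: leqW.
  have -> : count (fun z : nat => z < i.+1)%N l' = 0%N.
    apply/eqP; rewrite -leqn0 leqNgt -has_count -all_predC.
    by apply: sub_all hl' => z /= h; rewrite -leqNgt ltnW.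
  by clear; lia.
exists i; rewrite ji; split=> //.
  exists (size R); rewrite lamp nth_rcons ltnn eqxx; split=> //.
  rewrite lame; case: (g) => [|g'].
    by have := incr_nth_cat_size R [::]; rewrite cats0 => ->; rewrite cats1.
  by have := incr_nth_cat_size R [:: g'.+1]; rewrite /= !cats1 => ->.
move=> base; rewrite lamp lame word_rcons; congr (_ :: _).
by move: sR; clear; lia.
Qed.

Lemma lam_rainbow : lam (rainbow n) = [::].
Proof.
rewrite lamE; apply/eqP; rewrite -size_eq0 size_filter -leqn0 leqNgt -has_count -all_predC.
rewrite all_rev all_map; apply/allP => _ /mapP [x + ->] /=.
rewrite mem_filter /opener ffunE /= => /andP [hx _].
rewrite -leqNgt leqn0 closersE big1 // => y; rewrite /opener ffunE /=.
by move: hx; have := ltn_ord x; have := ltn_ord y; clear; case: ltnP; lia.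
Qed.

End Diagram.

(** The k new openers precede every closer and give empty rows; the counts at the old openers do not
    change. *)
Lemma lam_nest k n (p : NC n) : lam (nest k p) = lam p.
Proof.
have sz : (n + k).*2 = (k + n.*2 + k)%N by exact: nest_size.
have inN (z : nat) : (z < n.*2)%N -> (k + z < (n + k).*2)%N by rewrite sz; clear; lia.
pose up (y : 'I_n.*2) : 'I_(n + k).*2 := Ordinal (inN y (ltn_ord y)).
have oup y : opener (nest k p) (up y) = opener p y.
  by rewrite /opener (@nest_fun_in k n p (up y) y) //= ltn_add2l.
have oout (x : 'I_(n + k).*2) : (x < k)%N || (k + n.*2 <= x)%N ->
    opener (nest k p) x = (x < k)%N.
  move=> h; rewrite /opener [nest k p x]nest_fun_out //=.
  by have := ltn_ord x; move: h; clear; lia.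
have split_at (x : 'I_(n + k).*2) : (x < k)%N || (k + n.*2 <= x)%N \/ exists y, x = up y.
  have [h|] := boolP ((x < k)%N || (k + n.*2 <= x)%N); first by left.
  rewrite negb_or -leqNgt -ltnNge => /andP [h1 h2]; right.
  have h : (x - k < n.*2)%N by move: h1 h2; clear; lia.
  by exists (Ordinal h); apply: ord_inj => /=; rewrite subnKC.
have cup m : (m <= n.*2)%N -> closers (nest k p) (k + m) = closers p m.
  elim: m => [|m IH] hm.
    rewrite addn0 closers0 closersE big1 // => x ox; apply/eqP; rewrite eqb0.
    by apply: contra ox => h; rewrite oout h.
  rewrite addnS -[m]/(nat_of_ord (Ordinal hm)) -[(k + _)%N]/(nat_of_ord (up (Ordinal hm))).
  by rewrite !closersS oup /= IH // ltnW.
have eo : openers (nest k p) = iota 0 k ++ map (addn k) (openers p).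
  apply: (irr_sorted_eq ltn_trans ltnn).
  - exact: openers_sorted.
  - rewrite sorted_pairwise ?pairwise_cat; last exact: ltn_trans.
    rewrite -!(sorted_pairwise ltn_trans) iota_ltn_sorted /=; apply/andP; split.
      apply/allrelP => x z; rewrite mem_iota add0n => /andP [_ xk] /mapP [y _ ->].
      exact: leq_trans xk (leq_addr _ _).
    rewrite sorted_map (@eq_sorted _ _ ltn) ?openers_sorted // => x y /=.
    exact: ltn_add2l.
  - move=> z; rewrite mem_cat mem_iota add0n /=.
    apply/mapP/orP => [[x + ->]|[zk|/mapP [_ /mapP [y + ->] ->]]].
    + rewrite mem_filter => /andP [+ _]; have [h|[y ->]] := split_at x.
        by rewrite oout // => ->; left.
      rewrite oup => oy; right; apply: map_f; apply: map_f.
      by rewrite mem_filter oy mem_enum.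
    + have zn : (z < (n + k).*2)%N by rewrite sz; move: zk; clear; lia.
      exists (Ordinal zn); rewrite // mem_filter mem_enum andbT oout /= ?zk //.
    + rewrite mem_filter => /andP [oy _]; exists (up y) => //.
      by rewrite mem_filter mem_enum oup oy.
rewrite !lamE eo map_cat rev_cat filter_cat -map_comp.
have -> : map (closers (nest k p) \o addn k) (openers p) = map (closers p) (openers p).
  by apply/eq_in_map => _ /mapP [y _ ->] /=; rewrite cup // ltnW.
rewrite -[RHS]cats0; congr (_ ++ _); apply/eqP.
rewrite -size_eq0 size_filter -leqn0 leqNgt -has_count -all_predC all_rev all_map.
apply/allP => z; rewrite mem_iota add0n => /andP [_ zk] /=; rewrite -leqNgt.
by have := closers_mono (nest k p) (ltnW zk); have := cup 0%N; rewrite addn0 closers0 => ->.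
Qed.

(** * The operators and the polynomials Psi *)

Section Operators.

Variables (F : fieldType) (n : nat) (q : F).
Hypotheses (qE : q ^+ 2 + q + 1 = 0) (q1 : q != 1).
Local Notation N := n.*2.
Implicit Types (f g : {mpoly F[N]}) (i x y : 'I_N) (p s : NC n).
Implicit Types (t : 'I_N -> {mpoly F[N]}) (v : 'I_N -> F).

Local Notation X := (fun k : 'I_N => 'X_k : {mpoly F[N]}).

Lemma dhomog_msize_le d f : f \is d.-homog -> (msize f <= d.+1)%N.
Proof.
move=> /dhomogP h; rewrite msizeE; apply/bigmax_leqP_seq => m hm _.
by rewrite (h m hm).
Qed.

Lemma dhomog_divl d g f : g \is 1.-homog -> g != 0 -> g * f \is d.+1.-homog ->
  f \is d.-homog.
Proof.
move=> hg g0 hgf; rewrite homog_piE; apply/eqP; apply: (mulfI g0).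
rewrite -[RHS](pihomog_dE hgf).
have hH e : g * pihomog mdeg e f \is e.+1.-homog.
  by rewrite -add1n dhomogM // pihomogP.
pose K := maxn (msize f) d.+1.
rewrite [X in _ = pihomog _ _ (_ * X)](@pihomog_partitionE _ _ mdeg K f) ?leq_maxl //.
rewrite [X in _ = pihomog _ _ X]mulr_sumr linear_sum /=.
have dK : (d < K)%N by rewrite leq_max ltnSn orbT.
rewrite (bigD1 (Ordinal dK)) //= [X in _ + X]big1 ?addr0.
  by rewrite [RHS]pihomog_dE.
move=> e ne; apply: (@pihomog_ne0 _ _ _ e.+1); last exact: hH.
by rewrite eqSS; apply: contraNneq ne => e'; apply/eqP/val_inj.
Qed.

Lemma dhomog_msym d (sg : 'S_N) f : f \is d.-homog -> msym sg f \is d.-homog.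
Proof.
by rewrite !homog_piE => /eqP h; rewrite -msym_pihomog h.
Qed.

Lemma dhomog_X x : ('X_x : {mpoly F[N]}) \is 1.-homog.
Proof. by rewrite dhomogX /= mdeg1. Qed.

Lemma Dop_eq i f : ('X_(ordS i) - 'X_i) * Dop q i f =
  (q *: 'X_i - q^-1 *: 'X_(ordS i)) * (swap i f - f).
Proof. by rewrite /Dop mulrCA divdiffE. Qed.

Lemma ordS_X_neq0 i : 'X_(ordS i) - 'X_i != 0 :> {mpoly F[N]}.
Proof.
have := @linear_neq0 F N (ordS i) 1 i; rewrite scale1r; apply.
exact/eqP/ordS_neq.
Qed.

Lemma Dop_linear i (a : F) f g : Dop q i (a *: f + g) = a *: Dop q i f + Dop q i g.
Proof.
apply: (mulfI (ordS_X_neq0 i)); rewrite mulrDr -scalerAr !Dop_eq.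
rewrite /swap msymD msymZ -!mul_mpolyC; ring.
Qed.

HB.instance Definition _ i := GRing.isLinear.Build F {mpoly F[N]} {mpoly F[N]} _ (Dop q i)
  (Dop_linear i).

(** Wheel polynomials with q^4 = q built in and z_i as the free variable; [inW_wheel] translates
    back. *)
Definition inW f := f \is (n * n.-1)%N.-homog /\ wheel_on q [set: 'I_N] f.

Lemma inW_msize f : inW f -> (msize f <= (n * n.-1).+1)%N.
Proof. by case=> /dhomog_msize_le. Qed.

Lemma inW_linear (a : F) f g : inW f -> inW g -> inW (a *: f + g).
Proof.
move=> [hf wf] [hg wg]; split; first by rewrite rpredD // rpredZ.
move=> t x y z Ax Ay Az xy yz ty tz.
by rewrite raddfD /= evZ (wf t x y z) // (wg t x y z) // scaler0 addr0.
Qed.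

Lemma inW0 : inW 0.
Proof. by split; [exact: rpred0 | move=> *; rewrite raddf0]. Qed.

Lemma inW_sum (I : finType) (P : pred I) (h : I -> {mpoly F[N]}) :
  (forall k, P k -> inW (h k)) -> inW (\sum_(k | P k) h k).
Proof.
move=> hP; apply: big_ind => //; first exact: inW0.
by move=> f g hf hg; rewrite -[f]scale1r; apply: inW_linear.
Qed.

Lemma inW_wheel f : inW f -> wheel q f.
Proof.
move=> [hf wf]; split=> // i j k ij jk; rewrite comp_mpoly_ev.
have nij : i != j by rewrite -(inj_eq (@ord_inj _)) neq_ltn ij.
have njk : j != k by rewrite -(inj_eq (@ord_inj _)) neq_ltn jk.
have nik : i != k by rewrite -(inj_eq (@ord_inj _)) neq_ltn (ltn_trans ij jk).
have q0 := q_neq0 qE; have q3 := q_cube qE.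
apply: (wf _ i j k); rewrite ?inE // !tnth_mktuple eqxx.
  rewrite eq_sym (negPf nij) eqxx scalerA.
  by have -> : q ^+ 2 / q ^+ 4 = q ^- 2 by field.
rewrite eq_sym (negPf nik) eq_sym (negPf njk) scalerA.
have -> : q / q ^+ 4 = (q ^+ 3)^-1 by field.
by rewrite q3 invr1 scale1r.
Qed.

Lemma tperm_adjacent i x y : (i.+1 < N)%N -> (x < y)%N ->
  ~~ ((x == i) && (y == ordS i)) ->
  (tperm i (ordS i) x < tperm i (ordS i) y)%N.
Proof.
move=> i1 xy; have jE := ordS_small i1.
rewrite -!(inj_eq (@ord_inj _)) jE.
case: tpermP => [ex|ex|/eqP nx1 /eqP nx2]; case: tpermP => [ey|ey|/eqP ny1 /eqP ny2];
  rewrite ?ex ?ey ?jE; move: xy; rewrite ?ex ?ey ?jE;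
  repeat match goal with H : is_true (_ != _) |- _ =>
    move: H; rewrite -!(inj_eq (@ord_inj _)) ?jE end; clear; lia.
Qed.

(** At a wheel (a, b, c), f vanishes. If (i, i + 1) is (a, b) or (b, c), the factor q z_i - q^-1
    z_(i+1) vanishes; otherwise exchanging i and i + 1 keeps the wheel increasing and S_i f
    vanishes. *)
Lemma inW_Dop i f : (i.+1 < N)%N -> inW f -> inW (Dop q i f).
Proof.
move=> i1 [hf wf]; have jE := ordS_small i1; split.
  apply: (dhomog_divl (g := 'X_(ordS i) - 'X_i)).
  - by rewrite rpredB // dhomog_X.
  - exact: ordS_X_neq0.
  rewrite Dop_eq -add1n dhomogM //; first by rewrite rpredB // rpredZ // dhomog_X.
  by rewrite rpredB // dhomog_msym.
apply: wheel_onP => a b c _ _ _ ab bc; set t := wheel_pt q a b c.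
have nab : a != b by rewrite -(inj_eq (@ord_inj _)) neq_ltn ab.
have nbc : b != c by rewrite -(inj_eq (@ord_inj _)) neq_ltn bc.
have nac : a != c by rewrite -(inj_eq (@ord_inj _)) neq_ltn (ltn_trans ab bc).
have nij : i != ordS i by rewrite eq_sym; apply/eqP/ordS_neq.
have ta : t a = 'X_a by rewrite /t /wheel_pt !upd_neq.
have tb : t b = q ^+ 2 *: 'X_a by rewrite /t /wheel_pt upd_neq // updE.
have tc : t c = q *: 'X_a by rewrite /t /wheel_pt updE.
have q0 := q_neq0 qE; have q3 := q_cube qE.
move: (Dop q i f) (Dop_eq i f) => D /(congr1 (ev t)).
rewrite !rmorphM !raddfB /= !evZ !evX /swap ev_msym.
rewrite (wf t a b c) ?inE ?ta // subr0.
have [tE|tNE] : t (ordS i) = q ^+ 2 *: t i /\ (exists2 d, d != 0 & t i = d *: 'X_a) \/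
    [/\ t (ordS i) - t i != 0, ~~ ((a == i) && (b == ordS i))
      & ~~ ((b == i) && (c == ordS i))].
- case: (boolP ((a == i) && (b == ordS i))) => [/andP [/eqP <- /eqP <-]|h1].
    left; rewrite ta tb; split=> //; exists 1; rewrite ?scale1r ?oner_neq0 //.
  case: (boolP ((b == i) && (c == ordS i))) => [/andP [/eqP <- /eqP <-]|h2].
    left; rewrite tb tc scalerA q4 //; split=> //.
    by exists (q ^+ 2); rewrite ?expf_neq0.
  right; split=> //; have h3 : ~~ ((a == i) && (c == ordS i)).
    apply/negP => /andP [/eqP ea /eqP ec]; move: ab bc; rewrite ea ec jE; clear; lia.
  have tX x : x != b -> x != c -> t x = 'X_x by exact: wheel_pt_ne.
  have tin x : [\/ x = a, x = b | x = c] -> exists d, t x = d *: 'X_a.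
    case=> ->; [by exists 1; rewrite ta scale1r | by exists (q ^+ 2) | by exists q].
  have cs x : [\/ x = a, x = b | x = c] \/ [/\ x != a, x != b & x != c].
    case: (eqVneq x a) => [->|?]; first by left; constructor 1.
    case: (eqVneq x b) => [->|?]; first by left; constructor 2.
    by case: (eqVneq x c) => [->|?]; [left; constructor 3 | right].
  have [hi|[ia ib ic]] := cs i; have [hj|[ja jb jc]] := cs (ordS i).
  + exfalso; case: hi hj => /(congr1 (@nat_of_ord _)) e1 [] /(congr1 (@nat_of_ord _)) e2;
      move: h1 h2 h3 ab bc jE e1 e2; rewrite -!(inj_eq (@ord_inj _));
      move: (nat_of_ord (ordS i)) (nat_of_ord i) (nat_of_ord a) (nat_of_ord b)
        (nat_of_ord c) => j' i' a' b' c'; clear; lia.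
  + have [d ->] := tin _ hi; rewrite tX //; apply: linear_neq0 => //.
  + have [d ->] := tin _ hj; rewrite tX // -opprB oppr_eq0; apply: linear_neq0 => //.
  + by rewrite !tX // ordS_X_neq0.
- case: tE => tj [d d0 ti]; rewrite tj scalerA.
  have -> : q^-1 * q ^+ 2 = q by rewrite expr2 mulrA mulVf ?mul1r.
  rewrite subrr mul0r => /eqP; rewrite mulf_eq0 => /orP [|/eqP //].
  rewrite -{2}[t i]scale1r -scalerBl -mul_mpolyC mulf_eq0 mpolyC_eq0 subr_eq0.
  rewrite (negPf (q2_neq1 qE q1)) ti -mul_mpolyC mulf_eq0 mpolyC_eq0 (negPf d0) /=.
  by rewrite (negPf (mpolyX_neq0 _ _)).
case: tNE => tn h1 h2; rewrite (wf _ (tperm i (ordS i) a) (tperm i (ordS i) b)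
    (tperm i (ordS i) c)) ?inE //= ?tpermK ?ta //; try exact: tperm_adjacent.
by rewrite mulr0 => /eqP; rewrite mulf_eq0 (negPf tn) => /eqP.
Qed.

Definition Eop i f := f + Dop q i f.

(** As 1 + q + q^-1 = 0, multiplying (1 + D_i) f by z_(i+1) - z_i gives (q z_i - q^-1 z_(i+1)) S_i f
    - (q z_(i+1) - q^-1 z_i) f, which is antisymmetric. *)
Lemma Eop_sym i f : sym_at i (ordS i) (Eop i f).
Proof.
rewrite /sym_at -/(swap i _); apply/eqP; rewrite -subr_eq0.
have X0 := ordS_X_neq0 i; suff : ('X_(ordS i) - 'X_i) * (swap i (Eop i f) - Eop i f) = 0.
  by move/eqP; rewrite mulf_eq0 (negPf X0).
have sX : swap i ('X_(ordS i) - 'X_i) = 'X_i - 'X_(ordS i) :> {mpoly F[N]}.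
  by rewrite /swap raddfB /= /msym !mmapX !mmap1U tpermR tpermL.
have sY : swap i (q *: 'X_i - q^-1 *: 'X_(ordS i)) =
    q *: 'X_(ordS i) - q^-1 *: 'X_i :> {mpoly F[N]}.
  by rewrite /swap raddfB /= !msymZ /msym !mmapX !mmap1U tpermR tpermL.
have ss : swap i (swap i f) = f.
  by rewrite /swap -msymMm tperm2 msym1m.
rewrite /Eop; move: (Dop q i f) (Dop_eq i f) => D h; have h' := congr1 (swap i) h.
rewrite /swap !msymM -!/(swap i _) sX sY /swap msymB -!/(swap i _) ss in h'.
rewrite /swap msymD -!/(swap i _).
have -> : ('X_(ordS i) - 'X_i) * (swap i f + swap i D - (f + D)) =
  ('X_(ordS i) - 'X_i) * (swap i f - f) - ('X_i - 'X_(ordS i)) * swap i D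
   - ('X_(ordS i) - 'X_i) * D by ring.
rewrite h h' -!mul_mpolyC.
have -> : (q^-1)%:MP_[N] = - 1 - q%:MP.
  have -> : q^-1 = - 1 - q; last by rewrite rmorphB rmorphN rmorph1.
  apply: (mulfI (q_neq0 qE)); rewrite divff ?(q_neq0 qE) //.
  by apply/eqP; rewrite -subr_eq0 -qE; apply/eqP; ring.
ring.
Qed.

(** The prefactor of D_i takes the value q^3 - 1 = 0. *)
Lemma meval_Eop i f v : v i = q ^+ 2 -> v (ordS i) = q -> (Eop i f).@[v] = f.@[v].
Proof.
move=> vi vj; rewrite /Eop; move: (Dop q i f) (Dop_eq i f) => D hD.
rewrite mevalD; suff -> : D.@[v] = 0 by rewrite addr0.
have := congr1 (meval v) hD; rewrite !mevalM.

rewrite !raddfB /= !mevalZ !mevalXU vi vj mulVf ?(q_neq0 qE) // -exprS (q_cube qE).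
rewrite subrr mul0r => /eqP; rewrite mulf_eq0 => /orP [|/eqP //].
by rewrite subr_eq0 eq_sym (negPf (q2_neq_q qE q1)).
Qed.

Lemma nc_onT p : nc_on [set: 'I_N] p.
Proof.
split=> [x _|x y _ _]; first by rewrite inE nc_neq nc_inv.
by apply/negP => /and3P [h1 h2 h3]; apply: (@nc_cross _ p x y).
Qed.

Lemma arch_ptE p x : arch_pt q p x = if opener p x then q ^+ 2 else q.
Proof. by []. Qed.

(** At P_(e_i p), (1 + D_i) f and f agree by [meval_Eop]. The symmetric polynomial (1 + D_i) f is
    carried from P_p to P_(e_i p) by exchanging z_i and z_(i+1) at a valley, and by [swap_arch] if
    both points open or both close; at a peak the two points coincide. *)
Lemma Eop_arch_pt i f p : (i.+1 < N)%N -> inW f ->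
  (Eop i f).@[arch_pt q p] = f.@[arch_pt q (e i p)].
Proof.
move=> i1 hf; have jE := ordS_small i1; have [ei ej _] := e_val i p.
have hE : inW (Eop i f).
  by rewrite /Eop -[f]scale1r; apply: inW_linear => //; rewrite scale1r; apply: inW_Dop.
rewrite -(@meval_Eop i f); first last.
- by rewrite arch_ptE /opener ej jE ltnNge leqnSn.
- by rewrite arch_ptE /opener ei jE ltnSn.
have cT : #|[set: 'I_N]| = n.*2 by rewrite cardsT card_ord.
have adj : consecutive [set: 'I_N] i (ordS i).
  by split; rewrite ?inE ?jE // => m _; rewrite ltnS; case: ltngtP.
have [oi|oi] := boolP (opener p i); have [oj|oj] := boolP (opener p (ordS i)).
- rewrite (swap_arch qE q1 cT hE.2 (inW_msize hE) (nc_onT p) (x := i) (in_setT _) oj).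
    by apply: meval_eq => x; rewrite /comp !arch_ptE (e_opener_NN i1 oi oj).
  by left; split=> //; exact: Eop_sym.
- by rewrite e_connected //; exact: opener_connected.
- rewrite -[in LHS](Eop_sym i f) meval_msym; apply: meval_eq => x.
  by rewrite /comp !arch_ptE (e_opener_EN i1 oi oj).
have hu : (p i < p (p i))%N by rewrite -[(_ < _)%N]/(opener p (p i)) opener_partner.
rewrite (swap_arch qE q1 cT hE.2 (inW_msize hE) (nc_onT p) (x := ordS i) (in_setT (p i)) hu).
  by rewrite nc_inv; apply: meval_eq => x; rewrite /comp !arch_ptE (e_opener_EE i1 oi oj).
by right; rewrite nc_inv; split=> //; [rewrite nc_ltNge | exact: Eop_sym].
Qed.

End Operators.

(** * Rotation of matchings *)

Section Rotation.

Variable n : nat.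
Local Notation N := n.*2.
Implicit Types (i x y : 'I_N) (p s : NC n).

Lemma ordS_inj : injective (@ordS N).
Proof. exact: can_inj (@ordSK _). Qed.

Lemma rho_ordS p x : rho p (ordS x) = ordS (p x).
Proof. by rewrite ffunE ordSK. Qed.

Lemma rho_inj : injective (@rho n).
Proof.
move=> p s h; apply: nc_eqP => x; apply: ordS_inj.
by rewrite -!rho_ordS h.
Qed.

Lemma rho_bij : bijective (@rho n).
Proof. exact: injF_bij rho_inj. Qed.

Lemma e_rho i p : e (ordS i) (rho p) = rho (e i p).
Proof.
apply: nc_eqP => x; rewrite -[x]ord_predK; move: (ord_pred x) => y.
by rewrite rho_ordS !e_at !rho_ordS !(inj_eq ordS_inj) !(fun_if (@ordS N)).
Qed.

Lemma val_ord_pred x : (ord_pred x : nat) = if x == 0%N :> nat then N.-1 else x.-1.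
Proof.
have := val_ordS (ord_pred x); rewrite ord_predK.
have := ltn_ord (ord_pred x); case: eqP => [e|e]; case: eqP => [->|ne] //; lia.
Qed.

Lemma opener_rho_rainbow x :
  opener (rho (rainbow n)) x = (x == 0%N :> nat) || (1 < x <= n)%N.
Proof.
have xN := ltn_ord x.
rewrite /opener -[x in LHS]ord_predK rho_ordS ffunE ord_predK val_ordS.
move: (ord_pred x) (val_ord_pred x) => y /= ->.
case: (nat_of_ord x =P 0%N) => [x0|x0] /=.
  by rewrite x0; case: eqP; lia.
by case: eqP; lia.
Qed.

End Rotation.

(** * The polynomial of ()_n and its rotation, evaluated at the points P_s *)

Section RainbowPolynomial.

Variables (F : fieldType) (n : nat) (q : F).
Hypotheses (qE : q ^+ 2 + q + 1 = 0) (q1 : q != 1).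
Local Notation N := n.*2.
Implicit Types (f g : {mpoly F[N]}) (x y z : 'I_N) (p s : NC n) (i j : 'I_n).
Implicit Types (t : 'I_N -> {mpoly F[N]}) (v : 'I_N -> F).

Let lo i : 'I_N := cast_ord (addnn n) (lshift n i).
Let hi i : 'I_N := cast_ord (addnn n) (rshift n i).

Lemma half_index x : (exists i, x = lo i) \/ (exists i, x = hi i).
Proof.
have [h|h] := ltnP x n; [left; exists (Ordinal h) | right].
  exact: val_inj.
have h' : (x - n < n)%N by have := ltn_ord x; lia.
by exists (Ordinal h'); apply: val_inj; rewrite /= subnKC.
Qed.

Lemma sum_pairs : (\sum_(i < n) \sum_(j < n | i < j) 2 = n * n.-1)%N.
Proof.
rewrite (exchange_big_dep predT) //= (eq_bigr (fun j : 'I_n => j * 2)%N); last first.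
  move=> j _; rewrite -(big_ord_widen n (fun=> 2%N)) ?(ltnW (ltn_ord j)) //.
  by rewrite sum_nat_const card_ord.
elim: n => [|m IH]; first by rewrite big_ord0.
by rewrite big_ord_recr /= IH; case: m {IH} => //= m; lia.
Qed.

Lemma dhomog_prod_big (I : Type) (r : seq I) (P : pred I) (d : I -> nat)
    (h : I -> {mpoly F[N]}) :
  (forall k, P k -> h k \is (d k).-homog) ->
  \prod_(k <- r | P k) h k \is (\sum_(k <- r | P k) d k)%N.-homog.
Proof.
move=> hP; elim/big_rec2: _ => [|k e g Pk IH]; first exact: dhomog1.
by rewrite dhomogM ?hP.
Qed.

Lemma qV : q^-1 = q ^+ 2.
Proof.
apply: (mulfI (q_neq0 qE)); rewrite divff ?(q_neq0 qE) //.
by rewrite -exprS (q_cube qE).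
Qed.

(** In a wheel (a, b, c), a and b or b and c lie in the same half, and their factor vanishes. *)
Lemma inW_rainbow : inW q (Psi_rainbow n q).
Proof.
split.
  apply: rpredZ; rewrite -sum_pairs; apply: dhomog_prod_big => i _.
  apply: dhomog_prod_big => j _; rewrite (_ : 2 = 1 + 1)%N //.
  by rewrite dhomogM // rpredB // rpredZ // dhomog_X.
apply: wheel_onP => a b c _ _ _ ab bc; set t := wheel_pt q a b c.
have nab : a != b by rewrite -(inj_eq (@ord_inj _)) neq_ltn ab.
have nbc : b != c by rewrite -(inj_eq (@ord_inj _)) neq_ltn bc.
have nac : a != c by rewrite -(inj_eq (@ord_inj _)) neq_ltn (ltn_trans ab bc).
have ta : t a = 'X_a by rewrite /t /wheel_pt !upd_neq.
have tb : t b = q ^+ 2 *: 'X_a by rewrite /t /wheel_pt upd_neq // updE.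
have tc : t c = q *: 'X_a by rewrite /t /wheel_pt updE.
have z1 y z : t z = q ^+ 2 *: t y -> ev t (q *: 'X_y - q^-1 *: 'X_z) = 0.
  move=> h; rewrite raddfB /= !evZ !evX h scalerA.
  by rewrite expr2 mulrA mulVf ?(q_neq0 qE) // mul1r subrr.
have zab : ev t (q *: 'X_a - q^-1 *: 'X_b) = 0 by apply: z1; rewrite ta.
have zbc : ev t (q *: 'X_b - q^-1 *: 'X_c) = 0.
  by apply: z1; rewrite tb tc scalerA q4.
rewrite /Psi_rainbow evZ; apply/eqP; rewrite scaler_eq0; apply/orP; right.
have main i j : (i < j)%N -> ev t ((q *: var_lo F i - q^-1 *: var_lo F j) *
     (q *: var_hi F i - q^-1 *: var_hi F j)) == 0 ->
   ev t (\prod_(i < n) \prod_(j < n | (i < j)%N)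
      ((q *: var_lo F i - q^-1 *: var_lo F j) *
       (q *: var_hi F i - q^-1 *: var_hi F j))) == 0.
  move=> ij h; rewrite rmorph_prod prodf_seq_eq0; apply/hasP; exists i.
    by rewrite mem_index_enum.
  rewrite /= rmorph_prod prodf_seq_eq0; apply/hasP; exists j.
    by rewrite mem_index_enum.
  by rewrite ij.
have [[i ai]|[i ai]] := half_index a; have [[j bj]|[j bj]] := half_index b;
  have [[k ck]|[k ck]] := half_index c; move: ab bc; rewrite ?ai ?bj ?ck /= => ab bc.
- by apply: (main i j) => //; rewrite rmorphM /var_lo -/(lo i) -/(lo j) -ai -bj /= zab mul0r.
- by apply: (main i j) => //; rewrite rmorphM /var_lo -/(lo i) -/(lo j) -ai -bj /= zab mul0r.
- by have := ltn_ord k; move: bc; clear; lia.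
- apply: (main j k); first by move: bc; clear; lia.
  by rewrite rmorphM /var_hi -/(hi j) -/(hi k) -bj -ck /= zbc mulr0.
- by have := ltn_ord j; move: ab; clear; lia.
- by have := ltn_ord j; move: ab; clear; lia.
- by have := ltn_ord k; move: bc; clear; lia.
- apply: (main j k); first by move: bc; clear; lia.
  by rewrite rmorphM /var_hi -/(hi j) -/(hi k) -bj -ck /= zbc mulr0.
Qed.

Lemma rainbow_meval v : (Psi_rainbow n q).@[v] =
  (q - q^-1) ^- (n * n.-1) * \prod_(i < n) \prod_(j < n | (i < j)%N)
   ((q * v (lo i) - q^-1 * v (lo j)) * (q * v (hi i) - q^-1 * v (hi j))).
Proof.
rewrite mevalZ rmorph_prod; congr (_ * _); apply: eq_bigr => i _.
rewrite rmorph_prod; apply: eq_bigr => j _.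
by rewrite /= mevalM !raddfB /= !mevalZ !mevalXU.
Qed.

Lemma rainbow_meval_neq0 v y z : (Psi_rainbow n q).@[v] != 0 -> (y < z)%N ->
  (z < n)%N || (n <= y)%N -> v y = q ^+ 2 -> v z = q -> False.
Proof.
rewrite rainbow_meval mulf_eq0 negb_or => /andP [_ h] yz hyz vy vz.
have z0 : q * v y - q^-1 * v z = 0.
  by rewrite vy vz -exprS (q_cube qE) mulVf ?(q_neq0 qE) ?subrr.
have main i j : (i < j)%N -> (q * v (lo i) - q^-1 * v (lo j)) *
    (q * v (hi i) - q^-1 * v (hi j)) = 0 -> False.
  move=> ij e; move/negP: h; apply; rewrite prodf_seq_eq0; apply/hasP; exists i.
    by rewrite mem_index_enum.
  rewrite /= prodf_seq_eq0; apply/hasP; exists j; first by rewrite mem_index_enum.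
  by rewrite ij e eqxx.
have [[i ei]|[i ei]] := half_index y; have [[j ej]|[j ej]] := half_index z.
- by apply: (main i j); [move: yz; rewrite ei ej | rewrite -ei -ej z0 mul0r].
- by move: hyz; rewrite ei ej /=; have := ltn_ord i; clear; lia.
- by move: yz; rewrite ei ej /=; have := ltn_ord j; clear; lia.
- by apply: (main i j); [move: yz; rewrite ei ej /= ltn_add2l | rewrite -ei -ej z0 mulr0].
Qed.

Lemma u_neq0 : q - q^-1 != 0.
Proof. by rewrite qV subr_eq0 eq_sym q2_neq_q. Qed.

Lemma pairs_norm (h : 'I_n -> 'I_n -> F) :
    (forall i j, (i < j)%N -> h i j = (q - q^-1) ^+ 2) ->
  (q - q^-1) ^- (n * n.-1) * \prod_(i < n) \prod_(j < n | (i < j)%N) h i j = 1.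
Proof.
move=> hh; have -> : \prod_(i < n) \prod_(j < n | (i < j)%N) h i j = (q - q^-1) ^+ (n * n.-1).
  rewrite -sum_pairs -prodrXr; apply: eq_bigr => i _.
  by rewrite -prodrXr; apply: eq_bigr => j /hh.
by rewrite mulVf // expf_neq0 // u_neq0.
Qed.

(** Reduces identities modulo q^3 = 1 to [ring], with c as explicit cofactor. *)
Lemma cube_eq (a b c : F) : a - b = (q ^+ 3 - 1) * c -> a = b.
Proof. by rewrite (q_cube qE) subrr mul0r => /eqP; rewrite subr_eq0 => /eqP. Qed.

Lemma rainbow_at_rainbow : (Psi_rainbow n q).@[arch_pt q (rainbow n)] = 1.
Proof.
rewrite rainbow_meval; apply: pairs_norm => i j ij.
have vlo k : arch_pt q (rainbow n) (lo k) = q ^+ 2.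
  by rewrite arch_ptE /opener ffunE /=; case: ltnP => //; have := ltn_ord k; lia.
have vhi k : arch_pt q (rainbow n) (hi k) = q.
  by rewrite arch_ptE /opener ffunE /=; case: ltnP => //; have := ltn_ord k; lia.
rewrite !vlo !vhi qV; apply: (cube_eq (c := q ^+ 2 * (1 - q) ^+ 2)); ring.
Qed.

(** A nonzero value forbids an opener before a closer within either half; as the first point opens
    and the last one closes, only ()_n is left. *)
Lemma rainbow_at p : (Psi_rainbow n q).@[arch_pt q p] = (p == rainbow n)%:R.
Proof.
have [->|ne] := eqVneq p (rainbow n); first exact: rainbow_at_rainbow.
apply/eqP; apply: contraNT ne => h; apply/eqP; apply: opener_inj => x.
have n0 : (0 < N)%N by apply: leq_ltn_trans (ltn_ord x).
pose x0 : 'I_N := Ordinal n0.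
have n1 : (N.-1 < N)%N by rewrite ltn_predL.
pose x1 : 'I_N := Ordinal n1.
have o0 : opener p x0 by rewrite -[opener p x0]negbK /opener -nc_ltNge.
have o1 : ~~ opener p x1 by rewrite /opener -leqNgt /= -ltnS prednK // ltn_ord.
have k0 := rainbow_meval_neq0 h (y := x0) (z := x).
have k1 := rainbow_meval_neq0 h (y := x) (z := x1).
rewrite !arch_ptE o0 in k0; rewrite !arch_ptE (negPf o1) /= in k1.
rewrite [RHS]/opener ffunE /=; have [xn|nx] := ltnP x n.
  have -> : (x < N - x.+1)%N by move: xn; clear; lia.
  apply/negPn/negP => ox; move: k0; rewrite (negPf ox) xn.
  have [e|x0x] := eqVneq x x0; first by move: ox; rewrite e o0.
  apply => //; move: x0x; rewrite -(inj_eq (@ord_inj _)) /=; clear; lia.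
have -> : (x < N - x.+1)%N = false by move: nx; clear; lia.
apply/negP => ox; move: k1; rewrite ox nx orbT.
have [e|x1x] := eqVneq x x1; first by move: o1; rewrite -e ox.
apply => //; have := ltn_ord x; move: x1x; rewrite -(inj_eq (@ord_inj _)) /=; clear; lia.
Qed.

Lemma rainbow_rotated_rho :
  (Psi_rainbow n q).@[arch_pt q (rho (rainbow n)) \o @ordS N] = 1.
Proof.
rewrite rainbow_meval; set v := _ \o _.
have vE x : v x = if (x == N.-1 :> nat) || (0 < x < n)%N then q ^+ 2 else q.
  rewrite /v /comp arch_ptE opener_rho_rainbow val_ordS.
  have xN := ltn_ord x; congr (if _ then _ else _).
  by case: (x.+1 =P N) => /= h; apply/idP/idP; lia.
pose A i j := q * v (lo i) - q^-1 * v (lo j).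
pose B i j := q * v (hi i) - q^-1 * v (hi j).
(* Reflecting the first half matches its exceptional factors, those through its first point, with
   those through the last point of the second half. Each product of two matched factors is then (q -
   q^-1)^2. *)
have AE : \prod_(i < n) \prod_(j < n | (i < j)%N) A i j =
          \prod_(i < n) \prod_(j < n | (i < j)%N) A (rev_ord j) (rev_ord i).
  rewrite (reindex_inj rev_ord_inj) (eq_bigr (fun i => \prod_(j < n | (j < i)%N)
      A (rev_ord i) (rev_ord j))).
    by rewrite (exchange_big_dep predT).
  move=> i _; rewrite (reindex_inj rev_ord_inj); apply: eq_bigl => j /=.
  by have := ltn_ord i; have := ltn_ord j; clear; lia.
have -> : \prod_(i < n) \prod_(j < n | (i < j)%N) (A i j * B i j) =
   \prod_(i < n) \prod_(j < n | (i < j)%N) (A (rev_ord j) (rev_ord i) * B i j).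
  under eq_bigr do rewrite big_split; rewrite big_split /= AE.
  by under [RHS]eq_bigr do rewrite big_split; rewrite big_split.
apply: pairs_norm => i j ij; rewrite /A /B !vE qV.
have -> : (lo (rev_ord i) == N.-1 :> nat) || (0 < lo (rev_ord i) < n)%N.
  by have := ltn_ord i; have := ltn_ord j; move: ij; rewrite /=; clear; lia.
have -> : (hi i == N.-1 :> nat) || (0 < hi i < n)%N = false.
  by have := ltn_ord i; have := ltn_ord j; move: ij; rewrite /=; clear; lia.
have -> : (lo (rev_ord j) == N.-1 :> nat) || (0 < lo (rev_ord j) < n)%N = (j != n.-1 :> nat).
  by have := ltn_ord i; have := ltn_ord j; move: ij; rewrite /=; clear; lia.
have -> : (hi j == N.-1 :> nat) || (0 < hi j < n)%N = (j == n.-1 :> nat).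
  by have := ltn_ord i; have := ltn_ord j; move: ij; rewrite /=; clear; lia.
case: eqP => _ /=.
  apply: (cube_eq (c := q ^+ 2 * (q - 1) * (q ^+ 2 + q - 1))); ring.
apply: (cube_eq (c := q ^+ 2 * (1 - q) ^+ 2)); ring.
Qed.

(** After the shift the halves are the labels 2, ..., n + 1 and n + 2, ..., 2n, 1. As 2n closes, a
    nonzero value makes n + 2, ..., 2n closers; one closer remains, and it has to be 2. *)
Lemma rainbow_rotated p :
  (Psi_rainbow n q).@[arch_pt q p \o @ordS N] = (p == rho (rainbow n))%:R.
Proof.
have [->|ne] := eqVneq p (rho (rainbow n)); first exact: rainbow_rotated_rho.
apply/eqP; apply: contraNT ne => h; apply/eqP; apply: opener_inj => x.
have k y z : (0 < y)%N -> (y < z)%N -> (z <= n)%N || (n < y)%N ->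
    opener p y -> ~~ opener p z -> False.
  move=> y0 yz hyz oy oz; apply: (rainbow_meval_neq0 h (y := ord_pred y) (z := ord_pred z)).
  - rewrite !val_ord_pred; move: y0 yz; clear; do 2!case: eqP; lia.
  - rewrite !val_ord_pred; move: y0 yz hyz; clear; do 2!case: eqP; lia.
  - by rewrite /comp ord_predK arch_ptE oy.
  - by rewrite /comp ord_predK arch_ptE (negPf oz).
have n0 : (0 < N)%N by apply: leq_ltn_trans (ltn_ord x).
pose x0 : 'I_N := Ordinal n0.
have n1 : (N.-1 < N)%N by rewrite ltn_predL.
pose x1 : 'I_N := Ordinal n1.
have o0 : opener p x0 by rewrite -[opener p x0]negbK /opener -nc_ltNge.
have o1 : ~~ opener p x1 by rewrite /opener -leqNgt /= -ltnS prednK // ltn_ord.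
have late y : (n < y)%N -> ~~ opener p y.
  move=> ny; apply/negP => oy; have [e|ne] := eqVneq y x1; first by move: o1; rewrite -e oy.
  apply: (k y x1); rewrite ?ny ?orbT //.
    by apply: leq_ltn_trans ny.
  by have := ltn_ord y; move: ne; rewrite -(inj_eq (@ord_inj _)) /=; clear; lia.
have cN : closers p N = n.
  have := closers_openers p (leqnn N).
  have -> : count (fun z : nat => z < N)%N (openers p) = size (openers p).
    by apply/eqP; rewrite -all_count; apply/allP => _ /mapP [y _ ->].
  by rewrite size_openers; clear; lia.
have cl m : (m <= n.-1)%N -> closers p (N - m) = (n - m)%N.
  elim: m => [|m IH] hm; first by rewrite !subn0.
  have := IH (ltnW hm).
  have lt : (N - m.+1 < N)%N by move: hm (n0); clear; lia.
  have -> : (N - m = (Ordinal lt).+1)%N by move: hm (n0) => /=; clear; lia.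
  rewrite closersS late /=; last by move: hm (n0); clear; lia.
  by move: (closers _ _) hm (n0); clear; lia.
have c1 : closers p n.+1 = 1%N.
  have := cl n.-1 (leqnn _); have -> : (N - n.-1 = n.+1)%N by move: (n0); clear; lia.
  by move=> ->; move: (n0); clear; lia.
have c01 : closers p 1 = 0%N by have := closersS p x0; rewrite o0 closers0.
have nN : (n <= N)%N by clear; lia.
have lt1 : (1 < N)%N by move: (n0); clear; lia.
pose y1 : 'I_N := Ordinal lt1.
have oy1 : ~~ opener p y1.
  apply/negP => oy1; have : closers p n.+1 = 0%N; last by rewrite c1.
  suff cm m : (m <= n)%N -> closers p m.+1 = 0%N by exact: cm.
  elim: m => [|m IH] hm; first exact: c01.
  have lt : (m.+1 < N)%N by move: hm (n0); clear; lia.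
  rewrite -[m.+1]/(nat_of_ord (Ordinal lt)) closersS /= IH //; last exact: ltnW.
  have [e|ne] := eqVneq (Ordinal lt) y1; first by rewrite e oy1.
  rewrite add0n; apply/eqP; rewrite eqb0 negbK; apply/negPn/negP => oz.
  apply: (k y1 (Ordinal lt)) => //=; last by rewrite hm.
  by move: ne; rewrite -(inj_eq (@ord_inj _)) /=; clear; lia.
have c2 : closers p 2 = 1%N by have := closersS p y1; rewrite (negPf oy1) c01.
rewrite opener_rho_rainbow.
have [e|x0x] := eqVneq x x0; first by rewrite e o0.
have [e|y1x] := eqVneq x y1; first by rewrite e (negPf oy1).
have x2 : (1 < x)%N.
  by move: x0x y1x; rewrite -!(inj_eq (@ord_inj _)) /=; clear; lia.
rewrite x2 eqn0Ngt (ltnW x2) /=; have [xn|nx] := leqP x n; last exact/negbTE/late.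
have m1 := closers_mono p (x2 : (2 <= x)%N); have m2 := closers_mono p (xn : (x.+1 <= n.+1)%N).
move: m1 m2; rewrite closersS c1 c2; case: opener => //; clear; lia.
Qed.

End RainbowPolynomial.

(** * The family Psi: duality with the points P_s, expansion, rotation *)

Section PsiTheory.

Variables (F : fieldType) (n : nat) (q : F).
Hypotheses (qE : q ^+ 2 + q + 1 = 0) (q1 : q != 1).
Local Notation N := n.*2.
Variable Psi : NC n -> {mpoly F[N]}.
Hypothesis hPsi : is_Psi q Psi.
Implicit Types (f g : {mpoly F[N]}) (i x : 'I_N) (p s t : NC n).

Lemma weight_ind (P : NC n -> Prop) :
  (forall p, (forall s, closers_le s p -> s != p -> P s) -> P p) -> forall p, P p.
Proof.
move=> h p; have [m] := ubnP (weight p); elim: m p => // m IH p hp.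
by apply: h => s sp ne; apply: IH; apply: leq_trans (weight_lt sp ne) _; rewrite -ltnS.
Qed.

Lemma valley_neq p i : (i.+1 < N)%N -> ~~ opener p i -> e i p != p.
Proof.
move=> i1 oi; apply: contraNneq oi => h; have [ei _ _] := e_val i p.
by rewrite -h /opener ei ordS_small.
Qed.

Lemma e_idem i p : e i (e i p) = e i p.
Proof. by apply: e_connected; have [] := e_val i p. Qed.

Lemma Psi_valley (p : NC n) i : add_box i.+1 (e i p) p ->
  Psi p = Dop q i (Psi (e i p)) -
    \sum_(t | [&& e i t == e i p, t != e i p & t != p]) Psi t.
Proof.
case: hPsi => _ h /h ->; congr (_ - _); apply: eq_bigl => t.
by rewrite !inE negb_or andbC andbA.
Qed.

(** At P_s the recursion reads [e_i s = e_i p] - [s = e_i p] minus the indicator of the other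
    preimages, which leaves [s = p]. By [preimage_le] the subtracted Psi_t are covered by
    induction. *)
Lemma Psi_spec p : inW q (Psi p) /\
  forall s, (Psi p).@[arch_pt q s] = (s == p)%:R.
Proof.
elim/weight_ind: p => p IH.
have [->|pR] := eqVneq p (rainbow n).
  case: hPsi => -> _; split; [exact: inW_rainbow | exact: rainbow_at].
have [i [i1 oi oj hb _]] := last_box pR; rewrite (Psi_valley hb).
have le_e := e_valley_le i1 oi oj; have ne := valley_neq i1 oi.
have [We he] := IH _ le_e ne.
have IHt t : [&& e i t == e i p, t != e i p & t != p] ->
    inW q (Psi t) /\ forall s, (Psi t).@[arch_pt q s] = (s == t)%:R.
  by case/and3P => /eqP et _ tp; apply: IH tp; apply: (preimage_le i1 oi oj) et.
split.
  rewrite -scaleN1r addrC; apply: inW_linear; last exact: inW_Dop.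
  by apply: inW_sum => t /IHt [].
move=> s; have -> : Dop q i (Psi (e i p)) = Eop q i (Psi (e i p)) - Psi (e i p).
  by rewrite /Eop addrC addKr.
rewrite mevalB mevalB (Eop_arch_pt qE q1 s i1 We) !he.
rewrite [X in _ - X](_ : _ = \sum_(t | [&& e i t == e i p, t != e i p & t != p]) (s == t)%:R);
  last first.
  by rewrite raddf_sum; apply: eq_bigr => t /IHt [_ h]; exact: h.
have -> : \sum_(t | [&& e i t == e i p, t != e i p & t != p]) (s == t)%:R =
    [&& e i s == e i p, s != e i p & s != p]%:R :> F.
  rewrite big_mkcond (bigD1 s) //= eqxx big1 ?addr0 => [|t ts].
    by case: ifP.
  by rewrite [s == t]eq_sym (negPf ts); case: ifP.
have [->|sp] := eqVneq s p; first by rewrite eqxx eq_sym (negPf ne) /= !subr0.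
have [->|se] := eqVneq s (e i p); first by rewrite e_idem eqxx /= subrr subr0.
by rewrite /= andbT subr0; case: eqP; rewrite subrr.
Qed.

Lemma Psi_inW p : inW q (Psi p).
Proof. by case: (Psi_spec p). Qed.

Lemma Psi_arch_pt p s : (Psi p).@[arch_pt q s] = (s == p)%:R.
Proof. by case: (Psi_spec p). Qed.

Lemma nc_of_nc_on (p : 'I_N -> 'I_N) : nc_on [set: 'I_N] p -> exists s : NC n, s =1 p.
Proof.
move=> [h1 h2]; have nc : noncrossing [ffun x => p x].
  apply/noncrossingP; split=> [x|x|x y]; rewrite !ffunE.
  - by apply/eqP; have [] := h1 x (in_setT _).
  - by have [] := h1 x (in_setT _).
  - by case=> a b c; have := h2 x y (in_setT _) (in_setT _); rewrite a b c.
by exists (MkNC nc) => x; rewrite ffunE.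
Qed.

(** By duality both sides agree at every P_s, so [wheel_meval_eq0] applies to the difference. *)
Lemma inW_expand f : inW q f -> f = \sum_(s : NC n) f.@[arch_pt q s] *: Psi s.
Proof.
move=> hf; apply/eqP; rewrite -subr_eq0; apply/eqP.
have hW : inW q (f - \sum_(s : NC n) f.@[arch_pt q s] *: Psi s).
  rewrite -scaleN1r addrC; apply: inW_linear => //.
  apply: inW_sum => s _; rewrite -[_ *: _]addr0; apply: inW_linear (Psi_inW s) (inW0 n q).
have cT : #|[set: 'I_N]| = N by rewrite cardsT card_ord.
apply: (wheel_meval_eq0 qE q1 cT hW.2 (inW_msize hW)) => p' /nc_of_nc_on [p hp].
have -> : forall g : {mpoly F[N]}, g.@[arch_pt q p'] = g.@[arch_pt q p].
  by move=> g; apply: meval_eq => x; rewrite /arch_pt hp.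
rewrite mevalB (raddf_sum (meval (arch_pt q p))) (bigD1 p) //= mevalZ Psi_arch_pt eqxx mulr1.
rewrite big1 ?addr0 ?subrr // => s sp.
by rewrite mevalZ Psi_arch_pt eq_sym (negPf sp) mulr0.
Qed.

Lemma Eop_Psi_small i s : (i.+1 < N)%N -> Eop q i (Psi s) = \sum_(t | e i t == s) Psi t.
Proof.
move=> i1; have hs := Psi_inW s.
have hE : inW q (Eop q i (Psi s)).
  by rewrite /Eop -[X in inW q (X + _)]scale1r; apply: inW_linear => //; apply: inW_Dop.
rewrite (inW_expand hE) [RHS]big_mkcond; apply: eq_bigr => t _.
by rewrite (Eop_arch_pt qE q1 t i1 hs) Psi_arch_pt; case: eqP; rewrite ?scale1r ?scale0r.
Qed.

Lemma rotate_varsE k f : rotate_vars k f = ev (fun x => 'X_(iter k (@ordS N) x)) f.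
Proof. by rewrite /rotate_vars comp_mpoly_ev; apply: eq_ev => x; rewrite tnth_mktuple. Qed.

Lemma rotate_varsD k m f : rotate_vars (k + m) f = rotate_vars k (rotate_vars m f).
Proof.
by rewrite !rotate_varsE evE; apply: eq_ev => x; rewrite evX iterD.
Qed.

Local Notation rot := (@rotate_vars F n 1).

Lemma rotate1E f : rot f = msym (perm (@ordS_inj n)) f.
Proof. by rewrite rotate_varsE; apply: eq_ev => x /=; rewrite permE. Qed.

Lemma inW_rot f : inW q f -> inW q (rot f).
Proof.
move=> [hf wf]; split; first by rewrite rotate1E; apply: dhomog_msym.
move=> t a b c _ _ _ ab bc tb tc; rewrite rotate1E ev_msym.
have tE x : (t \o perm (@ordS_inj n)) (ord_pred x) = t x.
  by rewrite /= permE ord_predK.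
(* A wheel through the first variable is permuted cyclically: (b, c, a) again has ratios q^2 and q
   to its first entry. *)
have [a0|a0] := posnP a.
  apply: (wf _ (ord_pred b) (ord_pred c) (ord_pred a)); rewrite ?inE // ?tE.
  - rewrite !val_ord_pred; move: ab bc; clear; do 2!case: eqP; lia.
  - rewrite !val_ord_pred a0; have := ltn_ord c; move: ab bc; clear; do 2!case: eqP; lia.
  - by rewrite tc tb scalerA q4.
  - by rewrite tb scalerA -exprS q_cube // scale1r.
apply: (wf _ (ord_pred a) (ord_pred b) (ord_pred c)); rewrite ?inE // ?tE //.
- rewrite !val_ord_pred; move: a0 ab bc; clear; do 2!case: eqP; lia.
- rewrite !val_ord_pred; move: a0 ab bc; clear; do 2!case: eqP; lia.
Qed.

Lemma rot_X x : rot 'X_x = 'X_(ordS x).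
Proof. by rewrite rotate_varsE evX. Qed.

Lemma rotB f g : rot (f - g) = rot f - rot g.
Proof. by rewrite !rotate_varsE raddfB. Qed.

Lemma rotD f g : rot (f + g) = rot f + rot g.
Proof. by rewrite !rotate_varsE raddfD. Qed.

Lemma rot_sum (I : finType) (P : pred I) (h : I -> {mpoly F[N]}) :
  rot (\sum_(k | P k) h k) = \sum_(k | P k) rot (h k).
Proof. by rewrite rotate_varsE raddf_sum; apply: eq_bigr => k _; rewrite rotate_varsE. Qed.

Lemma rot_mulB f g h : rot ((f - g) * h) = (rot f - rot g) * rot h.
Proof. by rewrite !rotate_varsE rmorphM raddfB. Qed.

Lemma rot_Dop i f : rot (Dop q i f) = Dop q (ordS i) (rot f).
Proof.
apply: (mulfI (ordS_X_neq0 F (ordS i))); rewrite Dop_eq.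
move: (Dop q i f) (Dop_eq q i f) => D hD.
transitivity (rot (('X_(ordS i) - 'X_i) * D)); first by rewrite rot_mulB !rot_X.
have rZ c x : rot (c *: 'X_x) = c *: 'X_(ordS x) by rewrite rotate_varsE evZ evX.
rewrite hD rot_mulB (rZ q i) (rZ q^-1 (ordS i)).
rewrite (rotB (swap i f) f); suff -> : rot (swap i f) = swap (ordS i) (rot f) by [].
rewrite /swap !rotate1E -!msymMm.
suff -> : (tperm i (ordS i) * perm (@ordS_inj n) =
           perm (@ordS_inj n) * tperm (ordS i) (ordS (ordS i)))%g by [].
by apply/permP => x; rewrite !permM !(permE (@ordS_inj n)) (inj_tperm _ _ _ (@ordS_inj n)).
Qed.

(** The recursion is rotated, its smaller terms are replaced by induction, and [Eop_Psi_small] at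
    the shifted index identifies what remains. *)
Lemma Psi_rho p : Psi (rho p) = rot (Psi p).
Proof.
elim/weight_ind: p => p IH.
have [->|pR] := eqVneq p (rainbow n).
  have [h0 _] := hPsi; rewrite (inW_expand (inW_rot (Psi_inW (rainbow n)))).
  rewrite (bigD1 (rho (rainbow n))) //= h0 big1 ?addr0 => [|s sp].
    rewrite rotate_varsE meval_ev (meval_eq (v2 := arch_pt q (rho (rainbow n)) \o @ordS N)).
      by rewrite rainbow_rotated // eqxx scale1r.
    by move=> x; rewrite mevalXU.
  rewrite rotate_varsE meval_ev (meval_eq (v2 := arch_pt q s \o @ordS N)).
    by rewrite rainbow_rotated // (negPf sp) scale0r.
  by move=> x; rewrite mevalXU.
have [i [i1 oi oj hb _]] := last_box pR.
have le_e := e_valley_le i1 oi oj; have ne := valley_neq i1 oi.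
(* The opener [ordS i] has its partner further right, so it is not the last point. *)
have i2 : ((ordS i).+1 < N)%N by have := ltn_ord (p (ordS i)); move: oj; rewrite /opener; lia.
rewrite [in RHS](Psi_valley hb) rotB rot_sum rot_Dop.
rewrite -(IH _ le_e ne).
have -> : Dop q (ordS i) (Psi (rho (e i p))) =
    Eop q (ordS i) (Psi (rho (e i p))) - Psi (rho (e i p)) by rewrite /Eop addrC addKr.
rewrite (Eop_Psi_small _ i2) (reindex (@rho n)) /=; last exact: onW_bij (rho_bij n).
rewrite (eq_bigl (fun t => e i t == e i p)); last first.
  by move=> t; rewrite e_rho (inj_eq (@rho_inj n)).
rewrite (bigD1 (e i p)) ?e_idem //= [_ - Psi (rho (e i p))]addrC addKr (bigD1 p) /=;
  last by rewrite eqxx eq_sym.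
rewrite -addrA -[LHS]addr0; congr (_ + _); apply/esym/eqP; rewrite subr_eq0; apply/eqP.
apply: eq_big => t; first by rewrite andbA.
case/andP => /andP [/eqP et tne] tp; rewrite IH //.
exact: (preimage_le i1 oi oj) et.
Qed.

Lemma Psi_rho_iter k p : Psi (iter k (@rho n) p) = rotate_vars k (Psi p).
Proof.
elim: k => [|k IH] /=; last by rewrite Psi_rho IH -rotate_varsD.
by rewrite rotate_varsE ev_id.
Qed.

(** The last index is the rotation of an earlier one, and rotation intertwines the e's and the
    D's. *)
Lemma Eop_Psi i s : Eop q i (Psi s) = \sum_(t | e i t == s) Psi t.
Proof.
have [i1|i1] := ltnP i.+1 N; first exact: Eop_Psi_small.
have iN := ltn_ord i; pose j := ord_pred i.
have jE : j = i.-1 :> nat by rewrite val_ord_pred; case: eqP => //; lia.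
have j1 : (j.+1 < N)%N by rewrite jE; lia.
have [r rK Kr] := rho_bij n.
rewrite -[i]ord_predK -/j -[s]Kr Psi_rho.
have -> : Eop q (ordS j) (rot (Psi (r s))) = rot (Eop q j (Psi (r s))).
  by rewrite /Eop rotD rot_Dop.
rewrite Eop_Psi_small // rot_sum [RHS](reindex (@rho n)) /=; last first.
  exact: onW_bij (rho_bij n).
apply: eq_big => t; first by rewrite e_rho (inj_eq (@rho_inj n)).
by rewrite Psi_rho.
Qed.

End PsiTheory.

(** * Concatenations and the expansion *)

Section Blocks.

Variables (n m : nat) (phi : 'I_m.*2 -> 'I_n.*2).
Hypothesis phi_lt : forall x y, (phi x < phi y)%N = (x < y)%N.
Hypothesis phi_out : forall z, [\/ exists x, z = phi x,
  forall x, (z < phi x)%N | forall x, (phi x < z)%N].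

Lemma block_inj : injective phi.
Proof.
move=> x y h; apply: ord_inj; have := phi_lt x y; have := phi_lt y x.
by rewrite h ltnn; case: ltngtP.
Qed.

Lemma restrict_block (tau : NC n) : (forall x, exists y, tau (phi x) = phi y) ->
  exists t : NC m, forall x, tau (phi x) = phi (t x).
Proof.
move=> /fin_all_exists [f hf]; pose t : {ffun 'I_m.*2 -> 'I_m.*2} := finfun f.
have tE x : tau (phi x) = phi (t x) by rewrite ffunE hf.
have nct : noncrossing t.
  apply/noncrossingP; split=> [x e|x|x y].
  - by move: (nc_neq tau (phi x)); rewrite tE e eqxx.
  - by apply: block_inj; rewrite -!tE nc_inv.
  - by rewrite -(phi_lt x) -(phi_lt y) -(phi_lt (t x)) -!tE; exact: nc_cross.
by exists (MkNC nct).
Qed.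

(** phi embeds the block as an interval. Only i, i + 1 and their partners in tau are reconnected. A
    partner of i outside the interval would cross the arch from x0, unless e reconnected that arch,
    and then the partner lies in the block. *)
Lemma block_preimage (s : NC m) (c tau : NC n) (i x0 : 'I_m.*2) :
    (forall x, c (phi x) = phi (s x)) -> ordS (phi i) = phi (ordS i) ->
    (i.+1 < m.*2)%N -> (x0 < i)%N -> (i.+1 < s x0)%N -> e (phi i) tau = c ->
  exists t : NC m, [/\ forall x, tau (phi x) = phi (t x) &
    forall z, (forall x, z <> phi x) -> tau z = c z].
Proof.
move=> cE Si i1 x0i isx et; pose J := phi i; pose K := phi (ordS i).
have iE := ordS_small i1.
have [eJ eK] : c J = K /\ c K = J.
  by have [h1 h2 _] := e_val (phi i) tau; rewrite -et -/J /K -Si.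
have [tJ|tJ] := eqVneq (tau J) K.
  have tc : tau = c by rewrite -et e_connected // Si.
  by exists s; split=> [x|z _]; rewrite tc.
have [_ _] := e_val (phi i) tau; rewrite -/J Si -/K et => /(_ tJ) [e1 e2 e3].
have X0 : tau (phi x0) = phi (s x0) \/ exists y, tau J = phi y.
  have xJ : phi x0 != J by rewrite (inj_eq block_inj) -(inj_eq (@ord_inj _)) neq_ltn x0i.
  have xK : phi x0 != K.
    by rewrite (inj_eq block_inj) -(inj_eq (@ord_inj _)) neq_ltn iE ltnS ltnW.
  have [xu|xu] := eqVneq (phi x0) (tau J); first by right; exists x0.
  have [xw|xw] := eqVneq (phi x0) (tau K); last by left; rewrite -cE e3.
  by right; exists (s x0); rewrite -cE xw e2.
have [y uy] : exists y, tau J = phi y.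
  case: X0 => // X0; case: (phi_out (tau J)) => // h; exfalso.
    apply: (@nc_cross _ tau (tau J) (phi x0)); rewrite nc_inv X0 h !phi_lt; split=> //.
    exact: ltn_trans isx.
  apply: (@nc_cross _ tau (phi x0) J); rewrite X0 h !phi_lt; split=> //.
  exact: ltn_trans isx.
have wy : tau K = phi (s y) by rewrite -cE -uy e1.
have [x|t ht] := @restrict_block tau.
  have [->|xJ] := eqVneq (phi x) J; first by exists y.
  have [->|xK] := eqVneq (phi x) K; first by exists (s y).
  have [->|xu] := eqVneq (phi x) (tau J); first by exists i; rewrite nc_inv.
  have [->|xw] := eqVneq (phi x) (tau K); first by exists (ordS i); rewrite nc_inv.
  by exists (s x); rewrite -cE e3.
exists t; split=> // z hz; rewrite e3 //; apply/eqP => h.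
- exact: (hz i).
- exact: (hz (ordS i)).
- by apply: (hz y); rewrite h.
- by apply: (hz (s y)); rewrite h.
Qed.

End Blocks.

(** * Ballot condition and enclosing arches *)

Section Ballot.

Variable n : nat.
Implicit Types (p s : NC n) (i x : 'I_n.*2).

Lemma opener_sum p k : (k <= n.*2)%N ->
  (closers p k + \sum_(x | opener p x) (x < k) = k)%N.
Proof.
move=> kn; rewrite -[RHS](closers_openers p kn); congr (_ + _)%N.
rewrite /openers count_map count_filter -sum1_count big_mkcond [RHS]big_mkcond big_enum.
by apply: eq_bigr => x _ /=; rewrite andbC; case: opener => //=; case: (x < k)%N.
Qed.

Lemma closers_reindex p k : closers p k = (\sum_(x | opener p x) (p x < k))%N.
Proof.
rewrite closersE (reindex_inj (@nc_inj _ p)) /=; apply: eq_bigl => x.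
by rewrite opener_partner negbK.
Qed.

Lemma ballot p k : (k <= n.*2)%N -> ((closers p k).*2 <= k)%N.
Proof.
move=> kn; rewrite -[leqRHS](opener_sum p kn) -addnn leq_add2l closers_reindex.
apply: leq_sum => x ox; case: (ltnP (p x) k) => // h.
by rewrite (ltn_trans ox h).
Qed.

(** As p closes at i, the ballot condition makes closers of p, hence of s, fewer than half of the
    points before i; so some opener of s before i is matched beyond i + 1. *)
Lemma enclosing_arch p s i : (i.+1 < n.*2)%N -> ~~ opener p i -> opener p (ordS i) ->
    closers_le s (e i p) -> s i = ordS i ->
  exists x, (x < i)%N /\ (i.+1 < s x)%N.
Proof.
move=> i1 oi oj sp si; have iE := ordS_small i1.
have hi : (i <= n.*2)%N by exact/ltnW/ltn_ord.
have h1 : ((closers s i).*2 < i)%N.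
  have := ballot p (ltnW i1); rewrite closersS oi addn1 doubleS.
  have := leq_trans (sp i) (e_valley_le i1 oi oj i).
  by move: (closers s i) (closers p i); clear; lia.
have [/existsP [x /and3P [ox xi ix]]|no] :=
    boolP [exists x, [&& opener s x, (x < i)%N & (i <= s x)%N]].
  exists x; split=> //; rewrite ltn_neqAle eq_sym; apply/andP; split.
    rewrite -iE (inj_eq (@ord_inj _)) -si (inj_eq (@nc_inj _ s)).
    by rewrite -(inj_eq (@ord_inj _)) neq_ltn xi.
  rewrite ltn_neqAle ix andbT eq_sym; apply: contraTneq xi => /ord_inj h.
  by rewrite -[x](nc_inv s) h si iE ltnNge leqW.
have le : (\sum_(x | opener s x) (x < i) <= closers s i)%N.
  rewrite closers_reindex; apply: leq_sum => x ox.
  case: (ltnP x i) => // xi; case: (ltnP (s x) i) => // h.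
  by case/negP: no; apply/existsP; exists x; rewrite ox xi.
by have := leq_add (leqnn (closers s i)) le; rewrite opener_sum // addnn leqNgt h1.
Qed.

End Ballot.

(** * Preimages of concatenations under e *)

Section Concat.

Variables n1 n2 : nat.
Local Notation n := (n1 + n2)%N.
Implicit Types (tau : NC n).

Definition lblock (x : 'I_n1.*2) : 'I_n.*2 :=
  cast_ord (esym (doubleD n1 n2)) (lshift n2.*2 x).
Definition rblock (x : 'I_n2.*2) : 'I_n.*2 :=
  cast_ord (esym (doubleD n1 n2)) (rshift n1.*2 x).

Lemma block_cases z : (exists x, z = lblock x) \/ (exists x, z = rblock x).
Proof.
rewrite -[z](cast_ordK (doubleD n1 n2)); move: (cast_ord _ z) => y.
by rewrite -(splitK y); case: (split y) => x; [left | right]; exists x.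
Qed.

Lemma concat_l t1 t2 x : concat t1 t2 (lblock x) = lblock (t1 x).
Proof. by rewrite ffunE /lblock cast_ordKV (unsplitK (inl x)). Qed.

Lemma concat_r t1 t2 x : concat t1 t2 (rblock x) = rblock (t2 x).
Proof. by rewrite ffunE /rblock cast_ordKV (unsplitK (inr x)). Qed.

Lemma lblock_lt x y : (lblock x < lblock y)%N = (x < y)%N.
Proof. by []. Qed.

Lemma rblock_lt x y : (rblock x < rblock y)%N = (x < y)%N.
Proof. by rewrite /= ltn_add2l. Qed.

Lemma lr_lt x y : (lblock x < rblock y)%N.
Proof. exact: leq_trans (ltn_ord x) (leq_addr _ _). Qed.

Lemma lblock_inj : injective lblock.
Proof. exact: block_inj lblock_lt. Qed.

Lemma rblock_inj : injective rblock.
Proof. exact: block_inj rblock_lt. Qed.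

Lemma lr_neq x y : lblock x != rblock y.
Proof. by rewrite -(inj_eq (@ord_inj _)) neq_ltn lr_lt. Qed.

Lemma lblock_out z : [\/ exists x, z = lblock x,
  forall x, (z < lblock x)%N | forall x, (lblock x < z)%N].
Proof.
case: (block_cases z) => [|[y ->]]; first by constructor 1.
by constructor 3 => x; exact: lr_lt.
Qed.

Lemma rblock_out z : [\/ exists x, z = rblock x,
  forall x, (z < rblock x)%N | forall x, (rblock x < z)%N].
Proof.
case: (block_cases z) => [[y ->]|]; last by constructor 1.
by constructor 2 => x; exact: lr_lt.
Qed.

Lemma concat_eqP tau (t1 : NC n1) (t2 : NC n2) : (forall x, tau (lblock x) = lblock (t1 x)) ->
  (forall x, tau (rblock x) = rblock (t2 x)) -> tau = concat t1 t2.
Proof.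
move=> h1 h2; apply: nc_eqP => z.
by case: (block_cases z) => [[x ->]|[x ->]]; rewrite ?h1 ?h2 ?concat_l ?concat_r.
Qed.

Lemma concat_inj_l (t2 : NC n2) : injective (fun t1 : NC n1 => concat t1 t2).
Proof.
move=> s1 t1 /= h; apply: nc_eqP => x; apply: lblock_inj.
by rewrite -(concat_l s1 t2) h concat_l.
Qed.

Lemma concat_inj_r (t1 : NC n1) : injective (fun t2 : NC n2 => concat t1 t2).
Proof.
move=> s2 t2 /= h; apply: nc_eqP => x; apply: rblock_inj.
by rewrite -(concat_r t1 s2) h concat_r.
Qed.

Lemma ordS_lblock (i : 'I_n1.*2) : (i.+1 < n1.*2)%N -> ordS (lblock i) = lblock (ordS i).
Proof.
move=> i1; apply: ord_inj; rewrite ordS_small.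
  by rewrite [RHS](ordS_small i1).
by rewrite /= doubleD; apply: leq_trans i1 (leq_addr _ _).
Qed.

Lemma ordS_rblock (i : 'I_n2.*2) : (i.+1 < n2.*2)%N -> ordS (rblock i) = rblock (ordS i).
Proof.
move=> i1; have iE := ordS_small i1; apply: ord_inj; rewrite ordS_small.
  by rewrite -[RHS]/(n1.*2 + ordS i)%N iE addnS.
by rewrite -[nat_of_ord _]/(n1.*2 + i)%N doubleD -addnS ltn_add2l.
Qed.

Lemma e_lblock (i : 'I_n1.*2) (t1 : NC n1) (t2 : NC n2) : (i.+1 < n1.*2)%N ->
  e (lblock i) (concat t1 t2) = concat (e i t1) t2.
Proof.
move=> i1; apply: concat_eqP => x; rewrite e_at ordS_lblock //.
  by rewrite !concat_l e_at !(inj_eq lblock_inj) !(fun_if lblock).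
by rewrite !concat_l !concat_r ![rblock _ == _]eq_sym !(negPf (lr_neq _ _)).
Qed.

Lemma e_rblock (i : 'I_n2.*2) (t1 : NC n1) (t2 : NC n2) : (i.+1 < n2.*2)%N ->
  e (rblock i) (concat t1 t2) = concat t1 (e i t2).
Proof.
move=> i1; apply: concat_eqP => x; rewrite e_at ordS_rblock //.
  by rewrite !concat_l !concat_r !(negPf (lr_neq _ _)).
by rewrite !concat_r e_at !(inj_eq rblock_inj) !(fun_if rblock).
Qed.

(** By [enclosing_arch], an arch of s1 covers i, i + 1, so [block_preimage] keeps the reconnection
    inside the left block. *)
Lemma preimage_concat_l (p s1 : NC n1) (i : 'I_n1.*2) (s2 : NC n2) tau :
    (i.+1 < n1.*2)%N -> ~~ opener p i -> opener p (ordS i) -> closers_le s1 (e i p) ->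
  (e (lblock i) tau == concat s1 s2) =
  (tau \in (fun t1 : NC n1 => concat t1 s2) @: [set t1 | e i t1 == s1]).
Proof.
move=> i1 oi oj sp; apply/eqP/imsetP => [h|[t1 + ->]]; last first.
  by rewrite inE => /eqP <-; exact: e_lblock.
have si : s1 i = ordS i.
  apply: lblock_inj; rewrite -(concat_l s1 s2) -h -ordS_lblock //.
  by have [] := e_val (lblock i) tau.
have [x [xi ix]] := enclosing_arch i1 oi oj sp si.
have [t1 [ht ho]] := block_preimage lblock_lt lblock_out (concat_l s1 s2) (ordS_lblock i1)
  i1 xi ix h.
have tE : tau = concat t1 s2.
  apply: concat_eqP => // y; rewrite ho ?concat_r // => z /eqP.
  by rewrite eq_sym (negPf (lr_neq _ _)).
exists t1 => //; rewrite inE; apply/eqP; apply: (@concat_inj_l s2).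
by rewrite -h tE e_lblock.
Qed.

Lemma preimage_concat_r (p s2 : NC n2) (i : 'I_n2.*2) (s1 : NC n1) tau :
    (i.+1 < n2.*2)%N -> ~~ opener p i -> opener p (ordS i) -> closers_le s2 (e i p) ->
  (e (rblock i) tau == concat s1 s2) =
  (tau \in (fun t2 : NC n2 => concat s1 t2) @: [set t2 | e i t2 == s2]).
Proof.
move=> i1 oi oj sp; apply/eqP/imsetP => [h|[t2 + ->]]; last first.
  by rewrite inE => /eqP <-; exact: e_rblock.
have si : s2 i = ordS i.
  apply: rblock_inj; rewrite -(concat_r s1 s2) -h -ordS_rblock //.
  by have [] := e_val (rblock i) tau.
have [x [xi ix]] := enclosing_arch i1 oi oj sp si.
have [t2 [ht ho]] := block_preimage rblock_lt rblock_out (concat_r s1 s2) (ordS_rblock i1)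
  i1 xi ix h.
have tE : tau = concat s1 t2.
  apply: concat_eqP => // y; rewrite ho ?concat_l // => z /eqP.
  by rewrite (negPf (lr_neq _ _)).
exists t2 => //; rewrite inE; apply/eqP; apply: (@concat_inj_r s1).
by rewrite -h tE e_rblock.
Qed.

End Concat.

Section IterRho.

Variable n : nat.
Implicit Types (p : NC n) (i x : 'I_n.*2).

Lemma iter_ordS k x : nat_of_ord (iter k (@ordS n.*2) x) = ((x + k) %% n.*2)%N.
Proof.
elim: k => [|k IH]; first by rewrite addn0 modn_small.
rewrite iterS -[LHS]/((iter k (@ordS n.*2) x).+1 %% n.*2)%N IH.
by rewrite -[in LHS]addn1 modnDml addn1 addnS.
Qed.

Lemma rho_iter k p x :
  iter k (@rho n) p (iter k (@ordS n.*2) x) = iter k (@ordS n.*2) (p x).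
Proof. by elim: k => // k IH; rewrite !iterS rho_ordS IH. Qed.

Lemma e_rho_iter k i p :
  e (iter k (@ordS n.*2) i) (iter k (@rho n) p) = iter k (@rho n) (e i p).
Proof. by elim: k => // k IH; rewrite !iterS e_rho IH. Qed.

Lemma rho_iter_bij k : bijective (iter k (@rho n)).
Proof. by elim: k => [|k IH]; [exists id | exact: bij_comp (rho_bij n) IH]. Qed.

End IterRho.

Lemma iter_ordS_surj n k (x : 'I_n.*2) : exists y, x = iter k (@ordS n.*2) y.
Proof.
elim: k x => [|k IH] x; first by exists x.
by have [y e] := IH (ord_pred x); exists y; rewrite iterS -e ord_predK.
Qed.

Lemma rainbowE n (x : 'I_n.*2) : nat_of_ord (rainbow n x) = (n.*2 - x.+1)%N.
Proof. by rewrite ffunE. Qed.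

(** Base of the expansion: for nested blocks, Phi is Psi_(()_n). *)
Lemma rho_concat_rainbow n1 n2 :
  iter n2 (@rho (n1 + n2)) (concat (rainbow n1) (rainbow n2)) = rainbow (n1 + n2).
Proof.
apply: nc_eqP => x; have [y ->] := iter_ordS_surj n2 x; rewrite rho_iter.
apply: ord_inj; rewrite rainbowE !iter_ordS.
have nE : ((n1 + n2).*2 = n1.*2 + n2.*2)%N by rewrite doubleD.
case: (block_cases y) => -[a ->]; rewrite ?concat_l ?concat_r /= rainbowE.
  have aN := ltn_ord a; rewrite !modn_small; move: aN nE; clear; lia.
have aN := ltn_ord a; have [h|h] := ltnP a n2.
  have -> : (n1.*2 + (n2.*2 - a.+1) + n2 = (n1 + n2).*2 + (n2 - a.+1))%N.
    by move: h; clear; lia.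
  by rewrite modnDl !modn_small; move: h aN nE; clear; lia.
have -> : (n1.*2 + a + n2 = (n1 + n2).*2 + (a - n2))%N by move: h; clear; lia.
by rewrite modnDl !modn_small; move: h aN nE; clear; lia.
Qed.

Lemma Dint_ord (F : fieldType) (n : nat) (q : F) (k : int) (i : 'I_n.*2)
    (f : {mpoly F[n.*2]}) :
  ((k - 1) %% n.*2%:Z)%Z = i%:Z -> Dint q k f = Dop q i f.
Proof. by move=> h; rewrite /Dint h absz_nat valK. Qed.

(** k stands for the other block, which is left alone while boxes are added to the block of p. *)
Definition expands (F : fieldType) (N m : nat) (I : finType) (S : I -> Prop)
    (Phi : NC m -> I -> {mpoly F[N]}) (p : NC m) (k0 : I) (f : {mpoly F[N]}) : Prop :=
  exists c : NC m -> I -> int,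
    [/\ forall t k, c t k != 0 -> closers_le t p /\ S k, c p k0 = 1
      & f = \sum_t \sum_k (c t k)%:~R *: Phi t k].

(** * Triangular effect of adding one box *)

Section AddBox.

Variables (F : fieldType) (q : F) (n m : nat) (I : finType) (S : I -> Prop).
Variables (Phi : NC m -> I -> {mpoly F[n.*2]}) (i : 'I_m.*2) (j : 'I_n.*2) (p : NC m).
Hypotheses (i1 : (i.+1 < m.*2)%N) (oi : ~~ opener p i) (oj : opener p (ordS i)).
Hypothesis hPhi : forall s k, closers_le s (e i p) ->
  Eop q j (Phi s k) = \sum_(t | e i t == s) Phi t k.

(** As D = (1 + D) - 1, the coefficient at t becomes c(e_i t) - c(t); at p this is 1 - 0, since p is
    not below e_i p. *)
Lemma expands_Dop k0 f : expands S Phi (e i p) k0 f -> expands S Phi p k0 (Dop q j f).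
Proof.
move=> [c [hc c1 ->]]; exists (fun t k => c (e i t) k - c t k).
have ep := e_valley_le i1 oi oj.
have cp : c p k0 = 0.
  apply/eqP; apply: contraT => /hc [h _].
  by have := valley_neq i1 oi; rewrite (closers_le_anti ep h) eqxx.
split=> [t k|| ].
- have [e0|/hc [h Sk] _] := eqVneq (c (e i t) k) 0; last first.
    by split=> //; apply: (preimage_le i1 oi oj h).
  rewrite e0 sub0r oppr_eq0 => /hc [h Sk]; split=> // x.
  exact: leq_trans (h x) (ep x).
- by rewrite c1 cp subr0.
have DE (g : {mpoly F[n.*2]}) : Dop q j g = Eop q j g - g by rewrite /Eop addrC addKr.
rewrite (raddf_sum (Dop q j)).
under eq_bigr => s _ do rewrite (raddf_sum (Dop q j)).
rewrite exchange_big [RHS]exchange_big; apply: eq_bigr => k _ /=.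
transitivity (\sum_s ((c s k)%:~R *: (\sum_(t | e i t == s) Phi t k) -
                (c s k)%:~R *: Phi s k)).
  apply: eq_bigr => s _; rewrite linearZ /= -scalerBr.
  have [->|/hc [h _]] := eqVneq (c s k) 0; first by rewrite !scale0r.
  by rewrite DE hPhi.
rewrite sumrB; under [RHS]eq_bigr => t _ do rewrite rmorphB scalerBl.
rewrite sumrB; congr (_ - _).
under eq_bigr => s _ do rewrite scaler_sumr.
rewrite (exchange_big_dep predT) //=; apply: eq_bigr => t _.
by rewrite (big_pred1 (e i t)) // => s; rewrite /= eq_sym.
Qed.

End AddBox.

(** * Expansion of the D in the Phi, and its inverse *)

Section TwoBlocks.

Variables (F : fieldType) (q : F) (n1 n2 : nat).
Hypotheses (qE : q ^+ 2 + q + 1 = 0) (q1 : q != 1).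
Local Notation n := (n1 + n2)%N.
Variable Psi : NC n -> {mpoly F[n.*2]}.
Hypothesis hPsi : is_Psi q Psi.

Definition Phi (t1 : NC n1) (t2 : NC n2) : {mpoly F[n.*2]} :=
  Psi (iter n2 (@rho n) (concat t1 t2)).

Lemma Eop_Phi (t1 : NC n1) (t2 : NC n2) (i : 'I_n.*2) :
  Eop q (iter n2 (@ordS n.*2) i) (Phi t1 t2) =
  \sum_(tau | e i tau == concat t1 t2) Psi (iter n2 (@rho n) tau).
Proof.
rewrite /Phi (Eop_Psi qE q1 hPsi) (reindex (iter n2 (@rho n))) /=; last first.
  exact: onW_bij (rho_iter_bij n n2).
by apply: eq_bigl => tau; rewrite e_rho_iter (inj_eq (bij_inj (rho_iter_bij n n2))).
Qed.

Lemma Eop_Phi_l (p s1 : NC n1) (s2 : NC n2) (i : 'I_n1.*2) :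
    (i.+1 < n1.*2)%N -> ~~ opener p i -> opener p (ordS i) -> closers_le s1 (e i p) ->
  Eop q (iter n2 (@ordS n.*2) (lblock n2 i)) (Phi s1 s2) = \sum_(t | e i t == s1) Phi t s2.
Proof.
move=> i1 oi oj sp; rewrite Eop_Phi.
rewrite (eq_bigl _ _ (fun tau => preimage_concat_l _ _ i1 oi oj sp)).
rewrite big_imset; last by move=> x y _ _; exact: concat_inj_l.
by apply: eq_bigl => t; rewrite inE.
Qed.

Lemma Eop_Phi_r (p s2 : NC n2) (s1 : NC n1) (i : 'I_n2.*2) :
    (i.+1 < n2.*2)%N -> ~~ opener p i -> opener p (ordS i) -> closers_le s2 (e i p) ->
  Eop q (iter n2 (@ordS n.*2) (rblock n1 i)) (Phi s1 s2) = \sum_(t | e i t == s2) Phi s1 t.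
Proof.
move=> i1 oi oj sp; rewrite Eop_Phi.
rewrite (eq_bigl _ _ (fun tau => preimage_concat_r _ _ i1 oi oj sp)).
rewrite big_imset; last by move=> x y _ _; exact: concat_inj_r.
by apply: eq_bigl => t; rewrite inE.
Qed.

Lemma Dint_l (i : 'I_n1.*2) f : Dint q (n%:Z + i.+1%:Z - n1%:Z) f =
  Dop q (iter n2 (@ordS n.*2) (lblock n2 i)) f.
Proof.
apply: Dint_ord; rewrite iter_ordS /=.
have -> : (n%:Z + i.+1%:Z - n1%:Z - 1 = (i + n2)%N%:Z)%R by lia.
by rewrite modz_nat.
Qed.

Lemma Dint_r (i : 'I_n2.*2) f : Dint q (0 + i.+1%:Z - n2%:Z) f =
  Dop q (iter n2 (@ordS n.*2) (rblock n1 i)) f.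
Proof.
apply: Dint_ord; rewrite iter_ordS /=.
(* The index may be nonpositive; one period 2n moves it to the rotated position in the right
   block. *)
rewrite -(modzDr (0 + i.+1%:Z - n2%:Z - 1)).
have -> : (0 + i.+1%:Z - n2%:Z - 1 + n.*2%:Z = (n1.*2 + i + n2)%N%:Z)%R by lia.
by rewrite modz_nat.
Qed.

Lemma expands_l (p1 : NC n1) :
  expands (fun t2 => t2 = rainbow n2) Phi p1 (rainbow n2)
    (Dprod q (word n%:Z (lam p1)) (Psi_rainbow n q)).
Proof.
elim/weight_ind: p1 => p IH; have [->|pR] := eqVneq p (rainbow n1).
  rewrite lam_rainbow /=.
  exists (fun t1 t2 => ((t1 == rainbow n1) && (t2 == rainbow n2))%:R); split.
  - move=> t1 t2; have [->|n1'] := eqVneq t1 (rainbow n1); last by rewrite eqxx.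
    have [->|n2'] := eqVneq t2 (rainbow n2); last by rewrite eqxx.
    by split=> // k.
  - by rewrite !eqxx.
  rewrite (bigD1 (rainbow n1)) //= [X in _ + X]big1 ?addr0 => [|t /negPf ne].
    rewrite (bigD1 (rainbow n2)) //= [X in _ + X]big1 ?addr0 => [|t /negPf ne].
      by rewrite !eqxx /= scale1r /Phi rho_concat_rainbow; case: hPsi => ->.
    by rewrite ne andbF scale0r.
  by rewrite big1 // => k _; rewrite ne scale0r.
have [i [i1 oi oj _ hw]] := last_box pR.
rewrite hw /= Dint_l; apply: (expands_Dop i1 oi oj) => [s k|]; last first.
  by apply: IH; [exact: e_valley_le | exact: valley_neq].
exact: Eop_Phi_l.
Qed.

(** By [lam_nest] the starting polynomial is the one expanded in [expands_l]; the boxes of p2 are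
    then added one by one. *)
Lemma expands_r (p1 : NC n1) (p2 : NC n2) :
  expands (fun t1 => closers_le t1 p1) (fun t2 t1 => Phi t1 t2) p2 p1 (D_pair q p1 p2).
Proof.
rewrite /D_pair /D_single lam_nest; elim/weight_ind: p2 => p IH.
have [->|pR] := eqVneq p (rainbow n2).
  rewrite lam_rainbow /=; have [c [hc c1 ->]] := expands_l p1.
  exists (fun t2 t1 => c t1 t2); split=> // [t2 t1 /hc [h ->]|]; first by split.
  by rewrite exchange_big.
have [i [i1 oi oj _ hw]] := last_box pR.
rewrite hw /= Dint_r; apply: (expands_Dop i1 oi oj) => [s k|]; last first.
  by apply: IH; [exact: e_valley_le | exact: valley_neq].
exact: Eop_Phi_r.
Qed.

Definition spanned (P : NC n1 -> NC n2 -> Prop) (f : {mpoly F[n.*2]}) : Prop :=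
  exists c : NC n1 -> NC n2 -> int, (forall t1 t2, c t1 t2 != 0 -> P t1 t2) /\
    f = \sum_t1 \sum_t2 (c t1 t2)%:~R *: D_pair q t1 t2.

Lemma spanned0 P : spanned P 0.
Proof.
exists (fun _ _ => 0); split=> [t1 t2|]; first by rewrite eqxx.
by rewrite big1 // => t1 _; rewrite big1 // => t2 _; rewrite scale0r.
Qed.

Lemma spannedD P f g : spanned P f -> spanned P g -> spanned P (f + g).
Proof.
move=> [c [hc ->]] [d [hd ->]]; exists (fun t1 t2 => c t1 t2 + d t1 t2); split.
  move=> t1 t2; have [e0|/hc //] := eqVneq (c t1 t2) 0.
  by rewrite e0 add0r => /hd.
rewrite -big_split; apply: eq_bigr => t1 _; rewrite -big_split; apply: eq_bigr => t2 _.
by rewrite rmorphD scalerDl.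
Qed.

Lemma spannedZ P (z : int) f : spanned P f -> spanned P (z%:~R *: f).
Proof.
move=> [c [hc ->]]; exists (fun t1 t2 => z * c t1 t2); split.
  by move=> t1 t2; rewrite mulf_eq0 negb_or => /andP [_ /hc].
rewrite scaler_sumr; apply: eq_bigr => t1 _; rewrite scaler_sumr; apply: eq_bigr => t2 _.
by rewrite scalerA -rmorphM.
Qed.

(** Inverts the unitriangular integer system of [expands_r] by induction on the total weight. *)
Lemma Phi_expansion (p1 : NC n1) (p2 : NC n2) :
  exists c : NC n1 -> NC n2 -> int,
    [/\ forall t1 t2, c t1 t2 != 0 -> closers_le t1 p1 /\ closers_le t2 p2,
      c p1 p2 = 1
      & Phi p1 p2 = \sum_t1 \sum_t2 (c t1 t2)%:~R *: D_pair q t1 t2].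
Proof.
have [m] := ubnP (weight p1 + weight p2); elim: m p1 p2 => // m IH p1 p2 hm.
have [c [hc c1 hD]] := expands_r p1 p2.
pose P t1 t2 := [/\ closers_le t1 p1, closers_le t2 p2 & (t1, t2) != (p1, p2)].
have tail : spanned P (D_pair q p1 p2 - Phi p1 p2).
  rewrite hD exchange_big pair_big /= (bigD1 (p1, p2)) //= c1 scale1r.
  rewrite [X in spanned _ X]addrC addKr.
  apply: big_ind => [||[t1 t2] /= ne]; [exact: spanned0 | exact: spannedD |].
  have [->|/hc [h2 h1]] := eqVneq (c t2 t1) 0; first by rewrite scale0r; exact: spanned0.
  apply: spannedZ; have [|d [hd d1 ->]] := IH t1 t2.
    rewrite -ltnS; apply: leq_trans hm; rewrite ltnS.
    have [e1|n1'] := eqVneq t1 p1; last first.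
      by rewrite -addSn leq_add ?weight_lt // leq_sum.
    have [e2|n2'] := eqVneq t2 p2; first by rewrite e1 e2 eqxx in ne.
    by rewrite e1 ltn_add2l weight_lt.
  exists d; split=> // s1 s2 /hd [l1 l2]; split.
  - by move=> x; exact: leq_trans (l1 x) (h1 x).
  - by move=> x; exact: leq_trans (l2 x) (h2 x).
  apply: contraNneq ne => -[e1 e2]; rewrite e1 in l1; rewrite e2 in l2.
  by rewrite (closers_le_anti h1 l1) (closers_le_anti h2 l2).
have [d [hd dE]] := tail.
exists (fun t1 t2 => ((t1 == p1) && (t2 == p2))%:R - d t1 t2); split.
- move=> t1 t2; have [e0|/hd [l1 l2 _]] := eqVneq (d t1 t2) 0; last by [].
  rewrite e0 subr0; have [->|n1'] := eqVneq t1 p1; last by rewrite eqxx.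
  have [->|n2'] := eqVneq t2 p2; last by rewrite eqxx.
  by split=> k.
- rewrite !eqxx; have [->|/hd [_ _]] := eqVneq (d p1 p2) 0; first by rewrite subr0.
  by rewrite eqxx.
have -> : Phi p1 p2 = D_pair q p1 p2 - (D_pair q p1 p2 - Phi p1 p2).
  by rewrite opprB addrC subrK.
rewrite dE; under [RHS]eq_bigr => t1 _.
  under eq_bigr => t2 _ do rewrite rmorphB scalerBl.
  rewrite sumrB; over.
rewrite sumrB; congr (_ - _).
rewrite (bigD1 p1) //= [X in _ = _ + X]big1 ?addr0 => [|t1 /negPf ne].
  rewrite (bigD1 p2) //= [X in _ = _ + X]big1 ?addr0 => [|t2 /negPf ne].
    by rewrite !eqxx scale1r.
  by rewrite ne andbF scale0r.
by rewrite big1 // => t2 _; rewrite ne scale0r.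
Qed.

End TwoBlocks.

(** * Specialisation to q = e^(2 pi i / 3) *)

Lemma omega_root (C : numClosedFieldType) : omega C ^+ 2 + omega C + 1 = 0.
Proof.
have s3 : sqrtC (3 : C) ^+ 2 = 3 by rewrite sqrtCK.
have i2 : 'i ^+ 2 = -1 :> C by rewrite sqrCi.
rewrite /omega; set s := sqrtC _ in s3 *; set j := 'i in i2 *.
have -> : ((-1 + j * s) / 2) ^+ 2 + (-1 + j * s) / 2 + 1 = (3 + j ^+ 2 * s ^+ 2) / 4 by field.
by rewrite i2 s3 mulN1r subrr mul0r.
Qed.

Lemma omega_neq1 (C : numClosedFieldType) : omega C != 1.
Proof.
apply/eqP => h; have := omega_root C; rewrite h expr1n => /eqP.
by have -> : 1 + 1 + 1 = 3%:R :> C; [ring | rewrite pnatr_eq0].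
Qed.

Lemma in_Qadj_int (F : numFieldType) (q : F) (z : int) : in_Qadj q z%:~R.
Proof.
exists (z%:~R)%:P, 1; rewrite rmorph1 hornerC oner_neq0 divr1; split=> //.
by rewrite map_polyC hornerC /= ratr_int.
Qed.

Theorem theorem15 (C : numClosedFieldType)
    (Psi : forall n : nat, NC n -> {mpoly C[n.*2]})
    (hPsi : forall n : nat, is_Psi (omega C) (@Psi n))
    (n1 n2 : nat) (p1 : NC n1) (p2 : NC n2) :
  let p := concat p1 p2 in
  let Phi := Psi (n1 + n2)%N (iter n2 (@rho (n1 + n2)%N) p) in
  [/\ wheel (omega C) Phi,
      Phi = rotate_vars n2 (Psi (n1 + n2)%N p)
    & exists c : NC n1 -> NC n2 -> C,
        [/\ forall t1 t2, in_Qadj (omega C) (c t1 t2),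
            c p1 p2 = 1
          & Phi = \sum_(t1 : NC n1 | NCle t1 p1) \sum_(t2 : NC n2 | NCle t2 p2)
                    c t1 t2 *: D_pair (omega C) t1 t2]].
Proof.
move=> p Phi0; have qE := omega_root C; have q1 := omega_neq1 C.
split.
- by apply: (inW_wheel qE); apply: (Psi_inW qE q1 (hPsi _)).
- exact: (Psi_rho_iter qE q1 (hPsi _)).
have [c [hc c1 hP]] := Phi_expansion qE q1 (hPsi (n1 + n2)%N) p1 p2.
exists (fun t1 t2 => (c t1 t2)%:~R); split=> [t1 t2||].
- exact: in_Qadj_int.
- by rewrite c1.
(* The coefficients vanish off [closers_le], so restricting the sums to [NCle] loses only zero
   terms. *)
rewrite /Phi0 -[Psi _ _]/(Phi (Psi (n1 + n2)%N) p1 p2) hP [RHS]big_mkcond.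
apply: eq_bigr => t1 _; have [h1|h1] := boolP (NCle t1 p1).
  rewrite [RHS]big_mkcond; apply: eq_bigr => t2 _; case: ifPn => // h2.
  have [->|/hc [_ l2]] := eqVneq (c t1 t2) 0; first by rewrite scale0r.
  by move: h2; rewrite closers_le_NCle.
rewrite big1 // => t2 _.
have [->|/hc [l1 _]] := eqVneq (c t1 t2) 0; first by rewrite scale0r.
by move: h1; rewrite closers_le_NCle.
Qed.
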